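(* Fix an integer $k\ge 1$, a ratio $\xi>0$, and a constant $\gamma\ge\max\{1,\xi^{-1}\}$. There exist a constant $C>0$, depending only on $\xi,\gamma$ if $k=1$ and only on $\xi,\gamma,k$ if $k\ge2$, and an integer $N$ depending only on $\xi,\gamma,k$, such that the following holds for all $n\ge N$ (with $m=\xi n$ an integer). Let $\mathsf R\in[0,\gamma]^n$ and let $\overline{\mathsf R}=(\overline r,\dots,\overline r)\in\mathbb R^n$ with $\overline r=\|\mathsf R\|_1/n$. If $\|\mathsf R-\overline{\mathsf R}\|_1>\theta n$, where $\theta>C(\log n/n)^{1/3}$ in case $k=1$ and $\theta>C(1/n)^{\frac{1}{4(k+1)}}$ in case $k\ge2$, then $\mu_m(\overline{\mathsf R})>\mu_m(\mathsf R)$.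
   Context: Model: supply locations $s_1,\dots,s_n$ and demand locations $d_1,\dots,d_m$ are drawn independently and uniformly from $[0,1]^k$, with $\xi=m/n$ fixed. Given a service range vector $\mathsf R=(r_1,\dots,r_n)\in\mathbb R_{\ge0}^n$, the random bipartite graph $G\sim\mathbb G(m,\mathsf R)$ has vertex classes $[n]$ (supply) and $[m]$ (demand), and supply $i$ is adjacent to demand $j$ iff $\|s_i-d_j\|_2\le (r_i/n)^{1/k}$. $M(G)$ denotes the size of a maximum matching of $G$, and $\mu_m(\mathsf R)=\mathbb E_{G\sim\mathbb G(m,\mathsf R)}[M(G)]$. *)

(* Defs.v *)
From HB Require Import structures.
From mathcomp Require Import all_boot all_order all_algebra.
From mathcomp Require Import all_classical all_reals all_analysis.

Set Implicit Arguments.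
Unset Strict Implicit.
Unset Printing Implicit Defensive.

Import Order.TTheory GRing.Theory Num.Theory.
Import numFieldNormedType.Exports.

Local Open Scope classical_set_scope.
Local Open Scope ring_scope.

Section power_probability.
Context (d : measure_display) (T : measurableType d).

Definition cons_pair (n : nat) (x : T * n.-tuple T) : n.+1.-tuple T :=
  [tuple of x.1 :: x.2].

Lemma measurable_cons_pair (n : nat) :
  measurable_fun [set: T * n.-tuple T] (@cons_pair n).
Proof. exact: (measurable_cons measurable_fst measurable_snd). Qed.

HB.instance Definition _ (n : nat) :=
  isMeasurableFun.Build _ _ _ _ (@cons_pair n) (@measurable_cons_pair n).

Context (R : realType) (P : probability T R).

(* [pow_prob n] is the n-fold product P \x ... \x P, i.e. the joint law of n
   independent random elements of law P; [pow_prob_box] below is the product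
   rule that characterizes it. *)
Fixpoint pow_prob (n : nat) : probability (n.-tuple T) R :=
  if n is n'.+1 then distribution (P \x pow_prob n')%E (@cons_pair n')
  else \d_ [tuple].

Lemma measurable_tuple_box (n : nat) (A : 'I_n -> set T) :
  (forall i, measurable (A i)) ->
  measurable [set t : n.-tuple T | forall i, A i (tnth t i)].
Proof.
move=> mA.
rewrite (_ : [set _ | _] =
    \bigcap_(i in [set: 'I_n]) ((@tnth _ T ^~ i) @^-1` A i)); last first.
  by apply/seteqP; split=> [t At i _|t At i]; exact: At.
apply: fin_bigcap_measurable => // i _.
by rewrite -[X in measurable X]setTI; exact: measurable_tnth.
Qed.

Lemma pow_prob_box (n : nat) (A : 'I_n -> set T) :
  (forall i, measurable (A i)) ->
  pow_prob n [set t | forall i, A i (tnth t i)] = (\prod_(i < n) P (A i))%E.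
Proof.
elim: n A => [|n IH] A mA.
  rewrite big_ord0 /= /dirac /= indicE mem_set//; by case.
pose B (i : 'I_n) : set T := A (lift ord0 i).
rewrite big_ord_recl /= /distribution /pushforward /=.
rewrite (_ : _ @^-1` _ = A ord0 `*`
    [set t : n.-tuple T | forall i, B i (tnth t i)]); last first.
  apply/seteqP; split=> [[x t] /= At|[x t] /= [Ax Bt] i].
    split; first exact: (At ord0).
    by move=> i; have := At (lift ord0 i); rewrite tnthS.
  by case: (unliftP ord0 i) => [j ->|->] //; rewrite tnthS; exact: Bt.
have mB i : measurable (B i) by exact: mA.
rewrite product_measure1E//; last exact: (measurable_tuple_box mB).
by congr (_ * _)%E; exact: (IH B mB).
Qed.

End power_probability.

Section matching.
Context (n m : nat) (adj : 'I_n -> 'I_m -> bool).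

Definition is_matching (E : {set 'I_n * 'I_m}) : bool :=
  [forall e in E, adj e.1 e.2] &&
  [forall e in E, forall f in E,
     (e != f) ==> (e.1 != f.1) && (e.2 != f.2)].

Definition max_matching : nat :=
  \max_(E : {set 'I_n * 'I_m} | is_matching E) #|E|.

End matching.

Section model.
Context (R : realType).

(* [measurableTypeR R] is R itself with its Borel sigma-algebra, under the
   display used by [uniform_prob]. *)
Definition unif_cube (k : nat) : probability (k.-tuple (measurableTypeR R)) R :=
  pow_prob (uniform_prob (@ltr01 R)) k.

Definition dist2 (k : nat) (x y : k.-tuple R) : R :=
  Num.sqrt (\sum_(i < k) (tnth x i - tnth y i) ^+ 2).

Definition l1norm (n : nat) (v : 'rV[R]_n) : R := \sum_(i < n) `|v ord0 i|.

Definition service_adj (k n m : nat) (r : 'rV[R]_n)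
    (s : n.-tuple (k.-tuple R)) (d : m.-tuple (k.-tuple R))
    (i : 'I_n) (j : 'I_m) : bool :=
  dist2 (tnth s i) (tnth d j) <= (r ord0 i / n%:R) `^ (k%:R^-1).

Definition locations (k n m : nat) :
    probability (n.-tuple (k.-tuple (measurableTypeR R)) *
                 m.-tuple (k.-tuple (measurableTypeR R)))%type R :=
  (pow_prob (unif_cube k) n \x pow_prob (unif_cube k) m)%E.

Definition mu (k n m : nat) (r : 'rV[R]_n) : \bar R :=
  ('E_(locations k n m)[fun sd =>
     (max_matching (service_adj r sd.1 sd.2))%:R])%E.

Definition deviation_rate (k n : nat) : R :=
  if k == 1%N then (ln n%:R / n%:R) `^ (3^-1)
  else n%:R^-1 `^ ((4 * k.+1)%:R^-1).

End model.

(* Main.v *)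
(* As a function of the range of a single supply, the expected matching size is
   a constant plus the expected volume of the union of the balls around the
   demands left uncovered by some maximum matching of the rest. Contracting each
   Voronoi cell towards its centre shows that the volume gained between radii
   [r1] and [r2] shrinks by at most [l ^+ k] when both radii are multiplied by
   [l]; in terms of ranges this forces concavity, and pairs of demands that
   share a neighbourhood of the supply make it uniformly strict. So replacing
   independent uniform draws from the entries of [R] by their average, one
   coordinate at a time, gains at least a constant times the variance per
   coordinate.

   It remains to compare [R], that is sampling its entries without replacement,
   with independent sampling. Each exchange step involves two supplies, and
   costs nothing when no edge joins the two sides of some splitting of the
   vertices that separates them. For [k = 1] an empty interval of demands
   between the two supplies provides the splitting, with high probability once
   about [n^(1/3)] such intervals fit between them. For [k >= 2] the edges near
   the walls of a partition of the cube into slabs are deleted first, at a cost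
   proportional to the volume near the walls. *)
From HB Require Import structures.
From mathcomp Require Import all_boot all_order all_algebra fingroup perm.
From mathcomp Require Import all_classical all_reals all_analysis.
From mathcomp Require Import measurable_realfun ring lra.
Require Import Defs.

Set Implicit Arguments.
Unset Strict Implicit.
Unset Printing Implicit Defensive.

Import Order.TTheory GRing.Theory Num.Theory.
Import numFieldNormedType.Exports.

Local Open Scope classical_set_scope.
Local Open Scope ring_scope.

(** * Means of bounded measurable functions *)

(** Contraction only compares radii in a fixed ratio, so concavity is first obtained as a condition
    on the values at [c / q], [c] and [c * q], which linear functions satisfy with equality. Its
    strict form has a coefficient bounded below for large [n]: a given location falls near a given
    point with probability of order [1 / n], so with positive probability exactly two demands lie
    near a point and nothing else does. The averaging gain is therefore of order [theta^2 n].

    Against it stands [n] times the probability that two supplies cannot be separated. Let [rho] be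
    the largest radius, of order [n^(-1/k)]. When [k = 1], an interval of width [2 * rho] expects
    boundedly many demands and is empty with positive probability. When [k >= 2], a slab of that
    width expects about [n^(1 - 1/k)] demands, so empty slabs are too rare and separation is forced
    by deleting edges. With walls at spacing [1 / b] the loss is about [n (1 / b + b rho)], least
    for [b] near [rho^(-1/2)]; per supply this is [n^(-1/(2k))], within the square of the deviation
    rate. *)

Section finite_information.
Context d d' (T : measurableType d) (V : measurableType d').

(* Every random object below is determined by finitely many comparisons, so
   this is the only measurability argument needed for it. *)
Lemma measurable_fun_of_bools (I : finType) (b : I -> T -> bool) (f : T -> V) :
  (forall i, measurable_fun setT (b i)) ->
  (forall x y, (forall i, b i x = b i y) -> f x = f y) ->
  measurable_fun setT f.
Proof.
move=> mb fb _ Y mY; rewrite setTI.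
pose cell (g : {ffun I -> bool}) := \bigcap_(i in [set: I]) (b i @^-1` [set g i]).
pose S := [set g : {ffun I -> bool} | exists x, Y (f x) /\ cell g x].
rewrite (_ : _ @^-1` _ = \bigcup_(g in S) cell g).
  apply: fin_bigcup_measurable => // g _.
  apply: fin_bigcap_measurable => // i _.
  by rewrite -[X in measurable X]setTI; exact: mb.
apply/seteqP; split=> [x /= Yx|x [g [y [Yy gy]] gx]] /=.
  exists [ffun i => b i x] => [|i _ /=]; last by rewrite ffunE.
  by exists x; split=> // i _ /=; rewrite ffunE.
by rewrite (fb x y)// => i; rewrite (gx i Logic.I) (gy i Logic.I).
Qed.

End finite_information.

Lemma ler_bool (R : realType) (b c : bool) : (b -> c) -> b%:R <= c%:R :> R.
Proof. by case: b => [->|]. Qed.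

Lemma sum_cst (R : realType) (I : finType) (a : R) :
  \sum_(i : I) a = #|I|%:R * a.
Proof. by rewrite sumr_const mulr_natl. Qed.

Section mean.
Context d (T : measurableType d) (R : realType).
Implicit Types (P : probability T R) (f g : T -> R) (b : T -> bool).

(** Boundedness, unlike integrability, is stable under products and independent of the measure, and
    every function averaged below is bounded. *)
Definition bounded_measurable f :=
  measurable_fun setT f /\ exists B : R, forall x, `|f x| <= B.

Definition mean P f : R := Rintegral P setT f.

Lemma bm_integrable P f : bounded_measurable f ->
  P.-integrable setT (EFin \o f).
Proof.
move=> [mf [B fB]]; apply: measurable_bounded_integrable => //.
  by apply: le_lt_trans (ltry 1); exact: probability_le1.
exists B; split; first exact: num_real.
by move=> M BM x _; exact: le_trans (fB x) (ltW BM).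
Qed.
Arguments bm_integrable : clear implicits.

Lemma bm_cst (c : R) : bounded_measurable (fun=> c).
Proof. by split=> //; exists `|c|. Qed.

Lemma bm_bool b : measurable_fun setT b ->
  bounded_measurable (fun x => (b x)%:R).
Proof.
move=> mb; split; last by exists 1 => x; case: (b x); rewrite ?normr1 ?normr0.
apply: (@measurable_fun_of_bools _ _ _ _ unit (fun=> b)) => // x y e.
by rewrite (e tt).
Qed.

Lemma bmD f g : bounded_measurable f -> bounded_measurable g ->
  bounded_measurable (fun x => f x + g x).
Proof.
move=> [mf [B fB]] [mg [C gC]]; split; first exact: measurable_funD.
by exists (B + C) => x; rewrite (le_trans (ler_normD _ _))// lerD.
Qed.

Lemma bmM f g : bounded_measurable f -> bounded_measurable g ->
  bounded_measurable (fun x => f x * g x).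
Proof.
move=> [mf [B fB]] [mg [C gC]]; split; first exact: measurable_funM.
by exists (B * C) => x; rewrite normrM ler_pM.
Qed.

Lemma bmZ (c : R) f : bounded_measurable f ->
  bounded_measurable (fun x => c * f x).
Proof. by move=> bf; apply: bmM => //; exact: bm_cst. Qed.

Lemma bmN f : bounded_measurable f -> bounded_measurable (fun x => - f x).
Proof.
by move=> /(bmZ (-1)) h; rewrite (_ : (fun _ => _) = fun x => -1 * f x)//;
  apply/funext => x; rewrite mulN1r.
Qed.

Lemma bmB f g : bounded_measurable f -> bounded_measurable g ->
  bounded_measurable (fun x => f x - g x).
Proof. by move=> bf /bmN; exact: bmD. Qed.

Lemma bm_sum (I : Type) (r : seq I) (Q : pred I) (F : I -> T -> R) :
  (forall i, Q i -> bounded_measurable (F i)) ->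
  bounded_measurable (fun x => \sum_(i <- r | Q i) F i x).
Proof.
move=> bF; elim: r => [|i r IH].
  by under eq_fun do rewrite big_nil; exact: bm_cst.
under eq_fun do rewrite big_cons.
by case: (boolP (Q i)) => // Qi; apply: bmD => //; exact: bF.
Qed.

Lemma eq_mean P f g : f =1 g -> mean P f = mean P g.
Proof. by move=> /funext ->. Qed.

Lemma mean_cst P (c : R) : mean P (fun=> c) = c.
Proof. by rewrite /mean Rintegral_cst//= probability_setT mulr1. Qed.

Lemma meanD P f g : bounded_measurable f -> bounded_measurable g ->
  mean P (fun x => f x + g x) = mean P f + mean P g.
Proof. by move=> *; apply: RintegralD => //; exact: bm_integrable. Qed.

Lemma meanZ P (c : R) f : bounded_measurable f ->
  mean P (fun x => c * f x) = c * mean P f.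
Proof. by move=> *; apply: RintegralZl => //; exact: bm_integrable. Qed.

Lemma meanB P f g : bounded_measurable f -> bounded_measurable g ->
  mean P (fun x => f x - g x) = mean P f - mean P g.
Proof. by move=> *; apply: RintegralB => //; exact: bm_integrable. Qed.

Lemma mean_le P f g : bounded_measurable f -> bounded_measurable g ->
  (forall x, f x <= g x) -> mean P f <= mean P g.
Proof. by move=> *; apply: le_Rintegral => //; exact: bm_integrable. Qed.

Lemma mean_sum P (I : Type) (r : seq I) (Q : pred I) (F : I -> T -> R) :
  (forall i, Q i -> bounded_measurable (F i)) ->
  mean P (fun x => \sum_(i <- r | Q i) F i x) =
  \sum_(i <- r | Q i) mean P (F i).
Proof.
move=> bF; elim: r => [|i r IH].
  by under eq_mean do rewrite big_nil; rewrite mean_cst big_nil.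
under eq_mean do rewrite big_cons; rewrite big_cons; case: ifPn => // Qi.
by rewrite meanD ?IH//; [exact: bF | exact: bm_sum].
Qed.

Lemma mean_ge0 P f : (forall x, 0 <= f x) -> 0 <= mean P f.
Proof. by move=> f0; exact: Rintegral_ge0. Qed.

Lemma mean_bool P b : measurable_fun setT b ->
  P [set x | b x] = (mean P (fun x => (b x)%:R))%:E.
Proof.
move=> mb.
have mB : measurable [set x | b x].
  rewrite (_ : [set x | b x] = setT `&` (b @^-1` [set true])).
    by apply: mb.
  by rewrite setTI; apply/seteqP; split.
rewrite /mean /Rintegral (_ : (fun x => _) = EFin \o \1_[set x | b x]).
  rewrite integral_indic// setIT fineK//.
  exact: fin_num_measure.
apply/funext => x /=; rewrite indicE; congr (_%:R%:E).
by case: (boolP (b x)) => bx; [rewrite mem_set | rewrite memNset//; apply/negP].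
Qed.

Lemma mean_bool_le1 P b : measurable_fun setT b ->
  mean P (fun x => (b x)%:R) <= 1.
Proof.
move=> mb; rewrite -[leRHS](mean_cst P); apply: mean_le.
- exact: bm_bool.
- exact: bm_cst.
- by move=> x; case: (b x).
Qed.

(** Adding [(B + C) (1 - b)] to [g] makes the inequality hold everywhere and leaves the mean of [g]
    unchanged. *)
Lemma mean_le_as P b f g : bounded_measurable f -> bounded_measurable g ->
  measurable_fun setT b -> mean P (fun x => (b x)%:R) = 1 ->
  (forall x, b x -> f x <= g x) -> mean P f <= mean P g.
Proof.
move=> bf bg mb b1 fg; have [[_ [B fB]] [_ [C gC]]] := (bf, bg).
have bN : bounded_measurable (fun x => (B + C) * (1 - (b x)%:R)).
  by apply: bmZ; apply: bmB; [exact: bm_cst | exact: bm_bool].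
have <- : mean P (fun x => g x + (B + C) * (1 - (b x)%:R)) = mean P g.
  rewrite meanD// meanZ ?meanB ?mean_cst ?b1 ?subrr ?mulr0 ?addr0//;
    [exact: bm_cst | exact: bm_bool | ].
  by apply: bmB; [exact: bm_cst | exact: bm_bool].
apply: mean_le => //; first exact: bmD.
move=> x; case: (boolP (b x)) => bx; first by rewrite subrr mulr0 addr0 fg.
rewrite subr0 mulr1 -lerBlDl lerD ?(le_trans (ler_norm _) (fB x))//.
by rewrite (le_trans _ (gC x))// -normrN ler_norm.
Qed.

End mean.
Arguments bm_cst {d T R}.

Section mean_product.
Context d1 d2 (T1 : measurableType d1) (T2 : measurableType d2) (R : realType).
Implicit Types (P : probability T1 R) (Q : probability T2 R).

Lemma bm_comp (X : T1 -> T2) (f : T2 -> R) : measurable_fun setT X ->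
  bounded_measurable f -> bounded_measurable (f \o X).
Proof.
move=> mX [mf [B fB]]; split; first exact: measurableT_comp.
by exists B => x; exact: fB.
Qed.

Lemma mean_distribution P (X : {mfun T1 >-> T2}) (f : T2 -> R) :
  bounded_measurable f -> mean (distribution P X) f = mean P (f \o X).
Proof.
move=> bf; rewrite /mean /Rintegral; congr fine.
rewrite integral_pushforward//.
  by case: bf => mf _; exact/measurable_EFinP.
by rewrite preimage_setT; apply: bm_integrable; exact: bm_comp.
Qed.

Lemma bm_pair1 (f : T1 * T2 -> R) x : bounded_measurable f ->
  bounded_measurable (fun y => f (x, y)).
Proof.
move=> [mf [B fB]]; split; last by exists B => y; exact: fB.
by apply: measurableT_comp => //; exact: measurable_pair1.
Qed.

Lemma bm_pair2 (f : T1 * T2 -> R) y : bounded_measurable f ->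
  bounded_measurable (fun x => f (x, y)).
Proof.
move=> [mf [B fB]]; split; last by exists B => x; exact: fB.
by apply: measurableT_comp => //; exact: measurable_pair2.
Qed.

End mean_product.

Section mean_product.
Context d1 d2 (T1 : measurableType d1) (T2 : measurableType d2) (R : realType).
Variables (P : probability T1 R) (Q : probability T2 R) (f : T1 * T2 -> R).
Hypothesis bf : bounded_measurable f.

Let intf : (P \x Q)%E.-integrable setT (EFin \o f).
Proof. exact: bm_integrable. Qed.

Lemma bm_mean1 : bounded_measurable (fun x => mean Q (fun y => f (x, y))).
Proof.
have [mf [B fB]] := bf; split.
  apply: (@measurableT_comp _ _ _ _ _ _ fine) => //.
  exact: (measurable_fubini_F intf).
exists B => x; apply: (@le_trans _ _ (mean Q (fun y => `|f (x, y)|))).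
  by apply: le_normr_Rintegral => //; apply: bm_integrable; exact: bm_pair1.
rewrite -[leRHS](mean_cst Q); apply: mean_le => //; last exact: bm_cst.
split; first by apply: measurableT_comp => //; case: (bm_pair1 x bf).
by exists B => y; rewrite normr_id.
Qed.

Lemma bm_mean2 : bounded_measurable (fun y => mean P (fun x => f (x, y))).
Proof.
have [mf [B fB]] := bf; split.
  apply: (@measurableT_comp _ _ _ _ _ _ fine) => //.
  exact: (measurable_fubini_G intf).
exists B => y; apply: (@le_trans _ _ (mean P (fun x => `|f (x, y)|))).
  by apply: le_normr_Rintegral => //; apply: bm_integrable; exact: bm_pair2.
rewrite -[leRHS](mean_cst P); apply: mean_le => //; last exact: bm_cst.
split; first by apply: measurableT_comp => //; case: (bm_pair2 y bf).
by exists B => x; rewrite normr_id.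
Qed.

Lemma mean_prod1 :
  mean (P \x Q)%E f = mean P (fun x => mean Q (fun y => f (x, y))).
Proof.
rewrite /mean /Rintegral; congr fine.
rewrite -(integral12_prod_meas1 intf); apply: eq_integral => x _.
rewrite /fubini_F fineK//; apply: integrable_fin_num => //.
by apply: bm_integrable; exact: bm_pair1.
Qed.

Lemma mean_prod2 :
  mean (P \x Q)%E f = mean Q (fun y => mean P (fun x => f (x, y))).
Proof.
rewrite /mean /Rintegral; congr fine.
rewrite -(integral21_prod_meas1 intf); apply: eq_integral => y _.
rewrite /fubini_G fineK//; apply: integrable_fin_num => //.
by apply: bm_integrable; exact: bm_pair2.
Qed.

End mean_product.

(** * Product laws: uniqueness, resampling and permutation of coordinates *)

Section tuple_laws.
Context d (T : measurableType d) (R : realType) (n : nat).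

(** Boxes are stable under intersection and generate the sigma-algebra of tuples. *)
Lemma tuple_measure_unique (m1 m2 : {measure set (n.-tuple T) -> \bar R}) :
  (m1 setT < +oo)%E ->
  (forall A : 'I_n -> set T, (forall i, measurable (A i)) ->
    m1 [set t | forall i, A i (tnth t i)] =
    m2 [set t | forall i, A i (tnth t i)]) ->
  forall B, measurable B -> m1 B = m2 B.
Proof.
move=> m1oo m12.
pose G := [set B | exists2 A : 'I_n -> set T, (forall i, measurable (A i)) &
  B = [set t : n.-tuple T | forall i, A i (tnth t i)]].
have GT : G setT.
  by exists (fun=> setT) => //; apply/seteqP; split.
apply: (measure_unique G (fun=> setT)) => //.
- apply/seteqP; split; last first.
    apply: smallest_sub; first exact: sigma_algebra_measurable.
    by move=> _ [A mA ->]; exact: measurable_tuple_box.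
  apply: smallest_sub; first exact: smallest_sigma_algebra.
  rewrite -bigcup_seq => B [i _ [A mA <-]]; apply: sub_sigma_algebra.
  exists (fun j => if j == i then A else setT) => [j|]; first by case: ifP.
  apply/seteqP; split=> [t [_ At] j|t At] /=.
    by case: eqP => [->|//]; exact: At.
  by split=> //; have := At i; rewrite eqxx.
- move=> _ _ [A mA ->] [A' mA' ->].
  exists (fun i => A i `&` A' i) => [i|]; first exact: measurableI.
  apply/seteqP; split=> [t [At At'] i|t At]; first by split.
  by split=> i; have [] := At i.
- by apply/seteqP; split=> // t _; exists 0%N.
- by move=> _ [A mA ->]; exact: m12.
Qed.

End tuple_laws.

Section pow_prob_theory.
Context d (T : measurableType d) (R : realType) (P : probability T R).
Context d' (S : measurableType d') (Q : probability S R) (n : nat).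

(** Any random tuple whose coordinates are independent of law [P] may stand for [pow_prob P n];
    overwriting a coordinate and permuting the coordinates are the two uses. *)
Lemma mean_pow_prob_eq (X : S -> n.-tuple T) (f : n.-tuple T -> R) :
  measurable_fun setT X ->
  (forall A : 'I_n -> set T, (forall i, measurable (A i)) ->
    Q [set s | forall i, A i (tnth (X s) i)] = (\prod_(i < n) P (A i))%E) ->
  bounded_measurable f ->
  mean (pow_prob P n) f = mean Q (f \o X).
Proof.
move=> mX boxX bf.
pose X' : {mfun S >-> n.-tuple T} :=
  HB.pack X (isMeasurableFun.Build _ _ _ _ X mX).
rewrite -[RHS](mean_distribution Q X' bf) /mean /Rintegral; congr fine.
apply: eq_measure_integral => B mB _.
apply: tuple_measure_unique => //.
  by apply: le_lt_trans (ltry 1); exact: probability_le1.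
by move=> A mA; rewrite [RHS](boxX A mA); exact: pow_prob_box.
Qed.

End pow_prob_theory.

Section resampling.
Context d (T : measurableType d) (R : realType) (P : probability T R) (n : nat).

Definition upd (i : 'I_n) (x : T) (t : n.-tuple T) : n.-tuple T :=
  [tuple if j == i then x else tnth t j | j < n].

Lemma tnth_upd i x t j : tnth (upd i x t) j = if j == i then x else tnth t j.
Proof. by rewrite tnth_mktuple. Qed.

Lemma measurable_upd i :
  measurable_fun setT (fun p : n.-tuple T * T => upd i p.2 p.1).
Proof.
apply/measurable_fun_tnthP => j.
rewrite (_ : _ \o _ = fun p => if j == i then p.2 else tnth p.1 j).
  case: eqP => [_|_]; first exact: measurable_snd.
  apply: (measurableT_comp (f := fun t : n.-tuple T => tnth t j)).
    exact: measurable_tnth.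
  exact: measurable_fst.
by apply/funext => p /=; rewrite tnth_upd.
Qed.

Lemma bm_upd (f : n.-tuple T -> R) i : bounded_measurable f ->
  bounded_measurable (fun p : n.-tuple T * T => f (upd i p.2 p.1)).
Proof. by apply: bm_comp; exact: measurable_upd. Qed.

(** Overwriting one coordinate by an independent draw preserves the law. This is how one conditions
    on all other coordinates. *)
Lemma mean_resample (f : n.-tuple T -> R) (i : 'I_n) : bounded_measurable f ->
  mean (pow_prob P n) f =
  mean (pow_prob P n) (fun t => mean P (fun x => f (upd i x t))).
Proof.
move=> bf.
rewrite -(mean_prod1 (pow_prob P n) P (bm_upd i bf)).
apply: (mean_pow_prob_eq (X := fun p => upd i p.2 p.1)) => //.
  exact: measurable_upd.
move=> A mA.
rewrite (_ : [set _ | _] =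
    [set t | forall j, (if j == i then setT else A j) (tnth t j)] `*` A i).
  have mA' j : measurable (if j == i then setT else A j) by case: ifP.
  have mB := measurable_tuple_box mA'.
  apply: etrans; first exact: (product_measure1E (pow_prob P n) P mB (mA i)).
  rewrite [RHS](bigD1 i)//= muleC; congr (_ * _)%E.
  apply: etrans; first exact: (pow_prob_box P mA').
  rewrite (bigD1 i)//= eqxx (probability_setT P) mul1e.
  by apply: eq_bigr => j /negbTE ->.
apply/seteqP; split=> [[t x] /= At|[t x] /= [At Ax] j].
  split; last by have := At i; rewrite tnth_upd eqxx.
  by move=> j; have := At j; rewrite tnth_upd; case: eqP.
by rewrite tnth_upd; have := At j; case: eqP => [->|].
Qed.

Definition permute (s : 'S_n) (t : n.-tuple T) : n.-tuple T :=
  [tuple tnth t (s i) | i < n].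

Lemma mean_permute (f : n.-tuple T -> R) (s : 'S_n) : bounded_measurable f ->
  mean (pow_prob P n) (f \o permute s) = mean (pow_prob P n) f.
Proof.
move=> bf; apply/esym/mean_pow_prob_eq => //.
  apply/measurable_fun_tnthP => j.
  rewrite (_ : _ \o _ = fun t => tnth t (s j)); first exact: measurable_tnth.
  by apply/funext => t /=; rewrite tnth_mktuple.
move=> A mA.
rewrite (_ : [set _ | _] = [set t | forall j, A ((s^-1)%g j) (tnth t j)]).
  apply: etrans; first exact: (pow_prob_box P (fun j => mA ((s^-1)%g j))).
  by rewrite [RHS](reindex_inj (@perm_inj _ (s^-1)%g)).
apply/seteqP; split=> [t At j|t At j].
  by have := At ((s^-1)%g j); rewrite tnth_mktuple permKV.
by rewrite tnth_mktuple; have := At (s j); rewrite permK.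
Qed.

End resampling.

(** * Homotheties and the uniform measure on the cube *)

Section homothety.
Context (R : realType) (k : nat).
Implicit Types (x y z u : k.-tuple R) (l : R).

Definition homothety u l x : k.-tuple R :=
  [tuple tnth u i + l * (tnth x i - tnth u i) | i < k].

Lemma homothetyK u l x : l != 0 -> homothety u l (homothety u l^-1 x) = x.
Proof.
move=> l0; apply: eq_from_tnth => i; rewrite !tnth_mktuple.
by rewrite [_ + l^-1 * _]addrC addrK mulrA divff// mul1r addrC subrK.
Qed.

Lemma dist2_ge0 x y : 0 <= dist2 x y.
Proof. exact: sqrtr_ge0. Qed.

Lemma dist2C x y : dist2 x y = dist2 y x.
Proof. by congr Num.sqrt; apply: eq_bigr => i _; rewrite -sqrrN opprB. Qed.

Lemma dist2_sqr x y : dist2 x y ^+ 2 = \sum_(i < k) (tnth x i - tnth y i) ^+ 2.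
Proof. by rewrite sqr_sqrtr// sumr_ge0// => i _; exact: sqr_ge0. Qed.

(** Lagrange's identity writes twice the difference of the two sides as a sum of squares. *)
Lemma cauchy_schwarz_sum (I : finType) (a b : I -> R) :
  (\sum_i a i * b i) ^+ 2 <= (\sum_i a i ^+ 2) * (\sum_i b i ^+ 2).
Proof.
rewrite -subr_ge0 -(pmulr_rge0 _ (ltr0Sn R 1)).
suff -> : 2 * ((\sum_i a i ^+ 2) * (\sum_i b i ^+ 2) - (\sum_i a i * b i) ^+ 2)
  = \sum_i \sum_j (a i * b j - a j * b i) ^+ 2.
  by apply: sumr_ge0 => i _; apply: sumr_ge0 => j _; exact: sqr_ge0.
have sumM (f g : I -> R) :
    (\sum_i f i) * (\sum_i g i) = \sum_i \sum_j f i * g j.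
  by rewrite big_distrl; apply: eq_bigr => i _; rewrite big_distrr.
rewrite mulrBr expr2 ![2 * _]mulrDl !mul1r {2}[(\sum_i a i ^+ 2) * _]mulrC !sumM.
rewrite -big_split -[_ + \sum_i _]big_split -sumrB/=; apply: eq_bigr => i _.
rewrite -big_split -[_ + \sum_i _]big_split -sumrB/=; apply: eq_bigr => j _.
by ring.
Qed.

Lemma dist2_triangle y x z : dist2 x z <= dist2 x y + dist2 y z.
Proof.
rewrite -(ler_pXn2r (ltn0Sn 1)) ?nnegrE ?addr_ge0 ?dist2_ge0//.
rewrite sqrrD !dist2_sqr.
pose a i := tnth x i - tnth y i; pose b i := tnth y i - tnth z i.
have -> : \sum_(i < k) (tnth x i - tnth z i) ^+ 2 =
    \sum_i a i ^+ 2 + (\sum_i a i * b i) *+ 2 + \sum_i b i ^+ 2.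
  rewrite -sumrMnl -!big_split/=; apply: eq_bigr => i _.
  by rewrite -sqrrD /a /b addrA subrK.
rewrite lerD2r lerD2l lerMn2r /=.
rewrite (le_trans (ler_norm _))// -sqrtr_sqr /dist2 -sqrtrM; last first.
  by apply: sumr_ge0 => i _; exact: sqr_ge0.
by rewrite ler_wsqrtr// cauchy_schwarz_sum.
Qed.

Lemma dist2_homothety u l x y : 0 <= l ->
  dist2 (homothety u l x) (homothety u l y) = l * dist2 x y.
Proof.
move=> l0; rewrite /dist2 -[in RHS](ger0_norm l0) -sqrtr_sqr -sqrtrM ?sqr_ge0//.
rewrite mulr_sumr; congr Num.sqrt; apply: eq_bigr => i _.
by rewrite !tnth_mktuple; ring.
Qed.

Lemma homothety_center u l : homothety u l u = u.
Proof. by apply: eq_from_tnth => i; rewrite tnth_mktuple subrr mulr0 addr0. Qed.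

Lemma dist2_homothety_center u l x : 0 <= l ->
  dist2 (homothety u l x) u = l * dist2 x u.
Proof. by move=> l0; rewrite -{2}(homothety_center u l) dist2_homothety. Qed.

Lemma dist2_homothety_id u l x : l <= 1 ->
  dist2 (homothety u l x) x = (1 - l) * dist2 x u.
Proof.
move=> l1; have l0 : 0 <= 1 - l by rewrite subr_ge0.
rewrite /dist2 -[in RHS](ger0_norm l0) -sqrtr_sqr -sqrtrM ?sqr_ge0//.
rewrite mulr_sumr; congr Num.sqrt; apply: eq_bigr => i _.
by rewrite !tnth_mktuple; ring.
Qed.

Lemma ler_coord_dist2 x y i : `|tnth x i - tnth y i| <= dist2 x y.
Proof.
rewrite -sqrtr_sqr /dist2 ler_wsqrtr// (bigD1 i)//= lerDl sumr_ge0// => j _.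
exact: sqr_ge0.
Qed.

(** The [k] squares add up to at most [r ^+ 2 / k]. Using [k] instead of its square root only
    affects constants. *)
Lemma dist2_le_coord x y (r : R) : (0 < k)%N ->
  (forall i, `|tnth x i - tnth y i| <= r / k%:R) -> dist2 x y <= r.
Proof.
move=> k0 h; have k1 : 1 <= k%:R :> R by rewrite ler1n.
have r0 : 0 <= r / k%:R by exact: le_trans (h (Ordinal k0)).
have r1 : 0 <= r by move: r0; rewrite pmulr_lge0// invr_gt0 (lt_le_trans ltr01).
rewrite -(ler_pXn2r (ltn0Sn 1)) ?nnegrE ?dist2_ge0// dist2_sqr.
apply: (@le_trans _ _ (\sum_(i < k) (r / k%:R) ^+ 2)).
  apply: ler_sum => i _; rewrite -[leLHS]real_normK ?num_real//.
  by rewrite ler_pXn2r ?nnegrE.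
rewrite sumr_const card_ord -[_ *+ k]mulr_natr.
have k_gt0 : 0 < k%:R :> R by rewrite ltr0n.
have -> : (r / k%:R) ^+ 2 * k%:R = r ^+ 2 / k%:R by field; rewrite gt_eqF.
by rewrite ler_piMr ?sqr_ge0// invf_le1.
Qed.

Definition in_cube x := [forall i, (0 <= tnth x i) && (tnth x i <= 1)].

Lemma in_cubeP x : reflect (forall i, 0 <= tnth x i <= 1) (in_cube x).
Proof. exact: forallP. Qed.

End homothety.

Section measurable_geometry.
Context d (T : measurableType d) (R : realType) (k : nat).
Implicit Types X Y : T -> k.-tuple (measurableTypeR R).

Lemma measurable_coord X i : measurable_fun setT X ->
  measurable_fun setT (fun w => tnth (X w) i : R).
Proof. by move=> mX; exact: (measurableT_comp (measurable_tnth i) mX). Qed.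

Lemma measurable_dist2 X Y : measurable_fun setT X -> measurable_fun setT Y ->
  measurable_fun setT (fun w => dist2 (X w) (Y w) : R).
Proof.
move=> mX mY; rewrite /dist2.
apply: (@measurableT_comp _ _ _ _ _ _ (@Num.sqrt R)).
  exact: continuous_measurable_fun (@sqrt_continuous R).
apply: measurable_sum => i; apply: measurable_funX.
by apply: measurable_funB; exact: measurable_coord.
Qed.

Lemma measurable_homothety X Y l : measurable_fun setT X ->
  measurable_fun setT Y ->
  measurable_fun setT
    (fun w => homothety (X w) l (Y w) : k.-tuple (measurableTypeR R)).
Proof.
move=> mX mY; apply/measurable_fun_tnthP => i.
rewrite (_ : _ \o _ = fun w => tnth (X w) i + l * (tnth (Y w) i - tnth (X w) i)).
  apply: measurable_funD; first exact: measurable_coord.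
  apply: measurable_funM => //.
  by apply: measurable_funB; exact: measurable_coord.
by apply/funext => w /=; rewrite tnth_mktuple.
Qed.

Lemma measurable_in_cube X : measurable_fun setT X ->
  measurable_fun setT (fun w => in_cube (X w : k.-tuple R)).
Proof.
move=> mX.
apply: (@measurable_fun_of_bools _ _ _ _ 'I_k
  (fun i w => (0 <= tnth (X w) i) && (tnth (X w) i <= 1))).
  move=> i; apply: measurable_and.
    by apply: measurable_fun_ler => //; exact: measurable_coord.
  by apply: measurable_fun_ler => //; exact: measurable_coord.
by move=> x y e; apply: eq_forallb.
Qed.

End measurable_geometry.

Section image_measure.
Context d1 d2 (T1 : measurableType d1) (T2 : measurableType d2) (R : realType).
Context (m : {measure set T1 -> \bar R}) (X : {mfun T1 >-> T2}).

(** The pushforward of a measure that need not be a probability, packaged as a measure so that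
    uniqueness theorems apply to it. *)
Definition image_measure : set T2 -> \bar R := pushforward m X.

Let image_measure0 : image_measure set0 = 0%E.
Proof. exact: measure0. Qed.

Let image_measure_ge0 A : (0 <= image_measure A)%E.
Proof. exact: measure_ge0. Qed.

Let image_measure_sigma_additive : semi_sigma_additive image_measure.
Proof. exact: measure_semi_sigma_additive. Qed.

HB.instance Definition _ := isMeasure.Build _ _ _ image_measure
  image_measure0 image_measure_ge0 image_measure_sigma_additive.

End image_measure.

Section uniform_measure.
Context (R : realType) (k : nat).
Local Notation TR := (measurableTypeR R).
Local Notation U1 := (uniform_prob (@ltr01 R)).
Local Notation U := (unif_cube R k).
Implicit Types (u x : k.-tuple R) (l : R).

Lemma uniform_probE (A : set TR) : measurable A ->
  U1 A = lebesgue_measure (A `&` `[0, 1]).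
Proof.
move=> mA; rewrite /uniform_prob integral_uniform_pdf.
transitivity (\int[lebesgue_measure]_(x in A `&` `[0%R, 1%R]) (1 : R)%:E)%E.
  apply: eq_integral => x /set_mem [_]; rewrite /= in_itv/= => x01.
  by rewrite /uniform_pdf x01 subr0 invr1.
by rewrite integral_cst ?mul1e//; exact: measurableI.
Qed.

Lemma lebesgue_measure_cc (a b : R) : a <= b ->
  lebesgue_measure (`[a, b]%classic : set TR) = (b - a)%:E.
Proof.
move=> ab; rewrite lebesgue_measure_itv/= lte_fin.
case: ltP => [_|ba]; first by rewrite EFinB.
by rewrite (le_anti (introT andP (conj ab ba))) subrr.
Qed.

Lemma uniform_prob_itv_le (a b : R) : a <= b -> (U1 `[a, b]%classic <= (b - a)%:E)%E.
Proof.
move=> ab; rewrite uniform_probE//.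
apply: (@le_trans _ _ (lebesgue_measure (`[a, b]%classic : set TR))).
  by apply: le_measure; rewrite ?inE//; apply: measurableI.
by rewrite lebesgue_measure_cc.
Qed.

Lemma uniform_prob_itvE (a b : R) : 0 <= a -> a <= b -> b <= 1 ->
  U1 `[a, b]%classic = (b - a)%:E.
Proof.
move=> a0 ab b1; rewrite uniform_probE// setIidl.
  by rewrite lebesgue_measure_cc.
move=> x /=; rewrite !in_itv/= => /andP[ax xb].
by rewrite (le_trans a0)//= (le_trans xb).
Qed.

Lemma measurable_affine (c l : R) :
  measurable_fun setT (fun x : TR => c + l * (x - c) : TR).
Proof.
apply: measurable_funD => //; apply: measurable_funM => //.
exact: measurable_funB.
Qed.

(** Scaled by [l^-1], the image of Lebesgue measure under the affine map agrees with Lebesgue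
    measure on half-open intervals, which determine it. *)
Lemma lebesgue_measure_affine (c l : R) (A : set TR) : 0 < l -> measurable A ->
  lebesgue_measure ((fun x : TR => c + l^-1 * (x - c) : TR) @^-1` A) =
  (l%:E * lebesgue_measure A)%E.
Proof.
move=> l0 mA.
pose X : {mfun TR >-> TR} := HB.pack (fun x : TR => c + l^-1 * (x - c) : TR)
  (isMeasurableFun.Build _ _ _ _ _ (measurable_affine c l^-1)).
have li0 : 0 <= l^-1 by rewrite invr_ge0 ltW.
pose m := mscale (NngNum li0) (image_measure lebesgue_measure X).
suff -> : lebesgue_measure A = m A.
  by rewrite /m /mscale/= muleA -EFinM divff ?gt_eqF// mul1e.
apply: lebesgue_measure_unique => // _ [[a b] _ <-] /=.
rewrite /m /mscale /image_measure /pushforward/=.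
rewrite (_ : _ @^-1` _ = `](c + l * (a - c)), (c + l * (b - c))]%classic); last first.
  have E (x : R) : (c + l * (a - c) < x <= c + l * (b - c)) =
      (a < c + l^-1 * (x - c) <= b).
    have {1 2}-> : x = c + l * (c + l^-1 * (x - c) - c).
      by field; rewrite gt_eqF.
    by rewrite ltrD2l lerD2l ltr_pM2l// ler_pM2l// ltrD2r lerD2r.
  by apply/seteqP; split=> x /=; rewrite !in_itv/= E.
rewrite !lebesgue_measure_itv/= !lte_fin ltrD2l ltr_pM2l// ltrD2r.
case: ifP => // _; last by rewrite mule0.
by rewrite -!EFinB -EFinM; congr EFin; field; rewrite gt_eqF.
Qed.

(** The preimage is the contraction towards [c] of the part of [A] in the unit interval. Its points
    are convex combinations of [c] and points of the interval, so truncation to the interval loses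
    nothing. *)
Lemma uniform_prob_affine (c l : R) (A : set TR) :
  0 < l -> l <= 1 -> 0 <= c -> c <= 1 -> measurable A ->
  U1 ((fun x : TR => c + l^-1 * (x - c) : TR) @^-1` (A `&` `[0, 1])) = (l%:E * U1 A)%E.
Proof.
move=> l0 l1 c0 c1 mA.
have mAI : measurable (A `&` `[0, 1]%classic : set TR) by exact: measurableI.
rewrite !uniform_probE//; last first.
  by rewrite -[X in measurable X]setTI; exact: measurable_affine.
rewrite -(lebesgue_measure_affine c l0 mAI) setIidl// => x /= [_].
rewrite !in_itv/= => /andP[h0 h1].
have -> : x = c * (1 - l) + l * (c + l^-1 * (x - c)) by field; rewrite gt_eqF.
have c' : 0 <= 1 - l by rewrite subr_ge0.
apply/andP; split; first by rewrite addr_ge0// mulr_ge0// ltW.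
rewrite [leRHS](_ : 1 = 1 * (1 - l) + l * 1); last by ring.
by rewrite lerD// ?ler_wpM2r// ler_wpM2l// ltW.
Qed.

Lemma prod_mule (I : Type) (r : seq I) (c : R) (F : I -> \bar R) :
  (forall i, 0 <= F i)%E -> 0 <= c ->
  (\prod_(i <- r) (c%:E * F i) = (c ^+ size r)%:E * \prod_(i <- r) F i)%E.
Proof.
move=> F0 c0; elim: r => [|i r IH]; first by rewrite !big_nil mule1.
by rewrite !big_cons IH/= exprS EFinM muleACA.
Qed.

Lemma unif_cube_in_cube :
  mean U (fun x => (in_cube (x : k.-tuple R))%:R) = 1.
Proof.
have mc : measurable_fun setT (fun x : k.-tuple TR => in_cube (x : k.-tuple R)).
  exact: (measurable_in_cube (X := id)).
apply: EFin_inj; rewrite -mean_bool//.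
have mI (i : 'I_k) : measurable (`[0, 1]%classic : set TR) by [].
rewrite (_ : [set _ | _] =
    [set x : k.-tuple TR | forall i, `[0, 1]%classic (tnth x i)]); last first.
  apply/seteqP; split=> x /=.
    by move=> /in_cubeP h i; have := h i; rewrite in_itv.
  by move=> h; apply/in_cubeP => i; have := h i; rewrite /= in_itv.
apply: etrans; first exact: (pow_prob_box _ mI).
by rewrite big1// => i _; rewrite [LHS]uniform_prob_itvE// subr0.
Qed.

Lemma unif_cube_homothety (u : k.-tuple R) l (B : set (k.-tuple TR)) :
  0 < l -> l <= 1 -> in_cube u -> measurable B ->
  (forall x, B x -> in_cube (x : k.-tuple R)) ->
  U ((homothety u l^-1 : k.-tuple TR -> k.-tuple TR) @^-1` B) =
  ((l ^+ k)%:E * U B)%E.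
Proof.
move=> l0 l1 /in_cubeP uc mB Bc.
have mH : measurable_fun setT (homothety u l^-1 : k.-tuple TR -> k.-tuple TR).
  exact: (measurable_homothety (X := fun=> u) (Y := id)).
pose X : {mfun k.-tuple TR >-> k.-tuple TR} := HB.pack
  (homothety u l^-1 : k.-tuple TR -> k.-tuple TR) (isMeasurableFun.Build _ _ _ _ _ mH).
pose C := [set x : k.-tuple TR | in_cube (x : k.-tuple R)].
have mC : measurable C.
  have := measurable_in_cube (X := @id (k.-tuple TR)) (@measurable_id _ _ _).
  by move=> /(_ measurableT [set true]); rewrite setTI; exact.
have mXC : measurable (homothety u l^-1 @^-1` C : set (k.-tuple TR)).
  by have := mH measurableT _ mC; rewrite setTI.
have lk0 : 0 <= l ^+ k by rewrite exprn_ge0// ltW.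
pose m1 := mscale (NngNum lk0) U.
(* The dilated cube sticks out of the cube. Restricting [U] to the points whose dilation stays
   inside makes the image equal to [l ^+ k] times [U] on every box. *)
pose m2 := image_measure (mrestr U mXC) X.
have m12 : m1 B = m2 B.
  apply: tuple_measure_unique => //.
    rewrite /m1 /mscale/=; apply: le_lt_trans (ltry (l ^+ k)).
    rewrite -[leRHS]mule1; apply: lee_wpmul2l; first by rewrite lee_fin.
    exact: probability_le1.
  move=> A mA.
  transitivity ((l ^+ k)%:E * \prod_(i < k) U1 (A i))%E.
    by rewrite /m1 /mscale/=; congr (_ * _)%E; exact: pow_prob_box.
  transitivity (U [set t | forall i, ((fun x : TR => tnth u i + l^-1 * (x - tnth u i) : TR) @^-1`
                            (A i `&` `[0, 1])) (tnth t i)]); last first.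
    apply/esym; rewrite /image_measure /pushforward /mrestr/=; congr (U _).
    apply/seteqP; split=> [t [/= At /in_cubeP Ct] i|t /= At].
      by have := Ct i; have := At i; rewrite tnth_mktuple in_itv.
    split=> [i|]; first by have [] := At i; rewrite tnth_mktuple.
    by apply/in_cubeP => i; have [] := At i; rewrite tnth_mktuple/= in_itv.
  have mA' (i : 'I_k) : measurable ((fun x : TR =>
      tnth u i + l^-1 * (x - tnth u i) : TR) @^-1` (A i `&` `[0, 1])).
    rewrite -[Y in measurable Y]setTI.
    by apply: measurable_affine => //; exact: measurableI.
  apply/esym/etrans; first exact: (pow_prob_box _ mA').
  transitivity (\prod_(i < k) (l%:E * U1 (A i)))%E.
    apply: eq_bigr => i _; have /andP[u0 u1] := uc i.
    exact: uniform_prob_affine.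
  by rewrite prod_mule ?ltW// /index_enum -enumT size_enum_ord.
rewrite -[RHS]/(m1 B) m12 /m2 /image_measure /pushforward /mrestr/=; congr (U _).
by apply/seteqP; split=> [x /= Bx|x /= []//]; split=> //; exact: Bc.
Qed.

End uniform_measure.

(** * Product events and volumes in the cube *)

Section product_events.
Context d (T : measurableType d) (R : realType) (P : probability T R) (n : nat).

Lemma measurable_forall_tnth (a : 'I_n -> T -> bool) :
  (forall i, measurable_fun setT (a i)) ->
  measurable_fun setT (fun t : n.-tuple T => [forall i, a i (tnth t i)]).
Proof.
move=> ma; apply: (@measurable_fun_of_bools _ _ _ _ 'I_n
  (fun i (t : n.-tuple T) => a i (tnth t i))).
  by move=> i; exact: (measurableT_comp (ma i) (measurable_tnth i)).
by move=> x y e; apply: eq_forallb.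
Qed.

Lemma measurable_true (b : T -> bool) :
  measurable_fun setT b -> measurable [set x | b x].
Proof. by move=> /(_ measurableT [set true]); rewrite setTI; exact. Qed.

Lemma mean_forall_tnth (a : 'I_n -> T -> bool) :
  (forall i, measurable_fun setT (a i)) ->
  mean (pow_prob P n) (fun t => [forall i, a i (tnth t i)]%:R) =
  \prod_(i < n) mean P (fun x => (a i x)%:R).
Proof.
move=> ma; apply: EFin_inj; rewrite -mean_bool; last exact: measurable_forall_tnth.
rewrite (_ : [set _ | _] =
    [set t : n.-tuple T | forall i, [set x | a i x] (tnth t i)]); last first.
  by apply/seteqP; split=> t /= /forallP.
apply: etrans; first exact: (pow_prob_box P (fun i => measurable_true (ma i))).
rewrite -prodEFin; apply: eq_bigr => i _.
by rewrite -mean_bool.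
Qed.

Lemma mean_tnth (f : T -> R) (i : 'I_n) : bounded_measurable f ->
  mean (pow_prob P n) (fun t => f (tnth t i)) = mean P f.
Proof.
move=> bf; rewrite (mean_resample P i); last first.
  exact: (bm_comp (X := fun t : n.-tuple T => tnth t i) (measurable_tnth i)).
under eq_mean do under eq_mean do rewrite tnth_upd eqxx.
by rewrite mean_cst.
Qed.

End product_events.

Section cube_volumes.
Context (R : realType) (k : nat).
Local Notation TR := (measurableTypeR R).
Local Notation U1 := (uniform_prob (@ltr01 R)).
Local Notation U := (unif_cube R k).
Implicit Types (u : k.-tuple R) (l rho : R).

Lemma mean_homothety u l (b : k.-tuple TR -> bool) :
  0 < l -> l <= 1 -> in_cube u -> measurable_fun setT b ->
  (forall x, b x -> in_cube (x : k.-tuple R)) ->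
  mean U (fun x => (b (homothety u l^-1 x))%:R) =
  l ^+ k * mean U (fun x => (b x)%:R).
Proof.
move=> l0 l1 uc mb bc.
have mH : measurable_fun setT (homothety u l^-1 : k.-tuple TR -> k.-tuple TR).
  exact: (measurable_homothety (X := fun=> u) (Y := id)).
have mbH : measurable_fun setT (b \o (homothety u l^-1 : k.-tuple TR -> k.-tuple TR)).
  exact: measurableT_comp mb mH.
apply: EFin_inj; rewrite EFinM -(mean_bool _ mb) -(mean_bool _ mbH).
exact: (unif_cube_homothety l0 l1 uc (measurable_true mb) bc).
Qed.

Definition in_box (x : k.-tuple R) rho (y : k.-tuple R) := [forall i, `|tnth y i - tnth x i| <= rho].

Lemma in_boxP x rho y :
  reflect (forall i, `|tnth y i - tnth x i| <= rho) (in_box x rho y).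
Proof. exact: forallP. Qed.

Lemma measurable_near (c rho : R) :
  measurable_fun setT (fun x : TR => `|x - c| <= rho).
Proof.
apply: measurable_fun_ler => //; apply: measurableT_comp => //.
exact: measurable_funB.
Qed.

Lemma measurable_in_box (x : k.-tuple R) rho :
  measurable_fun setT (fun y : k.-tuple TR => in_box x rho y).
Proof.
exact: (measurable_forall_tnth (fun i => measurable_near (tnth x i) rho)).
Qed.

Lemma set_near (c rho : R) :
  [set x : TR | `|x - c| <= rho] = `[c - rho, c + rho]%classic.
Proof. by apply/seteqP; split=> x /=; rewrite in_itv/= ler_distl. Qed.

Lemma mean_near_le (c rho : R) : 0 <= rho ->
  mean U1 (fun x => (`|x - c| <= rho)%R%:R) <= 2 * rho.
Proof.
move=> r0; rewrite -lee_fin -mean_bool; last exact: measurable_near.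
rewrite set_near (le_trans (uniform_prob_itv_le _))//.
  by rewrite lerD2l (le_trans _ r0)// oppr_le0.
by rewrite lee_fin; lra.
Qed.

Lemma mean_near_ge (c rho : R) : 0 <= rho -> rho <= c -> c <= 1 - rho ->
  mean U1 (fun x => (`|x - c| <= rho)%R%:R) = 2 * rho.
Proof.
move=> r0 rc c1; apply: EFin_inj; rewrite -mean_bool; last exact: measurable_near.
by rewrite set_near [LHS]uniform_prob_itvE; [congr EFin|..]; lra.
Qed.

Lemma mean_in_box_le (x : k.-tuple R) rho : 0 <= rho ->
  mean U (fun y => (in_box x rho y)%:R) <= (2 * rho) ^+ k.
Proof.
move=> r0.
rewrite (mean_forall_tnth U1 (a := fun i y => `|y - tnth x i| <= rho)); last first.
  by move=> i; exact: measurable_near.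
rewrite -[k in leRHS]card_ord -prodr_const; apply: ler_prod => i _.
by rewrite mean_near_le// mean_ge0.
Qed.

Lemma mean_in_box_ge (x : k.-tuple R) rho : 0 <= rho ->
  (forall i, rho <= tnth x i <= 1 - rho) ->
  mean U (fun y => (in_box x rho y)%:R) = (2 * rho) ^+ k.
Proof.
move=> r0 h.
rewrite (mean_forall_tnth U1 (a := fun i y => `|y - tnth x i| <= rho)); last first.
  by move=> i; exact: measurable_near.
rewrite -[k in RHS]card_ord -prodr_const; apply: eq_bigr => i _.
by have /andP[? ?] := h i; rewrite mean_near_ge.
Qed.

Lemma measurable_ball (x : k.-tuple R) rho :
  measurable_fun setT (fun y : k.-tuple TR => dist2 x (y : k.-tuple R) <= rho).
Proof.
by apply: measurable_fun_ler => //; exact: (measurable_dist2 (X := fun=> x) (Y := id)).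
Qed.

Lemma mean_ball_ge (x : k.-tuple R) rho : (0 < k)%N -> 0 <= rho ->
  (forall i, rho <= tnth x i <= 1 - rho) ->
  (2 * rho / k%:R) ^+ k <= mean U (fun y => (dist2 x y <= rho)%R%:R).
Proof.
move=> k0 r0 h.
have k1 : 1 <= k%:R :> R by rewrite ler1n.
have rk : rho / k%:R <= rho.
  by rewrite ler_piMr// invf_le1// (lt_le_trans ltr01).
have rk0 : 0 <= rho / k%:R by rewrite divr_ge0// (le_trans ler01).
rewrite -mulrA -(mean_in_box_ge (x := x) rk0); last first.
  by move=> i; have /andP[? ?] := h i; apply/andP; split; lra.
apply: mean_le.
- by apply: bm_bool; exact: measurable_in_box.
- by apply: bm_bool; exact: measurable_ball.
- by move=> y; apply: ler_bool => /in_boxP yb; rewrite dist2C dist2_le_coord.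
Qed.

End cube_volumes.

(** * Maximum matchings *)

Section matchings.
Context (n m : nat).
Implicit Types (adj : 'I_n -> 'I_m -> bool) (E : {set 'I_n * 'I_m}).

Lemma matchingP adj E :
  reflect ((forall e, e \in E -> adj e.1 e.2) /\
    forall e f, e \in E -> f \in E -> e != f -> (e.1 != f.1) && (e.2 != f.2))
  (is_matching adj E).
Proof.
apply: (iffP andP) => -[h1 h2]; split.
- by move=> e eE; exact: (forall_inP h1).
- move=> e f eE fE; exact/implyP/(forall_inP (forall_inP h2 e eE)).
- exact/forall_inP.
- apply/forall_inP => e eE; apply/forall_inP => f fE; apply/implyP; exact: h2.
Qed.

Lemma matching_sub adj adj' E E' : is_matching adj E -> E' \subset E ->
  (forall e, e \in E' -> adj e.1 e.2 -> adj' e.1 e.2) -> is_matching adj' E'.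
Proof.
move=> /matchingP[h1 h2] /fintype.subsetP sub ha; apply/matchingP; split.
  by move=> e eE; apply: ha => //; apply: h1; exact: sub.
by move=> e f eE fE; apply: h2; exact: sub.
Qed.

Lemma matching_set0 adj : is_matching adj finset.set0.
Proof. by apply/matchingP; split=> [e|e f]; rewrite inE. Qed.

Lemma leq_max_matching adj E : is_matching adj E -> (#|E| <= max_matching adj)%N.
Proof. exact: leq_bigmax_cond. Qed.

Lemma max_matching_witness adj :
  exists2 E, is_matching adj E & #|E| = max_matching adj.
Proof.
have [|E mE cE] := @eq_bigmax_cond _ (is_matching adj) (fun E => #|E|).
  by apply/card_gt0P; exists finset.set0; exact: matching_set0.
by exists E.
Qed.

Lemma max_matching_le adj b :
  (forall E, is_matching adj E -> (#|E| <= b)%N) -> (max_matching adj <= b)%N.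
Proof. by move=> h; apply/bigmax_leqP. Qed.

Lemma max_matching_leq_size adj : (max_matching adj <= n)%N.
Proof.
apply: max_matching_le => E /matchingP[_ h].
rewrite -[leqRHS]card_ord -(card_in_imset (f := fst)) ?max_card//.
move=> e f eE fE; apply: contra_eq => /(h _ _ eE fE) /andP[]//.
Qed.

Lemma eq_max_matching adj adj' : adj =2 adj' ->
  max_matching adj = max_matching adj'.
Proof. by move=> h; congr max_matching; apply/funext => i; apply/funext. Qed.

Lemma leq_max_matching_sub adj adj' : (forall i j, adj i j -> adj' i j) ->
  (max_matching adj <= max_matching adj')%N.
Proof.
move=> h; apply: max_matching_le => E mE; apply: leq_max_matching.
by apply: (matching_sub mE) => // e _; exact: h.
Qed.

Definition without adj i0 i j := (i != i0) && adj i j.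

Lemma max_matching_without_le adj i0 :
  (max_matching (without adj i0) <= max_matching adj)%N.
Proof. by apply: leq_max_matching_sub => i j /andP[]. Qed.

Lemma max_matching_le_without adj i0 :
  (max_matching adj <= (max_matching (without adj i0)).+1)%N.
Proof.
apply: max_matching_le => E mE; have /matchingP[_ mE2] := mE.
pose E0 := [set e in E | e.1 != i0].
have mE0 : is_matching (without adj i0) E0.
  apply: (matching_sub mE); first by apply/fintype.subsetP => e; rewrite inE => /andP[].
  by move=> e; rewrite inE /without => /andP[_ ->].
suff : (#|E :\: E0| <= 1)%N.
  have := leq_max_matching mE0; rewrite -(cardsID E0 E) => h1 h2.
  rewrite -[X in (_ <= X)%N]addn1 leq_add//; apply: leq_trans h1.
  by apply: subset_leq_card; exact: subsetIr.
apply/card_le1P => e; rewrite !inE => /andP[]; rewrite negb_and => /orP[/negP//|].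
rewrite negbK => /eqP ei eE f; rewrite !inE.
case: (eqVneq f e) => [->|fe]; first by rewrite eE ei eqxx.
apply/negbTE; rewrite negb_and negbK.
case fE : (f \in E) => //=; rewrite ?orbF /= ?andbT.
by have /andP[+ _] := mE2 _ _ fE eE fe; rewrite ei => ->.
Qed.

(** A matching has at most one edge at each supply of [S], and its other edges survive in [adj']. *)
Lemma max_matching_le_card adj adj' (S : {set 'I_n}) :
  (forall i j, i \notin S -> adj i j -> adj' i j) ->
  (max_matching adj <= max_matching adj' + #|S|)%N.
Proof.
move=> h; apply: max_matching_le => E mE; have /matchingP[_ mE2] := mE.
rewrite -(cardsID [set e | e.1 \in S] E) addnC leq_add//.
  apply: leq_max_matching; apply: (matching_sub mE); first exact: subsetDl.
  by move=> e; rewrite !inE => /andP[eS _]; exact: h.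
rewrite -(card_in_imset (f := fst)).
  by apply: subset_leq_card; apply/fintype.subsetP => _ /imsetP[e + ->]; rewrite !inE => /andP[].
move=> e f; rewrite !inE => /andP[eE _] /andP[fE _].
by apply: contra_eq => /(mE2 _ _ eE fE) /andP[].
Qed.

(** These are the inessential demands of the Gallai-Edmonds decomposition. *)
Definition missable adj j := [exists E : {set 'I_n * 'I_m},
  [&& is_matching adj E, #|E| == max_matching adj &
      [forall e in E, e.2 != j]]].

(** A maximum matching of the rest that misses a neighbour of [i0] can be extended by an edge at
    [i0]. Conversely, if [i0] increases the maximum, every maximum matching uses [i0]; removing its
    edge leaves a maximum matching of the rest that misses the partner of [i0]. *)
Lemma max_matching_hit adj i0 :
  max_matching adj = (max_matching (without adj i0) +
    [exists j, adj i0 j && missable (without adj i0) j])%N.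
Proof.
case: existsP => [[j /andP[aj /existsP[E /and3P[mE /eqP cE /forall_inP nj]]]]|no].
  apply/eqP; rewrite eqn_leq addn1 max_matching_le_without/= -cE.
  have nE : (i0, j) \notin E by apply/negP => /nj; rewrite eqxx.
  rewrite -[X in (X <= _)%N]add1n -[1%N]/(true : nat) -nE -cardsU1.
  have /matchingP[mE1 mE2] := mE.
  apply: leq_max_matching; apply/matchingP; split.
    by move=> e /setU1P[->//|/mE1 /andP[]].
  move=> e f /setU1P[->|eE] /setU1P[->|fE]; rewrite ?eqxx//.
  - by move=> _; have /andP[fi _] := mE1 _ fE; rewrite /= eq_sym fi eq_sym nj.
  - by move=> _; have /andP[ei _] := mE1 _ eE; rewrite /= ei nj.
  - exact: mE2.
apply/eqP; rewrite addn0 eqn_leq max_matching_without_le andbT.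
apply: contra_notT no; rewrite -ltnNge => lt.
have eqm : max_matching adj = (max_matching (without adj i0)).+1.
  by apply/eqP; rewrite eqn_leq lt max_matching_le_without.
have [E mE cE] := max_matching_witness adj.
have /matchingP[mE1 mE2] := mE.
have [e eE /eqP ei] : exists2 e, e \in E & e.1 == i0.
  apply/exists_inP; apply: contraTT lt => /exists_inPn h; rewrite -leqNgt -cE.
  apply: leq_max_matching; apply: (matching_sub mE) => // e eE ae.
  by rewrite /without (h e eE).
exists e.2; rewrite -ei mE1//=; apply/existsP; exists (E :\ e).
apply/and3P; split.
- apply: (matching_sub mE); first exact: subsetDl.
  move=> f /setD1P[fe fE] af; rewrite /without af andbT.
  by have /andP[] := mE2 _ _ fE eE fe.
- by have := cardsD1 e E; rewrite eE cE eqm add1n => -[/eqP]; rewrite ei eq_sym.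
- apply/forall_inP => f /setD1P[fe fE].
  by have /andP[] := mE2 _ _ fE eE fe.
Qed.

Lemma missable_isolated adj j : (forall i, ~~ adj i j) -> missable adj j.
Proof.
move=> nj; have [E mE cE] := max_matching_witness adj.
apply/existsP; exists E; rewrite mE cE eqxx /=.
apply/forall_inP => e eE; apply/eqP => ej; have /matchingP[/(_ e eE)] := mE.
by rewrite ej (negbTE (nj _)).
Qed.

(** No edge crosses the labelling, so matchings of the two sides combine freely. *)
Lemma max_matching_split adj (ls : 'I_n -> bool) (ld : 'I_m -> bool) :
  (forall i j, adj i j -> ls i = ld j) ->
  max_matching adj = (max_matching (fun i j => ls i && adj i j) +
                      max_matching (fun i j => ~~ ls i && adj i j))%N.
Proof.
move=> h; apply/eqP; rewrite eqn_leq; apply/andP; split.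
  apply: max_matching_le => E mE.
  rewrite -(cardsID [set e | ls e.1] E) leq_add//.
    apply: leq_max_matching; apply: (matching_sub mE); first exact: subsetIl.
    by move=> e; rewrite !inE => /andP[_ ->].
  apply: leq_max_matching; apply: (matching_sub mE); first exact: subsetDl.
  by move=> e; rewrite !inE => /andP[->].
have [E mE <-] := max_matching_witness (fun i j => ls i && adj i j).
have [F mF <-] := max_matching_witness (fun i j => ~~ ls i && adj i j).
have /matchingP[mE1 mE2] := mE; have /matchingP[mF1 mF2] := mF.
have EF e f : e \in E -> f \in F -> (e.1 != f.1) && (e.2 != f.2).
  move=> /mE1 /andP[le ae] /mF1 /andP[lf af].
  rewrite (contraTneq _ le) ?(contraTneq _ le)//.
    by move=> ef; rewrite (h _ _ ae) ef -(h _ _ af).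
  by move=> ->.
rewrite -cardsUI (_ : E :&: F = finset.set0) ?cards0 ?addn0; last first.
  apply/setP => e; rewrite !inE; apply/negbTE/negP => /andP[eE eF].
  by have := EF _ _ eE eF; rewrite eqxx.
apply: leq_max_matching; apply/matchingP; split.
  by move=> e /setUP[/mE1|/mF1] /andP[].
move=> e f /setUP[eE|eF] /setUP[fE|fF].
- exact: mE2.
- by move=> _; exact: EF.
- by move=> _; rewrite eq_sym [_.2 == _]eq_sym; exact: EF.
- exact: mF2.
Qed.

(* In [a b1 b2] the supplies [i1] and [i2] use the first or the second of two
   neighbourhoods. *)
Lemma max_matching_modular (a : bool -> bool -> 'I_n -> 'I_m -> bool)
    (i1 i2 : 'I_n) (ls : 'I_n -> bool) (ld : 'I_m -> bool) :
  (forall b1 b2 i j, a b1 b2 i j -> ls i = ld j) -> ls i1 != ls i2 ->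
  (forall b1 b2 b2' i j, i != i2 -> a b1 b2 i j = a b1 b2' i j) ->
  (forall b1 b1' b2 i j, i != i1 -> a b1 b2 i j = a b1' b2 i j) ->
  (max_matching (a true false) + max_matching (a false true) =
   max_matching (a true true) + max_matching (a false false))%N.
Proof.
move=> hl ne h2 h1; wlog l1 : ls ld hl ne / ls i1.
  move=> hw; case l1 : (ls i1); first exact: hw hl ne l1.
  apply: (hw (fun i => ~~ ls i) (fun j => ~~ ld j)).
  - by move=> b1 b2 i j /hl ->.
  - by rewrite (inj_eq negb_inj).
  - by rewrite l1.
have l2 : ls i2 = false by move: ne; rewrite l1; case: (ls i2).
(* The side of [i1] depends on [b1] only and the other side on [b2] only, so the size has the form
   [A b1 + B b2], and the identity is then immediate. *)
pose A b := max_matching (fun i j => ls i && a b true i j).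
pose B b := max_matching (fun i j => ~~ ls i && a true b i j).
have E b1 b2 : max_matching (a b1 b2) = (A b1 + B b2)%N.
  rewrite (max_matching_split (hl b1 b2)); congr (_ + _)%N; apply: eq_max_matching.
    move=> i j; case: (eqVneq i i2) => [->|ni]; first by rewrite l2.
    by rewrite (h2 b1 b2 true).
  move=> i j; case: (eqVneq i i1) => [->|ni]; first by rewrite l1.
  by rewrite (h1 b1 true b2).
by rewrite !E; ring.
Qed.

Lemma max_matching_perm adj (s : {perm 'I_n}) :
  max_matching (fun i => adj (s i)) = max_matching adj.
Proof.
have le (a : 'I_n -> 'I_m -> bool) (t : {perm 'I_n}) :
    (max_matching (fun i => a (t i)) <= max_matching a)%N.
  apply: max_matching_le => E /matchingP[mE1 mE2].
  pose f (e : 'I_n * 'I_m) := (t e.1, e.2).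
  have fI : injective f.
    by move=> [i j] [i' j'] [/perm_inj -> ->].
  rewrite -(card_imset _ fI); apply: leq_max_matching; apply/matchingP; split.
    by move=> _ /imsetP[e eE ->]; exact: mE1.
  move=> _ _ /imsetP[e eE ->] /imsetP[e' eE' ->]; rewrite (inj_eq fI) => ne.
  by rewrite /= (inj_eq perm_inj) mE2.
apply/eqP; rewrite eqn_leq le /=.
by have := le (fun i => adj (s i)) (s^-1)%g; under eq_max_matching do rewrite permKV.
Qed.

End matchings.

(** * Sampling with and without replacement *)

Section averaging.
Context (R : realType).

Definition setf (I : eqType) (V : Type) (h : I -> V) i x : I -> V :=
  fun j => if j == i then x else h j.

Lemma sum_ffun_resample (I T : finType) (F : {ffun I -> T} -> R) (i : I) :
  #|T|%:R * (\sum_f F f) =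
  \sum_(f : {ffun I -> T}) \sum_y F [ffun j => setf f i y j].
Proof.
rewrite pair_big/=.
(* [s] exchanges the value of the function at [i] with the independent value; it is an
   involution. *)
pose s (p : {ffun I -> T} * T) := ([ffun j => setf p.1 i p.2 j], p.1 i).
have sK : cancel s s.
  move=> [f y]; rewrite /s/= ffunE /setf eqxx; congr pair.
  by apply/ffunP => j; rewrite !ffunE; case: eqP => // ->.
rewrite (reindex_inj (can_inj sK))/=.
under [RHS]eq_bigr => p _.
  rewrite (_ : [ffun _ => _] = p.1); last first.
    by apply/ffunP => j; rewrite /setf !ffunE; case: eqP => // ->.
  over.
rewrite -(pair_big xpredT xpredT (fun f (_ : T) => F f))/=.
by rewrite big_distrr; apply: eq_bigr => f _; rewrite sum_cst.
Qed.

Context (n : nat) (Phi : ('I_n -> R) -> R) (r : 'I_n -> R).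
Hypothesis n_gt0 : (0 < n)%N.
Variable good : R -> Prop.
Hypothesis good_r : forall i, good (r i).

Local Notation fn := {ffun 'I_n -> 'I_n}.

(** For a uniform map [f], the vector [r \o f] consists of independent uniform draws from the
    entries of [r]. *)
Definition iid_mean (F : fn -> R) : R := #|fn|%:R^-1 * \sum_f F f.

Let card_fn_gt0 : 0 < #|fn|%:R :> R.
Proof.
by rewrite ltr0n; apply/card_gt0P; exists [ffun=> Ordinal n_gt0].
Qed.

Let n_gt0R : 0 < n%:R :> R. Proof. by rewrite ltr0n. Qed.

Lemma iid_mean_cst (a : R) : iid_mean (fun=> a) = a.
Proof.
by rewrite /iid_mean sum_cst mulrA mulVf ?mul1r// gt_eqF.
Qed.

Lemma iid_mean_le (F G : fn -> R) : (forall f, F f <= G f) ->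
  iid_mean F <= iid_mean G.
Proof. by move=> FG; rewrite ler_pM2l ?invr_gt0//; exact: ler_sum. Qed.

Lemma iid_meanD (F G : fn -> R) :
  iid_mean (fun f => F f + G f) = iid_mean F + iid_mean G.
Proof. by rewrite /iid_mean big_split/= mulrDr. Qed.

Lemma iid_mean_resample (F : fn -> R) (i : 'I_n) :
  iid_mean F =
  iid_mean (fun f => n%:R^-1 * \sum_y F [ffun j => setf f i y j]).
Proof.
rewrite /iid_mean; congr (_ * _); rewrite -mulr_sumr -sum_ffun_resample.
by rewrite card_ord mulrA mulVf ?mul1r// gt_eqF.
Qed.

Section jensen.
Variables (c gap : R).
Hypothesis good_c : good c.
Hypothesis step : forall h i, (forall j, good (h j)) ->
  n%:R^-1 * (\sum_y Phi (setf h i (r y))) <= Phi (setf h i c) - gap.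

(** Interpolates between independent draws ([k = 0]) and the constant vector ([k = n]). *)
Let B k (f : fn) : 'I_n -> R := fun i => if (i < k)%N then c else r (f i).

Let goodB k f i : good (B k f i).
Proof. by rewrite /B; case: ifP. Qed.

Let B_step k : (k < n)%N ->
  iid_mean (fun f => Phi (B k f)) <=
  iid_mean (fun f => Phi (B k.+1 f)) - gap.
Proof.
move=> kn; rewrite (iid_mean_resample _ (Ordinal kn)).
rewrite -(iid_mean_cst (- gap)) -iid_meanD; apply: iid_mean_le => f.
have -> : B k.+1 f = setf (B k f) (Ordinal kn) c.
  apply/funext => i; rewrite /B /setf ltnS leq_eqVlt -val_eqE/=.
  by case: eqP => //= ->; rewrite ltnn.
apply: le_trans (step (Ordinal kn) (goodB k f)); rewrite le_eqVlt; apply/predU1l.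
congr (_ * _); apply: eq_bigr => y _; congr Phi; apply/funext => i.
rewrite /B /setf ffunE -val_eqE/=; case: (eqVneq (i : nat) k) => [->|//].
by rewrite ltnn.
Qed.

Lemma iid_mean_le_cst :
  iid_mean (fun f => Phi (r \o f)) <= Phi (fun=> c) - n%:R * gap.
Proof.
have H k : (k <= n)%N -> iid_mean (fun f => Phi (r \o f)) <=
    iid_mean (fun f => Phi (B k f)) - k%:R * gap.
  elim: k => [_|k IH kn]; first by rewrite mul0r subr0.
  rewrite (le_trans (IH (ltnW kn)))// -natr1 mulrDl mul1r opprD addrA addrAC.
  by rewrite lerD2r B_step.
have := H n (leqnn n).
rewrite (_ : (fun f => Phi (B n f)) = fun=> Phi (fun=> c)) ?iid_mean_cst//.
by apply/funext => f; congr Phi; apply/funext => i; rewrite /B ltn_ord.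
Qed.

End jensen.

Section exchange.
Variable eps : R.
Hypothesis eps_ge0 : 0 <= eps.
Hypothesis Phi_perm : forall s : {perm 'I_n}, Phi (r \o s) = Phi r.
Hypothesis four_term : forall h i1 i2 a b, (forall j, good (h j)) ->
  good a -> good b -> i1 != i2 ->
  Phi (setf (setf h i1 a) i2 b) + Phi (setf (setf h i1 b) i2 a)
  - Phi (setf (setf h i1 a) i2 a) - Phi (setf (setf h i1 b) i2 b) <= eps.

(** For uniform [p] and [f], interpolates between independent draws ([k = 0]) and draws without
    replacement ([k = n]). *)
Let A k (p : {perm 'I_n}) (f : fn) : 'I_n -> R :=
  fun i => r (if (i < k)%N then p i else f i).

Let N : R := #|{perm 'I_n}|%:R.

Let N_gt0 : 0 < N.
Proof. by rewrite ltr0n; apply/card_gt0P; exists 1%g. Qed.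

Let swap_sum (F : {perm 'I_n} -> R) i j :
  \sum_p F p = \sum_p F (tperm i j * p)%g.
Proof. by rewrite (reindex_inj (mulgI (tperm i j))). Qed.

(** The independent draw at coordinate [k] is written as [p l], with [l] to be averaged over later.
    If [l >= k], the value [p l] does not occur among the first [k] coordinates, and transposing [l]
    and [k] in [p] gives equality. If [l < k], the draw repeats the value at [l]; adding the terms
    of [p] and of its transposed permutation produces the expression of [four_term], hence half of
    [eps] for each permutation. *)
Let swap_step k (kn : (k < n)%N) (f : fn) (l : 'I_n) :
  \sum_p Phi (A k.+1 p f) <=
  \sum_(p : {perm 'I_n})
    Phi (A k p [ffun j => setf f (Ordinal kn) (p l) j]) + N * (eps / 2).
Proof.
set j0 := Ordinal kn.
have AZ p : A k p [ffun j => setf f j0 (p l) j] = setf (A k.+1 p f) j0 (r (p l)).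
  apply/funext => i; rewrite /A /setf ffunE -val_eqE/= [in RHS]ltnS [in RHS]leq_eqVlt.
  by case: (eqVneq (i : nat) k) => [->|//]; rewrite ltnn.
under [X in _ <= X + _]eq_bigr do rewrite AZ.
have Ne : 0 <= N * (eps / 2) by rewrite mulr_ge0 ?divr_ge0// ltW.
have [lk|] := leqP k l.
  rewrite (swap_sum (fun p => Phi (A k.+1 p f)) l j0).
  rewrite -[leLHS]addr0 lerD// le_eqVlt; apply/predU1l.
  apply: eq_bigr => p _; congr Phi; apply/funext => i.
  rewrite /A /setf -val_eqE/= permM ltnS.
  case: (eqVneq (i : nat) k) => [ik|ik].
    have -> : i = j0 by exact: val_inj.
    by rewrite leqnn tpermR.
  rewrite leq_eqVlt (negbTE ik)/=; case: ltnP => // ilk; congr (r (p _)).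
  by rewrite tpermD// -val_eqE/= gtn_eqF// (leq_trans ilk).
move=> lk.
have lj : l != j0 by rewrite -val_eqE/= ltn_eqF.
rewrite -(ler_pM2l (ltr0Sn R 1)) mulrDr -lerBlDl.
have -> : 2 * (N * (eps / 2)) = N * eps by field.
have E : 2 * \sum_p Phi (A k.+1 p f) - 2 * \sum_(p : {perm 'I_n}) Phi (setf (A k.+1 p f) j0 (r (p l))) =
  \sum_(p : {perm 'I_n}) (Phi (A k.+1 p f) + Phi (A k.+1 (tperm l j0 * p)%g f)
   - Phi (setf (A k.+1 p f) j0 (r (p l)))
   - Phi (setf (A k.+1 (tperm l j0 * p)%g f) j0 (r ((tperm l j0 * p)%g l)))).
  rewrite !sumrB big_split/= -(swap_sum (fun p => Phi (A k.+1 p f))).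
  rewrite -(swap_sum (fun p => Phi (setf (A k.+1 p f) j0 (r (p l))))).
  by rewrite -addrA -opprD ![2 * _]mulrDl !mul1r.
rewrite E; apply: (@le_trans _ _ (\sum_(p : {perm 'I_n}) eps)); last first.
  by rewrite sum_cst.
apply: ler_sum => p _.
have good_A : forall i, good (A k.+1 p f i) by move=> i; exact: good_r.
have := four_term good_A (good_r (p l)) (good_r (p j0)) lj.
congr (Phi _ + Phi _ - Phi _ - Phi _ <= _); apply/funext => i;
  rewrite /A /setf ?permM ?tpermL.
- case: (eqVneq i j0) => [->|ij]; first by rewrite ltnSn.
  by case: (eqVneq i l) => [->|//]; rewrite ltnS ltnW.
- case: (eqVneq i j0) => [->|ij]; first by rewrite ltnSn tpermR.
  case: (eqVneq i l) => [->|il]; first by rewrite ltnS ltnW// tpermL.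
  by rewrite tpermD// eq_sym.
- case: (eqVneq i j0) => [//|ij].
  by case: (eqVneq i l) => [->|//]; rewrite ltnS ltnW.
- case: (eqVneq i j0) => [//|ij].
  case: (eqVneq i l) => [->|il]; first by rewrite ltnS ltnW// tpermL.
  by rewrite tpermD// eq_sym.
Qed.

Let perm_mean (F : {perm 'I_n} -> R) : R := N^-1 * \sum_p F p.

Let A_step k : (k < n)%N ->
  iid_mean (fun f => perm_mean (fun p => Phi (A k.+1 p f))) <=
  iid_mean (fun f => perm_mean (fun p => Phi (A k p f))) + eps / 2.
Proof.
move=> kn; rewrite [in leRHS](iid_mean_resample _ (Ordinal kn)).
rewrite -(iid_mean_cst (eps / 2)) -iid_meanD; apply: iid_mean_le => f.
rewrite /perm_mean -mulr_sumr exchange_big/=.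
have -> : \sum_(p : {perm 'I_n}) \sum_(y < n)
      Phi (A k p [ffun j => setf f (Ordinal kn) y j]) =
    \sum_(l < n) \sum_(p : {perm 'I_n})
      Phi (A k p [ffun j => setf f (Ordinal kn) (p l) j]).
  rewrite [RHS]exchange_big; apply: eq_bigr => p _.
  by rewrite (reindex_inj (@perm_inj _ p)).
rewrite mulrCA -(ler_pM2l N_gt0) mulrDr !mulrA divff ?gt_eqF// !mul1r.
rewrite -(ler_pM2l n_gt0R) mulrDr mulrA divff ?gt_eqF// mul1r.
have -> : n%:R * \sum_p Phi (A k.+1 p f) =
    \sum_(l < n) \sum_p Phi (A k.+1 p f).
  by rewrite sum_cst card_ord.
rewrite -mulrA.
have -> : n%:R * (N * (eps / 2)) = \sum_(l < n) N * (eps / 2).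
  by rewrite sum_cst card_ord.
rewrite -big_split; apply: ler_sum => l _; exact: swap_step.
Qed.

(* The sampling without replacement implicit in [Phi r] is turned into
   independent sampling one coordinate at a time; a step only creates a
   repeated value, which [four_term] controls after symmetrization. *)
Lemma le_iid_mean :
  Phi r <= iid_mean (fun f => Phi (r \o f)) + n%:R * (eps / 2).
Proof.
have H k : (k <= n)%N ->
    iid_mean (fun f => perm_mean (fun p => Phi (A k p f))) <=
    iid_mean (fun f => Phi (r \o f)) + k%:R * (eps / 2).
  elim: k => [_|k IH kn].
    rewrite mul0r addr0; apply: iid_mean_le => f.
    rewrite /perm_mean (eq_bigr (fun=> Phi (r \o f))); last first.
      by move=> p _; congr Phi; apply/funext => i; rewrite /A ltn0.
    by rewrite sum_cst mulrA mulVf ?mul1r// gt_eqF.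
  rewrite (le_trans (A_step kn))// -[in leRHS]natr1 mulrDl mul1r addrA lerD2r.
  exact/IH/ltnW.
have := H n (leqnn n).
rewrite (_ : (fun f => _) = fun=> Phi r) ?iid_mean_cst//.
apply/funext => f; rewrite /perm_mean (eq_bigr (fun=> Phi r)).
  by rewrite sum_cst mulrA mulVf ?mul1r// gt_eqF.
move=> p _; rewrite -(Phi_perm p); congr Phi.
by apply/funext => i; rewrite /A ltn_ord.
Qed.

End exchange.

End averaging.

(** * Concavity from multiplicative increments *)

Section ratio_concavity.
Context (R : realType) (gam : R) (H : R -> R).
Hypothesis H_cont : forall a b, 0 < a -> a <= b -> b <= gam ->
  {within `[a, b], continuous H}.
Hypothesis H_ratio : forall c q, 0 < c -> 1 < q -> q <= 2 -> c * q <= gam ->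
  (H (c * q) - H c) / q < H c - H (c / q).
Hypothesis H_mono : forall a, 0 <= a -> a <= gam -> H 0 <= H a.

(* Linear functions satisfy the ratio condition with equality, so subtracting
   the chord over [a, b] leaves a function that cannot have an interior
   minimum. *)
Lemma ratio_concave_gt0 a c b : 0 < a -> a < c -> c < b -> b <= gam ->
  (H b - H c) * (c - a) <= (H c - H a) * (b - c).
Proof.
move=> a0 ac cb bg; have ab := lt_trans ac cb.
have c0 := lt_trans a0 ac; have b0 := lt_trans c0 cb.
pose s := (H b - H a) / (b - a).
have sE : s * (b - a) = H b - H a by rewrite divfK// subr_eq0 gt_eqF.
pose f x := H x - s * x.
have fab : f a = f b by rewrite /f; apply/eqP; rewrite -subr_eq0; apply/eqP; lra.
have fcont : {within `[a, b], continuous f}.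
  have lin : {within `[a, b], continuous (fun x : R => s * x)}.
    by apply: continuous_subspaceT => x; exact: mulrl_continuous.
  by move=> x; apply: cvgB; [exact: H_cont a0 (ltW ab) bg x | exact: lin].
have [x0 x0ab fmin] := EVT_min (ltW ab) fcont.
(* If [f c] is not below the common value [f a = f b], the point at [c] lies above the chord, which
   is the claim. Otherwise the minimum of [f] is interior. *)
have [c1|c1] := leP (f a) (f c).
  have : H a - s * a <= H c - s * c by [].
  have h1 : 0 < c - a by rewrite subr_gt0.
  have h2 : 0 < b - c by rewrite subr_gt0.
  have h3 : 0 < b - a by rewrite subr_gt0.
  move=> le.
  have e1 : s * (c - a) * (b - c) <= (H c - H a) * (b - c).
    by rewrite ler_pM2r//; lra.
  apply: le_trans e1; rewrite mulrAC ler_pM2r//; lra.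
have fc : f x0 <= f c by apply: fmin; rewrite in_itv/= !ltW.
have x0a : x0 != a by apply: contraTneq fc => ->; rewrite -ltNge.
have x0b : x0 != b by apply: contraTneq fc => ->; rewrite -ltNge -fab.
move: x0ab; rewrite in_itv/= => /andP[ax xb].
have {x0a}ax : a < x0 by rewrite lt_neqAle eq_sym x0a.
have {x0b}xb : x0 < b by rewrite lt_neqAle x0b.
have x00 := lt_trans a0 ax.
(* Chosen so that both [x0 * q] and [x0 / q] stay in the interval, where [x0] is a minimum. *)
pose q := Num.min 2 (Num.min (b / x0) (x0 / a)).
have q1 : 1 < q by rewrite !lt_min ltr1n/= !ltr_pdivlMr ?mul1r ?ax ?xb.
have q2 : q <= 2 by rewrite ge_min lexx.
have q0 : 0 < q by rewrite (lt_trans ltr01).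
have xqb : x0 * q <= b.
  by rewrite -ler_pdivlMl// mulrC !ge_min lexx orbT.
have axq : a <= x0 / q.
  by rewrite ler_pdivlMr// -ler_pdivlMl// mulrC !ge_min lexx !orbT.
have := H_ratio x00 q1 q2 (le_trans xqb bg).
have := fmin (x0 * q); have := fmin (x0 / q).
rewrite !in_itv/= axq xqb.
have -> : x0 / q <= b.
  by rewrite ler_pdivrMr// (le_trans (ltW xb))// ler_peMr// ?ltW// (lt_trans a0).
have -> : a <= x0 * q by rewrite (le_trans (ltW ax))// ler_peMr// ltW.
move=> /(_ isT) f1 /(_ isT) f2.
rewrite ltr_pdivrMr// => f3.
have f1' : H x0 - s * x0 <= H (x0 / q) - s * (x0 / q) by [].
have f2' : H x0 - s * x0 <= H (x0 * q) - s * (x0 * q) by [].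
have e : s * (x0 - x0 / q) * q = s * (x0 * q) - s * x0.
  by field; rewrite gt_eqF.
have : (H x0 - H (x0 / q)) * q <= s * (x0 - x0 / q) * q.
  by rewrite ler_pM2r//; lra.
rewrite e => h; lra.
Qed.

(** At [a = 0] continuity is not assumed. Since [H 0 <= H x], the inequality for small [x > 0]
    implies the one with [H 0] in place of [H x], and a violation at [0] would persist at the point
    [e] close to it. *)
Lemma ratio_concave a c b : 0 <= a -> a < c -> c < b -> b <= gam ->
  (H b - H c) * (c - a) <= (H c - H a) * (b - c).
Proof.
rewrite le_eqVlt => /predU1P[<-|a0]; last exact: ratio_concave_gt0.
move=> c0 cb bg; rewrite subr0.
have bc : 0 < b - c by rewrite subr_gt0.
have Ha x : 0 < x -> x < c -> (H b - H c) * (c - x) <= (H c - H 0) * (b - c).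
  move=> x0 xc; apply: le_trans (ratio_concave_gt0 x0 xc cb bg) _.
  by rewrite ler_pM2r// lerD2l lerN2 H_mono// ltW// (lt_le_trans xc)// (le_trans _ bg)// ltW.
have [D0|D0] := leP (H b - H c) 0.
  apply: (@le_trans _ _ 0); first by rewrite mulr_le0_ge0// ltW.
  by rewrite mulr_ge0 ?(ltW bc)// subr_ge0 H_mono// ltW// (lt_le_trans cb).
rewrite leNgt; apply/negP => lt.
pose e := Num.min (c / 2) (((H b - H c) * c - (H c - H 0) * (b - c)) / (H b - H c) / 2).
have e0 : 0 < e.
  by rewrite lt_min !divr_gt0//= subr_gt0.
have ec : e < c.
  by rewrite gt_min; apply/orP; left; rewrite ltr_pdivrMr// ltr_pMr// ltr1n.
have := Ha e e0 ec.
have : e * (H b - H c) * 2 <= (H b - H c) * c - (H c - H 0) * (b - c).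
  by rewrite -ler_pdivlMr// -ler_pdivlMr// mulrAC ge_min lexx orbT.
have : 0 < e * (H b - H c) by exact: mulr_gt0.
lra.
Qed.

(** The slope is the supremum of the chord slopes to the right of [c], which every chord slope to
    the left bounds from above. *)
Lemma ratio_concave_support c : 0 < c -> c < gam ->
  exists s, forall x, 0 <= x -> x <= gam -> H x <= H c + s * (x - c).
Proof.
move=> c0 cg.
pose S := [set t | exists2 b, c < b <= gam & t = (H b - H c) / (b - c)]%classic.
have Sub a : 0 <= a -> a < c -> ubound S ((H c - H a) / (c - a)).
  move=> a0 ac _ [b /andP[cb bg] ->].
  have h1 : 0 < c - a by rewrite subr_gt0.
  have h2 : 0 < b - c by rewrite subr_gt0.
  rewrite ler_pdivrMr// mulrAC ler_pdivlMr//; exact: ratio_concave.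
have S0 : (S !=set0)%classic.
  by exists ((H gam - H c) / (gam - c)); exists gam => //; rewrite cg lexx.
have HS : has_sup S by split => //; exists ((H c - H 0) / (c - 0)); exact: Sub.
exists (sup S) => x x0 xg.
case: (ltgtP x c) => [xc|cx|->]; last by rewrite subrr mulr0 addr0.
- have h1 : 0 < c - x by rewrite subr_gt0.
  have : sup S <= (H c - H x) / (c - x) by apply: ge_sup => //; exact: Sub.
  rewrite ler_pdivlMr// => h; lra.
- have h1 : 0 < x - c by rewrite subr_gt0.
  have : (H x - H c) / (x - c) <= sup S.
    by apply: ub_le_sup; [case: HS | exists x => //; rewrite cx xg].
  rewrite ler_pdivrMr// => h; lra.
Qed.

Lemma ratio_concave_jensen n (r : 'I_n -> R) c : (0 < n)%N ->
  0 < c -> c < gam -> (forall i, 0 <= r i <= gam) ->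
  \sum_i r i = n%:R * c -> n%:R^-1 * (\sum_i H (r i)) <= H c.
Proof.
move=> n0 c0 cg rg rc; have n0R : 0 < n%:R :> R by rewrite ltr0n.
have [s hs] := ratio_concave_support c0 cg.
rewrite ler_pdivrMl//.
apply: (@le_trans _ _ (\sum_(i < n) (H c + s * (r i - c)))).
  by apply: ler_sum => i _; have /andP[? ?] := rg i; exact: hs.
by rewrite big_split/= -mulr_sumr sumrB rc !sum_cst card_ord subrr mulr0 addr0.
Qed.

End ratio_concavity.

(** * Volumes of unions of balls *)

Section voronoi.
Context (R : realType) (k m : nat).
Local Notation TR := (measurableTypeR R).
Local Notation U := (unif_cube R k).
Variables (p : 'I_m -> k.-tuple R) (W : 'I_m -> bool).

Definition hit (rho : R) (x : k.-tuple R) :=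
  [exists j, W j && (dist2 x (p j) <= rho)].

Lemma hitP rho x : reflect (exists2 j, W j & dist2 x (p j) <= rho) (hit rho x).
Proof.
by apply: (iffP existsP) => [[j /andP[]]|[j Wj h]]; exists j => //; rewrite Wj.
Qed.

(* Ties are broken by the index, so that the cells are disjoint. *)
Definition nearest (j : 'I_m) (x : k.-tuple R) :=
  [forall l, W l ==> (dist2 x (p j) < dist2 x (p l)) ||
    ((dist2 x (p j) <= dist2 x (p l)) && (j <= l)%N)].

Lemma nearestP j x : reflect (forall l, W l -> dist2 x (p j) < dist2 x (p l) \/
    dist2 x (p j) = dist2 x (p l) /\ (j <= l)%N) (nearest j x).
Proof.
apply: (iffP forallP) => h l.
  move=> Wl; have /implyP/(_ Wl)/orP[->|/andP[]] := h l; first by left.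
  by rewrite le_eqVlt => /predU1P[->|->]; [right | left].
by apply/implyP => /h[->//|[-> ->]]; rewrite lexx orbT.
Qed.

Lemma nearest_le j l x : nearest j x -> W l -> dist2 x (p j) <= dist2 x (p l).
Proof. by move=> /nearestP h /h[/ltW|[-> _]]. Qed.

Lemma nearest_uniq j l x : W j -> W l -> nearest j x -> nearest l x -> j = l.
Proof.
move=> Wj Wl /nearestP/(_ l Wl) h /nearestP/(_ j Wj) h'; apply: val_inj.
case: h => [h|[e jl]]; case: h' => [h'|[e' lj]].
- by have := lt_trans h h'; rewrite ltxx.
- by rewrite e' ltxx in h.
- by rewrite e ltxx in h'.
- by apply/eqP; rewrite eqn_leq jl lj.
Qed.

Lemma nearest_exists j x : W j -> exists2 l, W l & nearest l x.
Proof.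
move=> Wj; case: (arg_minP (fun l => dist2 x (p l)) Wj) => l Wl lmin.
pose A i := W i && (dist2 x (p i) == dist2 x (p l)).
have Al : A l by rewrite /A Wl eqxx.
case: (arg_minnP (fun i : 'I_m => i : nat) Al) => i /andP[Wi /eqP ei] imin.
exists i => //; apply/nearestP => h Wh; rewrite ei.
have := lmin h Wh; rewrite le_eqVlt => /predU1P[e|]; last by left.
by right; split=> //; apply: imin; rewrite /A Wh e eqxx.
Qed.

(** Voronoi cells are star-shaped about their centres: moving from [y] to [x] shortens the distance
    to [p j] by exactly [dist2 y x], and the distance to any other centre by at most that. *)
Lemma nearest_homothety j l x : 0 < l -> l <= 1 -> W j ->
  nearest j (homothety (p j) l^-1 x) -> nearest j x.
Proof.
move=> l0 l1 Wj; set y := homothety _ _ _ => /nearestP h.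
have xE : x = homothety (p j) l y by rewrite homothetyK// gt_eqF.
have dj : dist2 x (p j) = l * dist2 y (p j).
  by rewrite {1}xE dist2_homothety_center// ltW.
have dxy : dist2 y x = (1 - l) * dist2 y (p j).
  by rewrite dist2C {1}xE dist2_homothety_id.
apply/nearestP => i Wi; have := dist2_triangle x y (p i).
rewrite dxy => tri; case: (h i Wi) => [lt|[e ji]].
  by left; rewrite dj; lra.
have : dist2 x (p j) <= dist2 x (p i) by rewrite dj; lra.
by rewrite le_eqVlt => /predU1P[->|]; [right | left].
Qed.

Variables (r1 r2 l : R).
Hypotheses (r12 : r1 <= r2) (l_gt0 : 0 < l) (l_le1 : l <= 1).
Hypothesis p_cube : forall j, in_cube (p j).

Definition cell (j : 'I_m) (x : k.-tuple R) :=
  [&& in_cube x, W j, r1 < dist2 x (p j), dist2 x (p j) <= r2 & nearest j x].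

Variable bad : k.-tuple R -> bool.
Hypothesis bad_spec : forall x, bad x -> exists j1 j2,
  [/\ W j1, W j2, l * r1 < dist2 x (p j1) <= l * r2,
      (forall i, W i -> i != j1 -> dist2 x (p j1) < dist2 x (p i)) &
      dist2 (homothety (p j1) l^-1 x) (p j2) <
      dist2 (homothety (p j1) l^-1 x) (p j1)].

Lemma hit_le_cell x : in_cube x ->
  (hit r2 x)%:R - (hit r1 x)%:R <= \sum_j (cell j x)%:R :> R.
Proof.
move=> xc; have S0 : 0 <= \sum_j (cell j x)%:R :> R by rewrite sumr_ge0.
case: hitP => [[j Wj jr]|_]; last by rewrite sub0r (le_trans _ S0)// oppr_le0.
case: hitP => [_|n1]; first by rewrite subrr.
have [i Wi ni] := nearest_exists x Wj.
rewrite subr0 (bigD1 i)//= /cell xc Wi ni andbT.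
rewrite (le_trans (nearest_le ni Wj) jr) andbT ltNge.
have -> : dist2 x (p i) <= r1 = false.
  by apply/negbTE/negP => ir; case: n1; exists i.
by rewrite lerDl sumr_ge0.
Qed.

(** By star-shapedness the contracted parts lie in distinct Voronoi cells, so at most one of them
    contains [x]. A bad [x] lies in the cell of [j1], but its dilation away from [j1] does not, so
    no contracted part contains it. *)
Lemma cell_homothety_hit x :
  \sum_j (cell j (homothety (p j) l^-1 x))%:R + (bad x)%:R <=
  (hit (l * r2) x)%:R - (hit (l * r1) x)%:R :> R.
Proof.
pose b j := cell j (homothety (p j) l^-1 x).
have bN j : b j -> W j /\ nearest j x.
  by move=> /and5P[_ Wj _ _ nj]; split=> //; exact: nearest_homothety nj.
have hits i : W i -> nearest i x -> l * r1 < dist2 x (p i) ->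
    dist2 x (p i) <= l * r2 ->
    (hit (l * r2) x)%:R - (hit (l * r1) x)%:R = 1 :> R.
  move=> Wi ni i1 i2; have -> : hit (l * r2) x by apply/hitP; exists i.
  case: hitP => [[h Wh]|_]; last by rewrite subr0.
  by rewrite leNgt (lt_le_trans i1 (nearest_le ni Wh)).
have hb j : b j -> (hit (l * r2) x)%:R - (hit (l * r1) x)%:R = 1 :> R.
  move=> bj; have [Wj nj] := bN _ bj.
  move: bj => /and5P[_ _]; set y := homothety _ _ _ => h1 h2 _.
  have dj : dist2 x (p j) = l * dist2 y (p j).
    by rewrite -[x in LHS](homothetyK (p j) x (lt0r_neq0 l_gt0))
      dist2_homothety_center// ltW.
  by apply: (hits j) => //; rewrite dj ?ltr_pM2l ?ler_pM2l.
have bb : bad x -> (forall j, ~~ b j) /\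
    (hit (l * r2) x)%:R - (hit (l * r1) x)%:R = 1 :> R.
  move=> /bad_spec[j1 [j2 [W1 W2 /andP[h1 h2] lt12 lt]]].
  have n1 : nearest j1 x.
    apply/nearestP => i Wi; case: (eqVneq i j1) => [->|ne]; first by right.
    by left; exact: lt12.
  split; last exact: hits n1 h1 h2.
  move=> j; apply/negP => bj; have [Wj nj] := bN _ bj.
  have e := nearest_uniq Wj W1 nj n1; subst j.
  move: bj => /and5P[_ _ _ _ /nearest_le/(_ W2)].
  by rewrite leNgt lt.
have [/existsP[j bj]|no] := boolP [exists j, b j].
  rewrite (hb j bj) (bigD1 j)//= (bj : cell j _) big1 => [|i ij].
    by case: (boolP (bad x)) => [/bb[/(_ j)]|_]; rewrite ?bj// !addr0.
  case: (boolP (b i)) => [bi|/negbTE]; last by rewrite /b => ->.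
  have [[Wj nj] [Wi ni]] := (bN _ bj, bN _ bi).
  by rewrite (nearest_uniq Wi Wj ni nj) eqxx in ij.
rewrite big1 ?add0r => [|i _]; last first.
  by have /existsPn/(_ i)/negbTE := no; rewrite /b => ->.
case: (boolP (bad x)) => [/bb[_ ->]//|_].
rewrite subr_ge0; apply: ler_bool => /hitP[j Wj jr]; apply/hitP.
by exists j => //; rewrite (le_trans jr)// ler_pM2l.
Qed.

Lemma measurable_dist2_at (u : k.-tuple R) :
  measurable_fun setT (fun x : k.-tuple TR => dist2 (x : k.-tuple R) u : TR).
Proof. exact: (measurable_dist2 (X := id) (Y := fun=> u)). Qed.

Lemma measurable_hit rho :
  measurable_fun setT (fun x : k.-tuple TR => hit rho (x : k.-tuple R)).
Proof.
apply: (@measurable_fun_of_bools _ _ _ _ 'I_m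
  (fun j (x : k.-tuple TR) => dist2 (x : k.-tuple R) (p j) <= rho)).
  by move=> j; apply: measurable_fun_ler => //; exact: measurable_dist2_at.
by move=> x y e; apply: eq_existsb => j; rewrite e.
Qed.

Lemma measurable_cell j :
  measurable_fun setT (fun x : k.-tuple TR => cell j (x : k.-tuple R)).
Proof.
apply: measurable_and; first exact: (measurable_in_cube (X := id)).
apply: measurable_and => //.
apply: measurable_and.
  by apply: measurable_fun_ltr => //; exact: measurable_dist2_at.
apply: measurable_and.
  by apply: measurable_fun_ler => //; exact: measurable_dist2_at.
apply: (@measurable_fun_of_bools _ _ _ _ ('I_m * bool)%type
  (fun i (x : k.-tuple TR) =>
    if i.2 then dist2 (x : k.-tuple R) (p j) < dist2 (x : k.-tuple R) (p i.1)
    else dist2 (x : k.-tuple R) (p j) <= dist2 (x : k.-tuple R) (p i.1))).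
  move=> [i []] /=.
    by apply: measurable_fun_ltr; exact: measurable_dist2_at.
  by apply: measurable_fun_ler; exact: measurable_dist2_at.
move=> x y e; apply: eq_forallb => i; congr (_ ==> _).
by have /= -> := e (i, true); have /= -> := e (i, false).
Qed.

Definition volume rho : R := mean U (fun x => (hit rho x)%:R).

(* The parts of the cells at distance between [r1] and [r2] from their centres
   are disjoint, and stay so when contracted towards the centres; the points of
   [bad] are missed by all contracted parts. *)
Lemma volume_scaling :
  measurable_fun setT (fun x : k.-tuple TR => bad (x : k.-tuple R)) ->
  l ^+ k * (volume r2 - volume r1) + mean U (fun x => (bad x)%:R) <=
  volume (l * r2) - volume (l * r1).
Proof.
move=> mbad.
have bh rho := bm_bool R (measurable_hit rho).
have bc j := bm_bool R (measurable_cell j).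
have mH j : measurable_fun setT (homothety (p j) l^-1 : k.-tuple TR -> k.-tuple TR).
  exact: (measurable_homothety (X := fun=> p j) (Y := id)).
have mcH j : measurable_fun setT
    (fun x : k.-tuple TR => cell j (homothety (p j) l^-1 x)).
  exact: (measurableT_comp (measurable_cell j) (mH j)).
have bcH j := bm_bool R (mcH j).
rewrite /volume -!meanB//.
have le1 : mean U (fun x => (hit r2 x)%:R - (hit r1 x)%:R) <=
    \sum_j mean U (fun x => (cell j x)%:R).
  rewrite -mean_sum//; apply: mean_le_as (unif_cube_in_cube R k) _.
  - exact: bmB.
  - exact: bm_sum.
  - exact: (measurable_in_cube (X := id)).
  - exact: hit_le_cell.
apply: (@le_trans _ _ (mean U (fun x =>
    \sum_j (cell j (homothety (p j) l^-1 x))%:R + (bad x)%:R))); last first.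
  apply: mean_le; [|exact: bmB|exact: cell_homothety_hit].
  by apply: bmD; [exact: bm_sum | exact: bm_bool].
rewrite [leRHS]meanD; [|exact: bm_sum|exact: bm_bool].
have -> : mean U (fun x => \sum_j (cell j (homothety (p j) l^-1 x))%:R) =
    \sum_j mean U (fun x => (cell j (homothety (p j) l^-1 x))%:R).
  by apply: mean_sum => j _; exact: bcH.
rewrite lerD2r.
apply: le_trans (_ : l ^+ k * \sum_j mean U (fun x => (cell j x)%:R) <= _).
  by rewrite ler_pM2l// exprn_gt0.
rewrite mulr_sumr; apply: ler_sum => j _.
by rewrite (mean_homothety l_gt0 l_le1 (p_cube j) (measurable_cell j))// => x /andP[].
Qed.

End voronoi.

(** * Annuli, lunes and the probability of a bad pair *)

Section lune.
Context (R : realType) (k : nat).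
Hypothesis k_gt0 : (0 < k)%N.
Local Notation TR := (measurableTypeR R).
Local Notation U := (unif_cube R k).
Implicit Types (u c : k.-tuple R) (q rho : R).

Definition deep c rho := forall i, rho <= tnth c i <= 1 - rho.

Lemma deep_in_cube c rho : 0 <= rho -> deep c rho -> in_cube c.
Proof. by move=> r0 h; apply/in_cubeP => i; have := h i; lra. Qed.

Lemma deep_ball c rho rho' v : deep c (rho + rho') -> dist2 c v <= rho' -> deep v rho.
Proof.
move=> h cv i; have := h i; have := le_trans (ler_coord_dist2 c v i) cv.
by rewrite ler_norml; lra.
Qed.

Lemma ball_scaling u c q rho : 0 < q -> q <= 1 -> in_cube u -> deep c rho ->
  mean U (fun v => (dist2 (homothety u q c) v <= q * rho)%R%:R) =
  q ^+ k * mean U (fun v => (dist2 c v <= rho)%R%:R).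
Proof.
move=> q0 q1 uc cd.
rewrite -(mean_homothety q0 q1 uc (measurable_ball c rho)); last first.
  move=> v cv; apply: (@deep_in_cube v 0) => //.
  by apply: (deep_ball (rho' := rho)) cv; rewrite add0r.
apply: eq_mean => v; congr (_ %:R); congr nat_of_bool.
rewrite -[v in LHS](homothetyK u v (lt0r_neq0 q0)) dist2_homothety ?(ltW q0)//.
by rewrite ler_pM2l.
Qed.

(** The inner ball is a contraction of the outer one, so it takes exactly the fraction
    [(r1 / r2) ^+ k] of its volume. *)
Lemma mean_annulus_ge c r1 r2 : 0 < r1 -> r1 <= r2 -> deep c r2 ->
  (1 - (r1 / r2) ^+ k) * (2 * r2 / k%:R) ^+ k <=
  mean U (fun v => ((r1 < dist2 c v) && (dist2 c v <= r2))%R%:R).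
Proof.
move=> r10 r12 cd; have r20 := lt_le_trans r10 r12.
have q0 : 0 < r1 / r2 by rewrite divr_gt0.
have q1 : r1 / r2 <= 1 by rewrite ler_pdivrMr// mul1r.
have cc : in_cube c by apply: deep_in_cube cd; exact: ltW.
have := ball_scaling q0 q1 cc cd.
rewrite homothety_center divfK ?gt_eqF// => e.
have m1 := bm_bool R (measurable_ball c r1).
have m2 := bm_bool R (measurable_ball c r2).
apply: (@le_trans _ _ (mean U (fun v => (dist2 c v <= r2)%R%:R) -
                       mean U (fun v => (dist2 c v <= r1)%R%:R))).
  rewrite e -[X in _ <= X - _]mul1r -mulrBl ler_wpM2l//.
    by rewrite subr_ge0 exprn_ile1// ltW.
  by apply: mean_ball_ge => //; exact: ltW.
rewrite -meanB//; apply: mean_le; first exact: bmB.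
  apply: bm_bool; apply: measurable_and; last exact: measurable_ball.
  by apply: measurable_fun_ltr => //; exact: (measurable_dist2 (X := fun=> c) (Y := id)).
move=> v; rewrite ltNge andbC.
by case: (dist2 c v <= r2); case: (dist2 c v <= r1); rewrite ?subrr ?subr0 ?sub0r ?oppr_le0.
Qed.

(** A difference of two balls has at least the difference of their volumes, wherever they lie, and
    both volumes are known fractions of the ball about [c] of radius [rho]. *)
Lemma mean_lune_ge u c l eta rho : 0 < l -> l <= 1 -> 0 < eta -> eta <= 1 ->
  l ^+ k <= eta ^+ k -> 0 <= rho -> in_cube u -> deep c rho ->
  (eta ^+ k - l ^+ k) * (2 * rho / k%:R) ^+ k <=
  mean U (fun v => ((dist2 c v <= eta * rho) &&
                    (l * rho < dist2 (homothety u l c) v))%R%:R).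
Proof.
move=> l0 l1 e0 e1 le r0 uc cd.
have cc : in_cube c by exact: deep_in_cube cd.
have E1 := ball_scaling l0 l1 uc cd.
have := ball_scaling e0 e1 cc cd; rewrite homothety_center => E2.
have m1 := bm_bool R (measurable_ball (homothety u l c) (l * rho)).
have m2 := bm_bool R (measurable_ball c (eta * rho)).
apply: (@le_trans _ _ (mean U (fun v => (dist2 c v <= eta * rho)%R%:R) -
             mean U (fun v => (dist2 (homothety u l c) v <= l * rho)%R%:R))).
  rewrite E1 E2 -mulrBl ler_wpM2l ?subr_ge0//.
  by apply: mean_ball_ge.
rewrite -meanB//; apply: mean_le; first exact: bmB.
  apply: bm_bool; apply: measurable_and; first exact: measurable_ball.
  by apply: measurable_fun_ltr => //;
    exact: (measurable_dist2 (X := fun=> homothety u l c) (Y := id)).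
move=> v; rewrite [l * rho < _]ltNge.
by case: (dist2 c v <= _); case: (_ <= l * rho); rewrite ?subrr ?subr0 ?sub0r ?oppr_le0.
Qed.

Section bad_pair.
Variables (r1 r2 l eta rho : R) (x : k.-tuple R).
Hypotheses (r1_gt0 : 0 < r1) (r12 : r1 <= r2) (r2_le : r2 <= rho).
Hypotheses (l_gt0 : 0 < l) (l_lt1 : l < 1) (eta_gt0 : 0 < eta) (eta_lt1 : eta < 1).
Hypothesis l_eta : l ^+ k <= eta ^+ k.
Hypothesis x_deep : deep x (3 * rho).

(* [u] becomes the nearest of [u], [v] to [x], but no longer to the dilation of
   [x] away from [u] by the factor [l^-1]. *)
Definition bad_pair (u v : k.-tuple R) :=
  [&& l * r1 < dist2 x u, dist2 x u <= l * r2,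
      dist2 (homothety u l^-1 x) v <= eta * dist2 u (homothety u l^-1 x) &
      dist2 x u < dist2 x v].

Lemma dist2_dilation u : dist2 x u = l * dist2 u (homothety u l^-1 x).
Proof.
rewrite [in RHS]dist2C dist2_homothety_center ?invr_ge0 ?ltW//.
by rewrite mulrA divff ?gt_eqF// mul1r.
Qed.

Lemma bad_pair_near u v : bad_pair u v ->
  dist2 x u <= rho /\ dist2 x v <= 2 * rho.
Proof.
move=> /and4P[h1 h2 h3 h4]; set c := homothety u l^-1 x in h3 *.
have dxu := dist2_dilation u; rewrite -/c in dxu.
have cr : dist2 u c <= r2 by rewrite -(ler_pM2l l_gt0) -dxu.
have xc : dist2 x c <= r2.
  rewrite -[x](homothetyK u x (lt0r_neq0 l_gt0)) -/c (dist2_homothety_id _ _ (ltW l_lt1)).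
  rewrite dist2C (le_trans _ cr)// ler_piMl ?dist2_ge0//.
  by rewrite gerBl ltW.
split.
  by rewrite dxu (le_trans _ (le_trans cr r2_le))// ler_piMl ?dist2_ge0// ltW.
have := dist2_triangle c x v.
have cv : dist2 c v <= dist2 u c.
  by rewrite (le_trans h3)// ler_piMl ?dist2_ge0// ltW.
by move=> tri; have := r2_le; lra.
Qed.

Lemma bad_pair_lt u v : bad_pair u v ->
  dist2 (homothety u l^-1 x) v < dist2 (homothety u l^-1 x) u.
Proof.
move=> /and4P[h1 h2 h3 h4]; rewrite [X in _ < X]dist2C.
apply: le_lt_trans h3 _; rewrite gtr_pMl// -(pmulr_rgt0 _ l_gt0).
by rewrite -dist2_dilation (lt_trans _ h1)// mulr_gt0.
Qed.

Lemma measurable_bad_pair d (T : measurableType d)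
    (X Y Z : T -> k.-tuple TR) :
  measurable_fun setT X -> measurable_fun setT Y -> measurable_fun setT Z ->
  measurable_fun setT (fun w => let x := (X w : k.-tuple R) in
    let u := Y w in let v := Z w in
    [&& l * r1 < dist2 x u, dist2 x u <= l * r2,
      dist2 (homothety u l^-1 x) v <= eta * dist2 u (homothety u l^-1 x) &
      dist2 x u < dist2 x v]).
Proof.
move=> mX mY mZ.
have mH : measurable_fun setT (fun w => homothety (Y w) l^-1 (X w) : k.-tuple TR).
  exact: measurable_homothety.
apply: measurable_and.
  by apply: measurable_fun_ltr => //; exact: measurable_dist2.
apply: measurable_and.
  by apply: measurable_fun_ler => //; exact: measurable_dist2.
apply: measurable_and.
  apply: measurable_fun_ler; first exact: measurable_dist2.
  by apply: measurable_funM => //; exact: measurable_dist2.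
by apply: measurable_fun_ltr; exact: measurable_dist2.
Qed.

(** The point [u] ranges over an annulus about [x]. With [c] the dilation of [x] away from [u], the
    ball about [x] through [u] is the contraction towards [u] of the ball about [c] through [u]. The
    admissible [v] therefore fill the lune of [mean_lune_ge] with radius [dist2 u c], which is at
    least [r1]. *)
Lemma mean_bad_pair_ge :
  (1 - (r1 / r2) ^+ k) * (2 * (l * r2) / k%:R) ^+ k *
  ((eta ^+ k - l ^+ k) * (2 * r1 / k%:R) ^+ k) <=
  mean U (fun u => mean U (fun v => (bad_pair u v)%:R)).
Proof.
have k1 : 0 < k%:R :> R by rewrite ltr0n.
have r20 := lt_le_trans r1_gt0 r12.
have lune0 : 0 <= (eta ^+ k - l ^+ k) * (2 * r1 / k%:R) ^+ k.
  by rewrite mulr_ge0 ?subr_ge0// exprn_ge0// divr_ge0// ?mulr_ge0// ltW.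
have dx : deep x (l * r2).
  move=> i; have := x_deep i; have : l * r2 <= r2 by rewrite ler_piMl// ltW.
  by have := r2_le; have := r20; lra.
have lr1 : 0 < l * r1 by rewrite mulr_gt0.
have := mean_annulus_ge lr1 _ dx; rewrite ler_pM2l// => /(_ r12) ann.
have le : l * r1 / (l * r2) = r1 / r2 by field; rewrite !gt_eqF.
rewrite le in ann.
apply: (@le_trans _ _ (mean U (fun u =>
    ((l * r1 < dist2 x u) && (dist2 x u <= l * r2))%R%:R *
    ((eta ^+ k - l ^+ k) * (2 * r1 / k%:R) ^+ k)))).
  under eq_mean do rewrite mulrC.
  rewrite meanZ; last first.
    apply: bm_bool; apply: measurable_and; last exact: measurable_ball.
    by apply: measurable_fun_ltr => //; exact: (measurable_dist2 (X := fun=> x) (Y := id)).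
  by rewrite [leRHS]mulrC ler_wpM2r.
apply: mean_le.
- apply: bmM; last exact: bm_cst.
  apply: bm_bool; apply: measurable_and; last exact: measurable_ball.
  by apply: measurable_fun_ltr => //; exact: (measurable_dist2 (X := fun=> x) (Y := id)).
- apply: (bm_mean1 U U (f := fun uv => (bad_pair uv.1 uv.2)%:R)).
  by apply: bm_bool; apply: (measurable_bad_pair (X := fun=> x)).
move=> u; case: (boolP (_ && _)) => [/andP[h1 h2]|_]; last first.
  by rewrite mul0r mean_ge0.
rewrite mul1r; set c := homothety u l^-1 x.
have dxu := dist2_dilation u; rewrite -/c in dxu.
have cr : dist2 u c <= r2 by rewrite -(ler_pM2l l_gt0) -dxu.
have rc : r1 <= dist2 u c by rewrite -(ler_pM2l l_gt0) -dxu ltW.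
have xE : homothety u l c = x by rewrite homothetyK// gt_eqF.
have xu : dist2 x u <= rho.
  by rewrite dxu (le_trans _ (le_trans cr r2_le))// ler_piMl ?dist2_ge0// ltW.
have du : deep u (2 * rho).
  apply: (deep_ball (rho' := rho)) xu => i.
  by have := x_deep i; lra.
have dc : deep c (dist2 u c).
  apply: (deep_ball (rho' := dist2 u c)) (lexx _) => i.
  by have := du i; have := le_trans cr r2_le; lra.
have uc : in_cube u.
  apply: deep_in_cube du; rewrite mulr_ge0// (le_trans (ltW r20)) //.
have := mean_lune_ge l_gt0 (ltW l_lt1) eta_gt0 (ltW eta_lt1) l_eta (dist2_ge0 u c) uc dc.
rewrite xE => lune.
apply: le_trans (le_trans lune _).
  apply: ler_wpM2l; first by rewrite subr_ge0.
  by rewrite lerXn2r// ?nnegrE ?divr_ge0// ?mulr_ge0 ?dist2_ge0// ?(ltW r1_gt0)//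
    ler_pM2r ?invr_gt0// ler_pM2l.
rewrite le_eqVlt; apply/predU1l/eq_mean => v; congr (_%:R); congr nat_of_bool.
by rewrite /bad_pair -/c h1 h2 dxu.
Qed.

End bad_pair.

End lune.

(** * The expected matching size as a function of the ranges *)

Section two_coordinates.
Context d (T : measurableType d) (R : realType) (P : probability T R) (m : nat).

Lemma mean_forall_ge (a : 'I_m -> T -> bool) (alpha : R) : 0 <= alpha ->
  (forall i, measurable_fun setT (a i)) ->
  (forall i, alpha <= mean P (fun x => (a i x)%:R)) ->
  alpha ^+ m <= mean (pow_prob P m) (fun t => [forall i, a i (tnth t i)]%:R).
Proof.
move=> a0 ma h; rewrite mean_forall_tnth// -[m in leLHS]card_ord -prodr_const.
by apply: ler_prod => i _; rewrite a0 h.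
Qed.

Variables (j1 j2 : 'I_m) (f : T -> T -> bool) (g : T -> bool) (alpha K : R).
Hypothesis j12 : j1 != j2.
Hypothesis mf : measurable_fun setT (fun p : T * T => f p.1 p.2).
Hypothesis mg : measurable_fun setT g.
Hypotheses (alpha_ge0 : 0 <= alpha) (K_ge0 : 0 <= K).
Hypothesis alpha_le : alpha <= mean P (fun x => (g x)%:R).
Hypothesis K_le : K <= mean P (fun u => mean P (fun v => (f u v)%:R)).

Let others (t : m.-tuple T) :=
  [forall j, (j != j1) && (j != j2) ==> g (tnth t j)].

Let bm_others : bounded_measurable (fun t => (others t)%:R : R).
Proof.
apply: bm_bool.
apply: (measurable_forall_tnth
  (a := fun j x => (j != j1) && (j != j2) ==> g x)) => j.
by case: (_ && _).
Qed.

Let bm_f : bounded_measurable (fun p : T * T => (f p.1 p.2)%:R : R).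
Proof. exact: bm_bool. Qed.

Let mpair : measurable_fun setT (fun t : m.-tuple T => (tnth t j1, tnth t j2)).
Proof. by apply/measurable_fun_pairP; split; exact: measurable_tnth. Qed.

(** Resampling the coordinates [j1] and [j2] does not affect [others], so the mean factorizes. *)
Lemma mean_two_coordinates_ge :
  alpha ^+ m * K <= mean (pow_prob P m) (fun t =>
    (f (tnth t j1) (tnth t j2) &&
     [forall j, (j != j1) && (j != j2) ==> g (tnth t j)])%:R).
Proof.
have bF : bounded_measurable (fun t : m.-tuple T =>
    (f (tnth t j1) (tnth t j2) && others t)%:R : R).
  rewrite (_ : (fun t => _) = fun t =>
      (f (tnth t j1) (tnth t j2))%:R * (others t)%:R).
    apply: bmM bm_others.
    exact: (bm_comp (f := fun p : T * T => (f p.1 p.2)%:R) mpair).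
  by apply/funext => t; rewrite -natrM mulnb.
rewrite (mean_resample P j2 bF).
have bG := bm_mean1 (pow_prob P m) P (bm_upd j2 bF).
rewrite (mean_resample P j1 bG).
have oupd1 x t : others (upd j1 x t) = others t.
  by apply: eq_forallb => j; rewrite tnth_upd; case: (eqVneq j j1).
have oupd2 x t : others (upd j2 x t) = others t.
  by apply: eq_forallb => j; rewrite tnth_upd; case: (eqVneq j j2) => //; rewrite andbF.
have E t : mean P (fun x => mean P (fun y =>
    (f (tnth (upd j2 y (upd j1 x t)) j1) (tnth (upd j2 y (upd j1 x t)) j2) &&
     others (upd j2 y (upd j1 x t)))%:R)) =
    mean P (fun u => mean P (fun v => (f u v)%:R)) * (others t)%:R.
  rewrite [RHS]mulrC -meanZ; last exact: (bm_mean1 P P bm_f).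
  apply: eq_mean => u; rewrite -meanZ; last exact: (bm_pair1 u bm_f).
  apply: eq_mean => v.
  rewrite oupd2 oupd1 !tnth_upd (negbTE j12) !eqxx.
  by rewrite -natrM mulnb andbC.
under eq_mean do rewrite E.
rewrite meanZ//; apply: le_trans (_ : K * mean (pow_prob P m) (fun t => (others t)%:R) <= _).
  rewrite mulrC ler_wpM2l//.
  apply: (mean_forall_ge (a := fun j x => (j != j1) && (j != j2) ==> g x)) => //.
    by move=> j; case: (_ && _).
  (* The coordinates [j1] and [j2] are unconstrained here; for them [alpha <= 1] suffices, at the
     price of the exponent [m]. *)
  move=> j; case: (_ && _) => //=; rewrite mean_cst.
  by rewrite (le_trans alpha_le)// mean_bool_le1.
by rewrite ler_wpM2r// mean_ge0.
Qed.

End two_coordinates.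

Section matching_functional.
Context (R : realType) (k n m : nat).
Local Notation TR := (measurableTypeR R).
Local Notation Pt := (k.-tuple TR).
Local Notation U := (unif_cube R k).
Local Notation Law := (locations R k n m).
Local Notation Om := (n.-tuple Pt * m.-tuple Pt)%type.

Definition radius (x : R) : R := (x / n%:R) `^ (k%:R^-1).

(* Only pairs satisfying [z] are joined, so that an artificial removal of edges
   can be expressed. *)
Definition range_adj (z : k.-tuple R -> k.-tuple R -> bool) (r : 'I_n -> R)
    (s : n.-tuple (k.-tuple R)) (d : m.-tuple (k.-tuple R)) i j :=
  (dist2 (tnth s i) (tnth d j) <= radius (r i)) && z (tnth s i) (tnth d j).

Definition mean_matching z r : R :=
  mean Law (fun w => (max_matching (range_adj z r w.1 w.2))%:R).

Lemma bm_max_matching d (T : measurableType d) (a : T -> 'I_n -> 'I_m -> bool) :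
  (forall i j, measurable_fun setT (fun w => a w i j)) ->
  bounded_measurable (fun w => (max_matching (a w))%:R : R).
Proof.
move=> ma; split; last first.
  by exists n%:R => w; rewrite normr_nat ler_nat max_matching_leq_size.
apply: (@measurable_fun_of_bools _ _ _ _ ('I_n * 'I_m)%type
  (fun e w => a w e.1 e.2)) => [e|w w' e]; first exact: ma.
by congr (_%:R); apply: eq_max_matching => i j; exact: (e (i, j)).
Qed.

Lemma measurable_supply i : measurable_fun setT (fun w : Om => tnth w.1 i : Pt).
Proof. exact: (measurableT_comp (measurable_tnth i) measurable_fst). Qed.

Lemma measurable_demand j : measurable_fun setT (fun w : Om => tnth w.2 j : Pt).
Proof. exact: (measurableT_comp (measurable_tnth j) measurable_snd). Qed.

Lemma measurable_range_adj z r :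
  measurable_fun setT (fun p : Pt * Pt => z p.1 p.2) -> forall i j,
  measurable_fun setT (fun w : Om => range_adj z r w.1 w.2 i j).
Proof.
move=> mz i j; apply: measurable_and.
  apply: measurable_fun_ler => //.
  by apply: measurable_dist2; [exact: measurable_supply | exact: measurable_demand].
apply: (measurableT_comp (f := fun p : Pt * Pt => z p.1 p.2) mz
  (g := fun w : Om => (tnth w.1 i, tnth w.2 j))).
apply/measurable_fun_pairP; split; first exact: measurable_supply.
exact: measurable_demand.
Qed.

Lemma bm_range_matching z r :
  measurable_fun setT (fun p : Pt * Pt => z p.1 p.2) ->
  bounded_measurable (fun w : Om => (max_matching (range_adj z r w.1 w.2))%:R : R).
Proof. by move=> mz; apply: bm_max_matching => i j; exact: measurable_range_adj. Qed.

Lemma mu_mean_matching (r : 'rV[R]_n) :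
  mu k m r = (mean_matching (fun _ _ => true) (r ord0))%:E.
Proof.
rewrite /mu unlock /mean_matching /mean /Rintegral fineK; last first.
  by apply: integrable_fin_num => //; apply: bm_integrable; exact: bm_range_matching.
apply: eq_integral => w _; congr (_%:R%:E); apply: eq_max_matching => i j.
by rewrite /range_adj andbT.
Qed.

(** Permuting the ranges amounts to permuting the supply locations, whose joint law is
    exchangeable. *)
Lemma mean_matching_perm z r (s : {perm 'I_n}) :
  measurable_fun setT (fun p : Pt * Pt => z p.1 p.2) ->
  mean_matching z (r \o s) = mean_matching z r.
Proof.
move=> mz; rewrite /mean_matching.
have b1 := bm_range_matching (r \o s) mz; have b2 := bm_range_matching r mz.
rewrite [LHS](mean_prod2 (pow_prob U n) (pow_prob U m) b1).
rewrite [RHS](mean_prod2 (pow_prob U n) (pow_prob U m) b2).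
apply: eq_mean => d; rewrite -[RHS](mean_permute U s^-1%g (bm_pair2 d b2)).
apply: eq_mean => x /=; congr (_%:R).
rewrite -[LHS](max_matching_perm _ s^-1%g); apply: eq_max_matching => i j.
by rewrite /range_adj /= permKV /permute tnth_mktuple.
Qed.


End matching_functional.

Lemma sum_le_exists (R : realType) (I : finType) (Q : pred I) (E : pred I) :
  (forall p q, E p -> E q -> p = q) ->
  \sum_(p | Q p) (E p)%:R <= [exists p, E p]%:R :> R.
Proof.
move=> uniqE; case: (boolP [exists p, E p]) => [/existsP[p Ep]|/existsPn noE].
  apply: (@le_trans _ _ (\sum_q (E q)%:R)).
    by rewrite [leRHS](bigID Q)/= lerDl sumr_ge0.
  rewrite (bigD1 p)//= Ep big1 ?addr0// => q qp.
  by case: (boolP (E q)) => // /uniqE/(_ Ep) e; rewrite e eqxx in qp.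
by rewrite big1// => p _; rewrite (negbTE (noE p)).
Qed.

(** * Concavity in the range of a single supply *)

Section one_coordinate.
Context (R : realType) (k n m : nat).
Local Notation TR := (measurableTypeR R).
Local Notation Pt := (k.-tuple TR).
Local Notation U := (unif_cube R k).
Local Notation Law := (locations R k n m).
Local Notation Om := (n.-tuple Pt * m.-tuple Pt)%type.
Local Notation all_pairs := (fun _ _ : k.-tuple R => true).
Local Notation radius := (@radius R k n).
Variables (i0 : 'I_n) (r : 'I_n -> R) (gam : R).
Hypotheses (k_gt0 : (0 < k)%N) (n_gt0 : (0 < n)%N) (gam_gt0 : 0 < gam).
Hypothesis r_gam : forall i, 0 <= r i <= gam.

Let n_gt0R : 0 < n%:R :> R. Proof. by rewrite ltr0n. Qed.
Let k_gt0R : 0 < k%:R :> R. Proof. by rewrite ltr0n. Qed.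

Lemma radius_ge0 x : 0 <= radius x.
Proof. exact: powR_ge0. Qed.

Lemma radius_gt0 x : 0 < x -> 0 < radius x.
Proof. by move=> x0; rewrite powR_gt0// divr_gt0. Qed.

Lemma powR_rootK (x : R) : 0 <= x -> (x `^ k%:R^-1) ^+ k = x.
Proof.
move=> x0; rewrite -powR_mulrn ?powR_ge0// -powRrM mulVf ?gt_eqF//.
exact: powRr1.
Qed.

Lemma radiusK x : 0 <= x -> radius x ^+ k = x / n%:R.
Proof. by move=> x0; rewrite powR_rootK// divr_ge0// ltW. Qed.

Lemma radiusM l x : 0 <= l -> 0 <= x ->
  radius (l * x) = l `^ k%:R^-1 * radius x.
Proof. by move=> l0 x0; rewrite /radius -powRM ?divr_ge0 ?(ltW n_gt0R)// mulrA. Qed.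

Lemma ler_radius x y : 0 <= x -> x <= y -> radius x <= radius y.
Proof.
move=> x0 xy; apply: ge0_ler_powR; rewrite ?nnegrE ?invr_ge0 ?divr_ge0 ?(ltW n_gt0R)//.
  exact: le_trans xy.
by rewrite ler_pM2r// invr_gt0.
Qed.

Definition rest (w : Om) := without (range_adj all_pairs r w.1 w.2) i0.

Definition open_demand (w : Om) j := missable (rest w) j.

Definition base : R := mean Law (fun w => (max_matching (rest w))%:R).

Definition gain x : R :=
  mean Law (fun w => volume (tnth w.2) (open_demand w) (radius x)).

Lemma without_setf x (w : Om) :
  without (range_adj all_pairs (setf r i0 x) w.1 w.2) i0 = rest w.
Proof.
apply/funext => i; apply/funext => j; rewrite /rest /without.
by case: eqVneq => //= ii0; rewrite /range_adj /setf (negbTE ii0).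
Qed.

Lemma rest_upd y s (d : m.-tuple Pt) : rest (upd i0 y s, d) = rest (s, d).
Proof.
apply/funext => i; apply/funext => j; rewrite /rest /without.
by case: eqVneq => //= ii0; rewrite /range_adj/= tnth_upd (negbTE ii0).
Qed.

Lemma measurable_rest i j : measurable_fun setT (fun w : Om => rest w i j).
Proof. by apply: measurable_and => //; exact: measurable_range_adj. Qed.

Lemma measurable_open_demand j :
  measurable_fun setT (fun w : Om => open_demand w j).
Proof.
apply: (@measurable_fun_of_bools _ _ _ _ ('I_n * 'I_m)%type
  (fun e w => rest w e.1 e.2)) => [e|w w' e]; first exact: measurable_rest.
rewrite /open_demand (_ : rest w = rest w')//.
by apply/funext => i; apply/funext => j'; exact: (e (i, j')).
Qed.

Lemma measurable_hit_at d (T : measurableType d) (X : T -> Om) (Y : T -> Pt) rho :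
  measurable_fun setT X -> measurable_fun setT Y ->
  measurable_fun setT
    (fun v => hit (tnth (X v).2) (open_demand (X v)) rho (Y v)).
Proof.
move=> mX mY; apply: (@measurable_fun_of_bools _ _ _ _ 'I_m
  (fun j v => open_demand (X v) j &&
    (dist2 (Y v : k.-tuple R) (tnth (X v).2 j) <= rho))).
  move=> j; apply: measurable_and.
    exact: (measurableT_comp (measurable_open_demand j) mX).
  apply: measurable_fun_ler => //; apply: measurable_dist2 => //.
  exact: (measurableT_comp (@measurable_demand R k n m j) mX).
by move=> x y e; apply: eq_existsb.
Qed.

Lemma bm_volume rho :
  bounded_measurable (fun w : Om => volume (tnth w.2) (open_demand w) rho : R).
Proof.
apply: (bm_mean1 Law U (f := fun p : Om * Pt =>
  (hit (tnth p.1.2) (open_demand p.1) rho p.2)%:R)).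
by apply: bm_bool; apply: measurable_hit_at.
Qed.

(** The set of open demands does not depend on the location of [i0], so this location can be
    averaged over separately; the chance that it meets a ball around an open demand is a volume. *)
Lemma mean_matching_setf x :
  mean_matching m all_pairs (setf r i0 x) = base + gain x.
Proof.
have mH : measurable_fun setT (fun w : Om =>
    hit (tnth w.2) (open_demand w) (radius x) (tnth w.1 i0 : k.-tuple R)).
  by apply: measurable_hit_at => //; exact: measurable_supply.
have bB : bounded_measurable (fun w : Om => (max_matching (rest w))%:R : R).
  by apply: bm_max_matching => i j; exact: measurable_rest.
have bH := bm_bool R mH.
rewrite /mean_matching.
under eq_mean => w.
  rewrite (max_matching_hit _ i0) without_setf natrD.
  rewrite (_ : [exists j, _] =
      hit (tnth w.2) (open_demand w) (radius x) (tnth w.1 i0)); last first.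
    by apply: eq_existsb => j; rewrite andbC /range_adj andbT /setf eqxx.
  over.
rewrite meanD//; congr (_ + _).
rewrite [LHS](mean_prod2 (pow_prob U n) (pow_prob U m) bH).
rewrite [RHS](mean_prod2 (pow_prob U n) (pow_prob U m) (bm_volume _)).
apply: eq_mean => d.
rewrite (mean_resample U i0 (bm_pair2 d bH)).
apply: eq_mean => s; rewrite /volume; apply: eq_mean => y /=.
by rewrite /open_demand rest_upd tnth_upd eqxx.
Qed.

Lemma gain_le x y : 0 <= x -> x <= y -> gain x <= gain y.
Proof.
move=> x0 xy; apply: mean_le; [exact: bm_volume|exact: bm_volume|].
move=> w; apply: mean_le => [||v].
- by apply: bm_bool; exact: measurable_hit.
- by apply: bm_bool; exact: measurable_hit.
apply: ler_bool => /hitP[j Wj h]; apply/hitP; exists j => //.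
exact: le_trans h (ler_radius x0 xy).
Qed.

Lemma gain_le1 x : gain x <= 1.
Proof.
rewrite -[leRHS](mean_cst Law); apply: mean_le; [exact: bm_volume|exact: bm_cst|].
by move=> w; apply: mean_bool_le1; exact: measurable_hit.
Qed.

Definition demands_in_cube (w : Om) := [forall j, in_cube (tnth w.2 j : k.-tuple R)].

Lemma measurable_demands_in_cube : measurable_fun setT demands_in_cube.
Proof.
apply: (@measurable_fun_of_bools _ _ _ _ 'I_m
  (fun j w => in_cube (tnth w.2 j : k.-tuple R))) => [j|w w' e].
  by apply: measurable_in_cube; exact: measurable_demand.
exact: eq_forallb.
Qed.

Lemma mean_demands_in_cube : mean Law (fun w => (demands_in_cube w)%:R) = 1.
Proof.
have b := bm_bool R measurable_demands_in_cube.
rewrite [LHS](mean_prod1 (pow_prob U n) (pow_prob U m) b).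
have mc : measurable_fun setT (fun x : Pt => in_cube (x : k.-tuple R)).
  exact: (measurable_in_cube (X := id)).
under eq_mean => s.
  rewrite (mean_forall_tnth U (a := fun (_ : 'I_m) x => in_cube x))//.
  rewrite big1 => [|j _]; last exact: unif_cube_in_cube.
  over.
by rewrite mean_cst.
Qed.

Lemma gain_star l x : 0 < l -> l <= 1 -> 0 <= x -> l * gain x <= gain (l * x).
Proof.
move=> l0 l1 x0; rewrite /gain -meanZ; last exact: bm_volume.
apply: (mean_le_as _ _ measurable_demands_in_cube mean_demands_in_cube).
- by apply: bmZ; exact: bm_volume.
- exact: bm_volume.
move=> w /forallP wc; rewrite radiusM ?(ltW l0)//.
set q := l `^ _; have q0 : 0 < q by exact: powR_gt0.
have q1 : q <= 1.
  apply: le_trans (_ : 1 `^ k%:R^-1 <= _); last by rewrite powR1.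
  apply: ge0_ler_powR => //.
    by rewrite nnegrE ltW.
  by rewrite nnegrE.
(* With the negative inner radius [-1] the inner union is empty, and the scaling inequality for
   differences becomes one for the whole union of balls. *)
have neg rho : rho < 0 -> volume (tnth w.2) (open_demand w) rho = 0.
  move=> r0; rewrite /volume -[RHS](mean_cst U 0); apply: eq_mean => y.
  case: hitP => // -[j _]; rewrite leNgt (lt_le_trans r0)//.
  exact: dist2_ge0.
have r12 : -1 <= radius x by rewrite (le_trans _ (radius_ge0 x))// oppr_le0.
have no_bad : measurable_fun setT (fun _ : Pt => false) by [].
have := volume_scaling r12 q0 q1 wc (bad := fun=> false) _ no_bad.
move=> /(_ (open_demand w)); rewrite mean_cst addr0 mulrN1.
rewrite (neg (-1)) ?oppr_lt0// (neg (- q)) ?oppr_lt0//.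
by rewrite !subr0 powR_rootK ?(ltW l0)//; apply.
Qed.

Section bad_event.
Variables (r1 r2 l eta : R).
Let rho := radius gam.
Hypotheses (r1_gt0 : 0 < r1) (r12 : r1 <= r2) (r2_le : r2 <= rho).
Hypotheses (l_gt0 : 0 < l) (l_lt1 : l < 1) (eta_gt0 : 0 < eta) (eta_lt1 : eta < 1).
Hypothesis l_eta : l ^+ k <= eta ^+ k.
Hypothesis rho_small : 12 * rho <= 1.

Let rho_gt0 : 0 < rho. Proof. exact: radius_gt0. Qed.

(** Restricting [y] to the box of half-width [1 / 4] about this point removes boundary effects,
    because [3 * rho <= 1 / 4]. *)
Let center : k.-tuple R := [tuple 1 / 2 | _ < k].

(* The demands [e.1] and [e.2] form a bad pair for [y] and are isolated in the
   graph without [i0], so that every maximum matching of it misses both. *)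
Definition bad_at (e : 'I_m * 'I_m) (w : Om) (y : k.-tuple R) :=
  [&& in_box center (4^-1) y,
      [forall i, (i != i0) ==> ~~ in_box y (3 * rho) (tnth w.1 i)],
      e.1 != e.2 &
      bad_pair r1 r2 l eta y (tnth w.2 e.1) (tnth w.2 e.2) &&
      [forall j, (j != e.1) && (j != e.2) ==>
                 ~~ in_box y (3 * rho) (tnth w.2 j)]].

Definition bad_event (w : Om) y := [exists e, bad_at e w y].

Lemma center_deep y : in_box center (4^-1) y -> deep y (3 * rho).
Proof.
move=> /in_boxP h i; have := h i; rewrite tnth_mktuple ler_norml.
by have := rho_small; have := rho_gt0; lra.
Qed.

Lemma far_box (y v : k.-tuple R) a b : dist2 y v <= a -> a <= b -> in_box y b v.
Proof.
move=> h ab; apply/in_boxP => i; rewrite distrC.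
exact: le_trans (ler_coord_dist2 _ _ _) (le_trans h ab).
Qed.

Lemma bad_at_near e w y : bad_at e w y ->
  dist2 y (tnth w.2 e.1) <= rho /\ dist2 y (tnth w.2 e.2) <= 2 * rho.
Proof. by move=> /and5P[_ _ _ bp _]; exact: (bad_pair_near r2_le l_gt0 l_lt1 eta_lt1 bp). Qed.

(** No third demand lies in the box about [y], and [bad_pair] orders the two by their distance to
    [y]. This disjointness lets the probabilities add up over all ordered pairs of demands. *)
Lemma bad_at_uniq w y e e' : bad_at e w y -> bad_at e' w y -> e = e'.
Proof.
case: e e' => [a b] [a' b'] B B'.
have [/= na nb] := bad_at_near B; have [/= na' nb'] := bad_at_near B'.
have rho2 : rho <= 3 * rho by have := rho_gt0; lra.
have rho3 : 2 * rho <= 3 * rho by have := rho_gt0; lra.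
move: B B' => /and5P[_ _ /= ab /and4P[_ _ _ lt] /forallP far].
move=> /and5P[_ _ /= ab' /and4P[_ _ _ lt'] _].
have inE j : in_box y (3 * rho) (tnth w.2 j) -> (j == a) || (j == b).
  move=> jb; have := far j; rewrite jb implybF negb_and !negbK.
  exact.
have /orP[/eqP ea|/eqP ea] := inE a' (far_box na' rho2);
  have /orP[/eqP eb|/eqP eb] := inE b' (far_box nb' rho3); subst a' b' => //.
- by rewrite eqxx in ab'.
- by have := lt_trans lt lt'; rewrite ltxx.
- by rewrite eqxx in ab'.
Qed.

(** A supply other than [i0] adjacent to [j] would be within [2 * rho + rho] of [y]; this is the
    origin of the box size [3 * rho]. *)
Lemma isolated_open (w : Om) y j :
  [forall i, (i != i0) ==> ~~ in_box y (3 * rho) (tnth w.1 i)] ->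
  dist2 y (tnth w.2 j) <= 2 * rho -> open_demand w j.
Proof.
move=> /forallP far yj; apply: missable_isolated => i; rewrite /rest /without.
case: (boolP (i != i0)) => //= ii0; rewrite /range_adj andbT.
have := far i; rewrite ii0 /=; apply: contra => h.
have /andP[ri rg] := r_gam i.
apply: (@far_box _ _ (2 * rho + rho)); last by lra.
apply: le_trans (dist2_triangle (tnth w.2 j) _ _) _; rewrite lerD// dist2C.
exact: le_trans h (ler_radius ri rg).
Qed.

Lemma bad_event_spec w y : bad_event w y -> exists j1 j2,
  [/\ open_demand w j1, open_demand w j2,
      l * r1 < dist2 y (tnth w.2 j1) <= l * r2,
      (forall i, open_demand w i -> i != j1 ->
         dist2 y (tnth w.2 j1) < dist2 y (tnth w.2 i)) &
      dist2 (homothety (tnth w.2 j1) l^-1 y) (tnth w.2 j2) <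
      dist2 (homothety (tnth w.2 j1) l^-1 y) (tnth w.2 j1)].
Proof.
move=> /existsP[[j1 j2] B]; have [/= n1 n2] := bad_at_near B.
have rho2 : rho <= 2 * rho by have := rho_gt0; lra.
move: B => /and5P[_ far /= j12 bp /forallP fard].
exists j1, j2; split.
- exact: isolated_open far (le_trans n1 rho2).
- exact: isolated_open far n2.
- by case/and4P: bp => -> ->.
- move=> i _ ij1; case: (eqVneq i j2) => [->|ij2]; first by case/and4P: bp.
  have := fard i; rewrite ij1 ij2 /= ltNge; apply: contra => h.
  by apply: (far_box h); rewrite (le_trans n1)//; have := rho_gt0; lra.
- exact: (bad_pair_lt r1_gt0 l_gt0 eta_lt1 bp).
Qed.

Lemma measurable_in_box_pair d (T : measurableType d) (X Y : T -> Pt) b :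
  measurable_fun setT X -> measurable_fun setT Y ->
  measurable_fun setT (fun v => in_box (X v : k.-tuple R) b (Y v)).
Proof.
move=> mX mY; apply: (@measurable_fun_of_bools _ _ _ _ 'I_k
  (fun i v => `|tnth (Y v) i - tnth (X v) i| <= b)) => [i|v v' e].
  apply: measurable_fun_ler => //; apply: measurableT_comp => //.
  by apply: measurable_funB; exact: measurable_coord.
exact: eq_forallb.
Qed.

Lemma measurable_bad_at e d (T : measurableType d) (X : T -> Om) (Y : T -> Pt) :
  measurable_fun setT X -> measurable_fun setT Y ->
  measurable_fun setT (fun v => bad_at e (X v) (Y v)).
Proof.
move=> mX mY.
have mS i : measurable_fun setT (fun v => tnth (X v).1 i : Pt).
  exact: (measurableT_comp (@measurable_supply R k n m i) mX).
have mD j : measurable_fun setT (fun v => tnth (X v).2 j : Pt).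
  exact: (measurableT_comp (@measurable_demand R k n m j) mX).
apply: measurable_and.
  by apply: (measurable_in_box_pair (X := fun=> center)).
apply: measurable_and.
  apply: (@measurable_fun_of_bools _ _ _ _ 'I_n
    (fun i v => in_box (Y v : k.-tuple R) (3 * rho) (tnth (X v).1 i))) => [i|v v' h].
    exact: measurable_in_box_pair.
  by apply: eq_forallb => i; rewrite h.
apply: measurable_and => //.
apply: measurable_and; first exact: measurable_bad_pair.
apply: (@measurable_fun_of_bools _ _ _ _ 'I_m
  (fun i v => in_box (Y v : k.-tuple R) (3 * rho) (tnth (X v).2 i))) => [i|v v' h].
  exact: measurable_in_box_pair.
by apply: eq_forallb => i; rewrite h.
Qed.

Lemma measurable_bad_event d (T : measurableType d) (X : T -> Om) (Y : T -> Pt) :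
  measurable_fun setT X -> measurable_fun setT Y ->
  measurable_fun setT (fun v => bad_event (X v) (Y v)).
Proof.
move=> mX mY; apply: (@measurable_fun_of_bools _ _ _ _ ('I_m * 'I_m)%type
  (fun e v => bad_at e (X v) (Y v))) => [e|v v' h].
  exact: measurable_bad_at.
exact: eq_existsb.
Qed.

Let alpha : R := 1 - (6 * rho) ^+ k.
Hypothesis alpha_ge0 : 0 <= alpha.

Let K : R := (1 - (r1 / r2) ^+ k) * (2 * (l * r2) / k%:R) ^+ k *
  ((eta ^+ k - l ^+ k) * (2 * r1 / k%:R) ^+ k).

Let K_ge0 : 0 <= K.
Proof.
have r20 := lt_le_trans r1_gt0 r12.
have q0 : 0 <= r1 / r2 by rewrite divr_ge0// ltW.
have q1 : r1 / r2 <= 1 by rewrite ler_pdivrMr// mul1r.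
apply: mulr_ge0; apply: mulr_ge0; rewrite ?subr_ge0//.
- exact: exprn_ile1.
- by rewrite exprn_ge0// divr_ge0 ?ltW// !mulr_gt0.
- by rewrite exprn_ge0// divr_ge0 ?ltW// mulr_gt0.
Qed.

Let outside_ge (y : k.-tuple R) :
  alpha <= mean U (fun v => (~~ in_box y (3 * rho) v)%:R).
Proof.
have mb := measurable_in_box y (3 * rho).
have -> : mean U (fun v => (~~ in_box y (3 * rho) v)%:R) =
    mean U (fun v => 1 - (in_box y (3 * rho) v)%:R).
  by apply: eq_mean => v; case: in_box; rewrite ?subrr ?subr0.
rewrite meanB; [|exact: bm_cst|exact: bm_bool].
rewrite mean_cst lerD2l lerN2 (_ : 6 * rho = 2 * (3 * rho)); last by ring.
by rewrite mean_in_box_le// mulr_ge0// ltW.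
Qed.

(** The factors account, in order, for [y] in the central box, for supplies far from [y], for the
    other demands far from [y], and for the bad pair itself. *)
Lemma mean_bad_at_ge e : e.1 != e.2 ->
  2^-1 ^+ k * (alpha ^+ n * (alpha ^+ m * K)) <=
  mean Law (fun w => mean U (fun y => (bad_at e w y)%:R)).
Proof.
move=> e12.
have bB : bounded_measurable (fun p : Om * Pt => (bad_at e p.1 p.2)%:R : R).
  by apply: bm_bool; exact: measurable_bad_at.
rewrite -(mean_prod1 Law U bB) (mean_prod2 Law U bB).
pose c (y : Pt) := in_box center (4^-1) y.
have mc : measurable_fun setT c by exact: measurable_in_box.
have cE : mean U (fun y => (c y)%:R) = 2^-1 ^+ k.
  rewrite mean_in_box_ge//; first by congr (_ ^+ _); field.
  by move=> i; rewrite tnth_mktuple; lra.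
rewrite -cE mulrC -meanZ; last exact: bm_bool.
apply: mean_le.
- by apply: bmZ; exact: bm_bool.
- exact: (bm_mean2 Law U bB).
move=> y; case: (boolP (c y)) => cy; last by rewrite mulr0 mean_ge0.
rewrite mulr1.
have bBy := bm_pair2 y bB.
rewrite (mean_prod1 (pow_prob U n) (pow_prob U m) bBy).
pose A (s : n.-tuple Pt) := [forall i, (i != i0) ==> ~~ in_box y (3 * rho) (tnth s i)].
have mA : measurable_fun setT A.
  apply: (measurable_forall_tnth (a := fun i x => (i != i0) ==> ~~ in_box y (3 * rho) x)).
  by move=> i; case: (i != i0) => //; apply: measurable_neg; exact: measurable_in_box.
apply: le_trans (_ : mean (pow_prob U n) (fun s => (alpha ^+ m * K) * (A s)%:R) <= _).
  rewrite meanZ; last exact: bm_bool.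
  rewrite [leLHS]mulrC ler_wpM2l//; first exact: mulr_ge0 (exprn_ge0 _ alpha_ge0) K_ge0.
  apply: (mean_forall_ge (P := U)
    (a := fun i x => (i != i0) ==> ~~ in_box y (3 * rho) x)) => // i.
    by case: (i != i0) => //; apply: measurable_neg; exact: measurable_in_box.
  case: (i != i0) => //=; rewrite mean_cst.
  by rewrite gerBl exprn_ge0// mulr_ge0// ltW.
apply: mean_le.
- by apply: bmZ; exact: bm_bool.
- exact: (bm_mean1 (pow_prob U n) (pow_prob U m) bBy).
move=> s; case: (boolP (A s)) => As; last by rewrite mulr0 mean_ge0.
rewrite mulr1.
have -> : mean (pow_prob U m) (fun d => (bad_at e (s, d) y)%:R) =
    mean (pow_prob U m) (fun d =>
      (bad_pair r1 r2 l eta y (tnth d e.1) (tnth d e.2) &&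
       [forall j, (j != e.1) && (j != e.2) ==> ~~ in_box y (3 * rho) (tnth d j)])%:R).
  apply: eq_mean => d; congr (_%:R); rewrite /bad_at.
  by rewrite (cy : in_box _ _ _) e12 (As : [forall i, _]).
apply: (mean_two_coordinates_ge (P := U) (f := bad_pair r1 r2 l eta y)
  (g := fun v => ~~ in_box y (3 * rho) v)) => //.
- exact: (@measurable_bad_pair _ _ r1 r2 l eta _ _ (fun=> y) fst snd).
- by apply: measurable_neg; exact: measurable_in_box.
apply: (mean_bad_pair_ge k_gt0 (rho := rho)) => //.
exact: center_deep.
Qed.

Lemma mean_bad_event_ge :
  (m * m.-1)%:R * (2^-1 ^+ k * (alpha ^+ n * (alpha ^+ m * K))) <=
  mean Law (fun w => mean U (fun y => (bad_event w y)%:R)).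
Proof.
set c := 2^-1 ^+ k * _.
have bB e : bounded_measurable (fun p : Om * Pt => (bad_at e p.1 p.2)%:R : R).
  by apply: bm_bool; exact: measurable_bad_at.
have bE : bounded_measurable (fun p : Om * Pt => (bad_event p.1 p.2)%:R : R).
  by apply: bm_bool; exact: measurable_bad_event.
apply: le_trans (_ : \sum_(e : 'I_m * 'I_m | e.1 != e.2)
    mean Law (fun w => mean U (fun y => (bad_at e w y)%:R)) <= _).
  apply: le_trans (_ : \sum_(e : 'I_m * 'I_m | e.1 != e.2) c <= _).
    rewrite -(pair_big_dep xpredT (fun i j : 'I_m => i != j) (fun _ _ => c))/=.
    rewrite (eq_bigr (fun=> m.-1%:R * c)); last first.
      move=> i _; rewrite sumr_const mulr_natl; congr (_ *+ _).
      rewrite -[in RHS](card_ord m) -(cardC1 i).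
      by apply: eq_card => j; rewrite !inE eq_sym.
    by rewrite sum_cst card_ord natrM -mulrA.
  by apply: ler_sum => e e12; exact: mean_bad_at_ge.
rewrite -mean_sum; last first.
  by move=> e _; exact: (bm_mean1 Law U (bB e)).
apply: mean_le.
- by apply: bm_sum => e _; exact: (bm_mean1 Law U (bB e)).
- exact: (bm_mean1 Law U bE).
move=> w; rewrite -mean_sum; last by move=> e _; exact: (bm_pair1 w (bB e)).
apply: mean_le.
- by apply: bm_sum => e _; exact: (bm_pair1 w (bB e)).
- exact: (bm_pair1 w bE).
by move=> y; apply: sum_le_exists => e e'; exact: bad_at_uniq.
Qed.

End bad_event.

Let alpha : R := 1 - (6 * radius gam) ^+ k.

(** The lower bound for the mean of [bad_event], divided by [(x * (q - 1) / q) ^+ 2]. The annulus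
    and the lune each contribute a factor [(2 / k) ^+ k / n], the choice of [eta] the factor one
    half, and the ordered pairs of demands the factor [m * m.-1]. *)
Definition curvature : R := (m * m.-1)%:R / n%:R ^+ 2 *
  (2^-1 ^+ k * (alpha ^+ n * (alpha ^+ m * ((2 / k%:R) ^+ k ^+ 2 / 2)))).

Hypotheses (radius_small : 12 * radius gam <= 1) (alpha_ge0 : 0 <= alpha).

(** Dividing a range by [q] multiplies its radius by [l] with [l ^+ k = q^-1], so volume scaling
    becomes the ratio condition for [gain]; the volume of the bad points is the quadratic
    surplus. *)
Lemma gain_gap x q : 0 < x -> 1 < q -> x * q <= gam ->
  (gain (x * q) - gain x) / q + curvature * (x * (q - 1) / q) ^+ 2 <=
  gain x - gain (x / q).
Proof.
move=> x0 q1 xq.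
have q0 : 0 < q by exact: lt_trans q1.
have xq0 : 0 < x * q by exact: mulr_gt0.
pose lam := q^-1; have lam0 : 0 < lam by rewrite invr_gt0.
have lam1 : lam < 1 by rewrite invf_lt1.
have kV : 0 < k%:R^-1 :> R by rewrite invr_gt0.
pose l := lam `^ k%:R^-1; have l0 : 0 < l by exact: powR_gt0.
have root_lt1 (t : R) : 0 < t -> t < 1 -> t `^ k%:R^-1 < 1.
  move=> t0 t1; apply: lt_le_trans (_ : 1 `^ k%:R^-1 <= _); last by rewrite powR1.
  by apply: gt0_ltr_powR => //; rewrite nnegrE// ltW.
have l1 : l < 1 by exact: root_lt1.
(* [eta ^+ k] is the midpoint of [l ^+ k] and [1]: then [eta < 1], while [eta ^+ k - l ^+ k] stays
   proportional to [1 - lam]. *)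
pose mid := (1 + lam) / 2.
have mid0 : 0 < mid by rewrite divr_gt0// addr_gt0.
have mid1 : mid < 1 by rewrite /mid; lra.
pose eta := mid `^ k%:R^-1; have eta0 : 0 < eta by exact: powR_gt0.
have eta1 : eta < 1 by exact: root_lt1.
have lk : l ^+ k = lam by rewrite powR_rootK// ltW.
have ek : eta ^+ k = mid by rewrite powR_rootK// ltW.
have l_eta : l ^+ k <= eta ^+ k by rewrite lk ek /mid; lra.
pose r1 := radius x; pose r2 := radius (x * q).
have r10 : 0 < r1 by exact: radius_gt0.
have r12 : r1 <= r2 by rewrite ler_radius ?ltW// ltr_pMr.
have r2g : r2 <= radius gam by rewrite ler_radius// ltW.
have rx : l * r2 = r1.
  by rewrite -radiusM ?ltW// /lam mulrC mulfK// gt_eqF.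
have rxq : l * r1 = radius (x / q).
  by rewrite -radiusM ?ltW// /lam mulrC.
have r1k : r1 ^+ k = x / n%:R by rewrite radiusK// ltW.
have r2k : r2 ^+ k = x * q / n%:R by rewrite radiusK// ltW.
have := mean_bad_event_ge r10 r12 r2g l0 l1 eta0 eta1 l_eta radius_small alpha_ge0.
have -> : (1 - (r1 / r2) ^+ k) * (2 * (l * r2) / k%:R) ^+ k *
    ((eta ^+ k - l ^+ k) * (2 * r1 / k%:R) ^+ k) =
    ((2 / k%:R) ^+ k ^+ 2 / 2) * (x * (q - 1) / q) ^+ 2 / n%:R ^+ 2.
  have -> : (r1 / r2) ^+ k = q^-1.
    by rewrite expr_div_n r1k r2k; field; rewrite !gt_eqF.
  have -> : (2 * r1 / k%:R) ^+ k = (2 / k%:R) ^+ k * (x / n%:R).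
    by rewrite mulrAC exprMn r1k.
  rewrite rx; have -> : (2 * r1 / k%:R) ^+ k = (2 / k%:R) ^+ k * (x / n%:R).
    by rewrite mulrAC exprMn r1k.
  rewrite lk ek /mid /lam; set a := (2 / k%:R) ^+ k.
  by field; rewrite !gt_eqF.
have -> : (m * m.-1)%:R * (2^-1 ^+ k * (alpha ^+ n * (alpha ^+ m *
    ((2 / k%:R) ^+ k ^+ 2 / 2 * (x * (q - 1) / q) ^+ 2 / n%:R ^+ 2)))) =
    curvature * (x * (q - 1) / q) ^+ 2.
  by rewrite /curvature; field; rewrite !gt_eqF.
move=> bad_ge.
have bE : bounded_measurable (fun p : Om * Pt => (bad_event r1 r2 l eta p.1 p.2)%:R : R).
  by apply: bm_bool; exact: measurable_bad_event.
have bV := bm_volume.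
apply: le_trans (_ : mean Law (fun w => lam * (volume (tnth w.2) (open_demand w) r2 -
    volume (tnth w.2) (open_demand w) r1) +
    mean U (fun y => (bad_event r1 r2 l eta w y)%:R)) <= _).
  rewrite meanD; [|by apply: bmZ; exact: bmB|exact: (bm_mean1 Law U bE)].
  by rewrite meanZ ?meanB//; [rewrite [lam * _]mulrC lerD2l|exact: bmB].
have -> : gain x - gain (x / q) = mean Law (fun w =>
    volume (tnth w.2) (open_demand w) (l * r2) -
    volume (tnth w.2) (open_demand w) (l * r1)).
  by rewrite (meanB Law (bV (l * r2)) (bV (l * r1))) rx rxq.
apply: (mean_le_as _ _ measurable_demands_in_cube mean_demands_in_cube).
- apply: bmD; first by apply: bmZ; exact: bmB.
  exact: (bm_mean1 Law U bE).
- exact: bmB.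
move=> w /forallP wc; rewrite -lk.
have mb : measurable_fun setT (fun y : Pt => bad_event r1 r2 l eta w y).
  exact: (measurable_bad_event _ _ _ _ (X := fun=> w) (Y := id)).
apply: (volume_scaling r12 l0 (ltW l1) wc (bad := bad_event r1 r2 l eta w) _ mb).
by move=> y; exact: bad_event_spec.
Qed.

(** Star-shapedness bounds the increment by [1 - x / y] times [gain y], and [gain] is at most
    one. *)
Lemma gain_lipschitz a x y : 0 < a -> a <= x -> x <= y ->
  `|gain y - gain x| <= a^-1 * (y - x).
Proof.
move=> a0 ax xy; have x0 := lt_le_trans a0 ax; have y0 := lt_le_trans x0 xy.
rewrite ger0_norm ?subr_ge0 ?gain_le ?(ltW x0)//.
have xy0 : 0 < x / y by rewrite divr_gt0.
have xy1 : x / y <= 1 by rewrite ler_pdivrMr// mul1r.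
have := gain_star xy0 xy1 (ltW y0); rewrite divfK ?gt_eqF// => st.
apply: (@le_trans _ _ ((1 - x / y) * gain y)); first by rewrite mulrBl mul1r lerD2l lerN2.
apply: (@le_trans _ _ (1 - x / y)).
  by rewrite ler_piMr ?gain_le1// subr_ge0.
have -> : 1 - x / y = y^-1 * (y - x) by field; rewrite gt_eqF.
by rewrite ler_wpM2r ?subr_ge0// lef_pV2 ?posrE// (le_trans ax).
Qed.

Lemma gain_continuous a b : 0 < a -> {within `[a, b], continuous gain}.
Proof.
move=> a0; apply/subspace_continuousP => x; rewrite /= in_itv/= => /andP[ax xb].
apply/cvgrPdist_le => e e0; rewrite /prop_near1 /nbhs /= /within/=.
near=> y; rewrite in_itv/= => /andP[ay yb].
apply: le_trans (_ : a^-1 * `|x - y| <= _).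
  case: (leP x y) => [xy|/ltW yx]; last first.
    by rewrite [`|x - y|]ger0_norm ?subr_ge0// gain_lipschitz.
  by rewrite distrC [`|x - y|]distrC [`|y - x|]ger0_norm ?subr_ge0// gain_lipschitz.
rewrite -ler_pdivlMl ?invr_gt0// invrK ltW//.
by near: y; apply/nbhs_ballP; exists (a * e) => //=; exact: mulr_gt0.
Unshelve. all: by end_near. Qed.

Lemma gain_jensen (delta : R) p (v : 'I_p -> R) c :
  0 < delta -> delta <= curvature ->
  (0 < p)%N -> 0 < c -> c < gam -> (forall i, 0 <= v i <= gam) ->
  \sum_i v i = p%:R * c ->
  p%:R^-1 * (\sum_i gain (v i)) <=
  gain c - p%:R^-1 * (delta / 4 * \sum_i (v i - c) ^+ 2).
Proof.
move=> d0 dD p0 c0 cg vg vc.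
have p0R : 0 < p%:R :> R by rewrite ltr0n.
(* Strong concavity: the added square violates the ratio condition by [(q + 1) / 4] times
   [delta * (t * (q - 1) / q) ^+ 2]. The surplus of [gain_gap] is larger because [(q + 1) / 4 < 1]
   for [q <= 2]. Jensen's inequality for [H] then yields the variance term. *)
pose H x := gain x + delta / 4 * x ^+ 2.
have Hc a b : 0 < a -> a <= b -> b <= gam -> {within `[a, b], continuous H}.
  move=> a0 ab bg x; apply: cvgD; first exact: gain_continuous.
  have : {within `[a, b], continuous (fun y : R => delta / 4 * y ^+ 2)}.
    apply: continuous_subspaceT => y; apply: cvgM; first exact: cvg_cst.
    exact: exprn_continuous.
  exact.
have Hr t q : 0 < t -> 1 < q -> q <= 2 -> t * q <= gam ->
    (H (t * q) - H t) / q < H t - H (t / q).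
  move=> t0 q1 q2 tq; have q0 : 0 < q by exact: lt_trans q1.
  have := gain_gap t0 q1 tq.
  have : delta * (t * (q - 1) / q) ^+ 2 <= curvature * (t * (q - 1) / q) ^+ 2.
    by rewrite ler_wpM2r// sqr_ge0.
  have : 0 < (delta * (t * (q - 1) / q) ^+ 2) * (1 - (q + 1) / 4).
    rewrite !mulr_gt0// ?invr_gt0 ?subr_gt0//; lra.
  have -> : (H (t * q) - H t) / q = (gain (t * q) - gain t) / q +
      delta / 4 * (t ^+ 2 * (q ^+ 2 - 1) / q).
    rewrite /H; move: (gain (t * q)) (gain t) => g1 g0.
    by field; rewrite gt_eqF.
  have -> : H t - H (t / q) = gain t - gain (t / q) +
      delta / 4 * (t ^+ 2 * (q ^+ 2 - 1) / q) -
      (delta * (t * (q - 1) / q) ^+ 2) * ((q + 1) / 4).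
    rewrite /H; move: (gain t) (gain (t / q)) => g1 g0.
    by field; rewrite gt_eqF.
  have aux (A A' B C D E : R) : A' < A -> A <= B -> C + B <= D ->
      C + E < D + E - A' by lra.
  by rewrite mulrBr mulr1 subr_gt0; exact: aux.
have Hm a : 0 <= a -> a <= gam -> H 0 <= H a.
  move=> a0 ag; rewrite /H lerD ?gain_le// expr0n/= mulr0.
  by rewrite mulr_ge0 ?sqr_ge0// divr_ge0// ltW.
have := ratio_concave_jensen Hc Hr Hm p0 c0 cg vg vc.
rewrite /H big_split/= mulrDr -mulr_sumr.
have -> : \sum_i (v i - c) ^+ 2 = \sum_i v i ^+ 2 - p%:R * c ^+ 2.
  under eq_bigr => i _.
    rewrite (_ : (v i - c) ^+ 2 = v i ^+ 2 - 2 * c * v i + c ^+ 2); last by ring.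
    over.
  rewrite big_split/= sumrB -mulr_sumr vc sum_cst card_ord; ring.
have -> : p%:R^-1 * (delta / 4 * (\sum_i v i ^+ 2 - p%:R * c ^+ 2)) =
    p%:R^-1 * (delta / 4 * \sum_i v i ^+ 2) - delta / 4 * c ^+ 2.
  by field; rewrite gt_eqF.
lra.
Qed.

End one_coordinate.

(** * Separated supplies *)

Section occupancy.
Context d (T : measurableType d) (R : realType) (P : probability T R).
Context (M : nat) (A : 'I_M -> T -> bool) (p : R).
Hypotheses (p_ge0 : 0 <= p) (p_le1 : p <= 1).
Hypothesis mA : forall c, measurable_fun setT (A c).
Hypothesis A_disj : forall c c' x, A c x -> A c' x -> c = c'.
Hypothesis A_le : forall c, mean P (fun x => (A c x)%:R) <= p.

Lemma bernoulli_pow (h e : R) q : 0 <= h -> 0 <= e ->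
  h ^+ q + q%:R * h ^+ q.-1 * e <= (h + e) ^+ q.
Proof.
move=> h0 e0; elim: q => [|q IH]; first by rewrite !mul0r addr0.
rewrite [leRHS]exprS; apply: le_trans (_ : (h + e) * (h ^+ q + q%:R * h ^+ q.-1 * e) <= _).
  case: q {IH} => [|q] /=; first by rewrite !expr1 !expr0; lra.
  have -> : (h + e) * (h ^+ q.+1 + q.+1%:R * h ^+ q * e) =
      h ^+ q.+2 + q.+2%:R * h ^+ q.+1 * e + q.+1%:R * h ^+ q * e * e.
    by rewrite -[q.+2%:R]natr1 !exprS; ring.
  by rewrite lerDl !mulr_ge0 ?exprn_ge0.
by rewrite ler_wpM2l// addr_ge0.
Qed.

Definition occupied (m : nat) (S : {set 'I_M}) (t : m.-tuple T) :=
  [forall c in S, [exists j, A c (tnth t j)]].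

Lemma measurable_occupied m S : measurable_fun setT (@occupied m S).
Proof.
apply: (@measurable_fun_of_bools _ _ _ _ ('I_M * 'I_m)%type
  (fun e (t : m.-tuple T) => A e.1 (tnth t e.2))) => [e|t t' h].
  exact: (measurableT_comp (mA e.1) (measurable_tnth e.2)).
apply: eq_forallb => c; congr (_ ==> _); apply: eq_existsb => j.
exact: (h (c, j)).
Qed.

(* The events that the disjoint cells in [S] are hit are negatively correlated;
   conditioning on one point at a time, Bernoulli's inequality suffices. *)
Lemma mean_occupied_le m (S : {set 'I_M}) :
  mean (pow_prob P m) (fun t => (occupied S t)%:R) <=
  (1 - (1 - p) ^+ m) ^+ #|S|.
Proof.
elim: m S => [|m IH] S.
  (* Without points the bound is [0 ^+ #|S|], which is one exactly when [S] is empty. *)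
  rewrite expr0 subrr -[leRHS](mean_cst (pow_prob P 0)); apply: mean_le.
  - by apply: bm_bool; exact: measurable_occupied.
  - exact: bm_cst.
  move=> t; case: (boolP (occupied S t)) => [/forall_inP h|_]; last first.
    by rewrite exprn_ge0.
  rewrite (_ : #|S| = 0%N) ?expr0//; apply/eqP; rewrite cards_eq0.
  by apply/eqP/setP => c; rewrite inE; apply/negbTE/negP => /h/existsP[[]].
set psi := 1 - (1 - p) ^+ m.
have q1 : 0 <= 1 - p by rewrite subr_ge0.
have q2 : 1 - p <= 1 by rewrite gerBl.
have psi0 : 0 <= psi by rewrite subr_ge0 exprn_ile1.
have psi1 : psi <= 1 by rewrite gerBl exprn_ge0.
have -> : 1 - (1 - p) ^+ m.+1 = psi + p * (1 - psi) by rewrite /psi exprS; ring.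
pose unhit x := [set c in S | ~~ A c x]%SET.
have bO : bounded_measurable (fun z : T * m.-tuple T =>
    (occupied (unhit z.1) z.2)%:R : R).
  apply: bm_bool; apply: (@measurable_fun_of_bools _ _ _ _
    ('I_M + 'I_M * 'I_m)%type (fun e (z : T * m.-tuple T) =>
      match e with inl c => A c z.1 | inr e => A e.1 (tnth z.2 e.2) end)).
    move=> [c|e]; first exact: measurableT_comp (mA c) measurable_fst.
    apply: measurableT_comp (mA e.1) _.
    exact: measurableT_comp (measurable_tnth e.2) measurable_snd.
  move=> z z' h; apply: eq_forallb => c; rewrite !inE (h (inl c)).
  by congr (_ ==> _); apply: eq_existsb => j; exact: (h (inr (c, j))).
apply: le_trans (_ : mean (P \x pow_prob P m)%E
    (fun z => (occupied (unhit z.1) z.2)%:R) <= _).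
  have bS := bm_bool R (@measurable_occupied m.+1 S).
  rewrite /= (mean_distribution _ _ bS); apply: mean_le => //.
    exact: (bm_comp (measurable_cons_pair (n := m)) bS).
  move=> [x t]; apply: ler_bool => /forall_inP h; apply/forall_inP => c.
  rewrite inE => /andP[cS nA]; have /existsP[j] := h c cS.
  case: (unliftP ord0 j) => [j' ->|->]; last by rewrite tnth0 (negbTE nA).
  by rewrite tnthS => Aj; apply/existsP; exists j'.
rewrite (mean_prod1 P (pow_prob P m) bO).
(* Disjointness makes [U] zero or one, so [psi ^+ #|unhit x|] is bounded by an affine function of
   [U] and only the mean of [U] matters. *)
pose U x := \sum_(c in S) (A c x)%:R : R.
have bU : bounded_measurable U by apply: bm_sum => c _; exact: bm_bool.
set q := #|S|.
apply: le_trans (_ : mean P (fun x => psi ^+ q + (psi ^+ q.-1 - psi ^+ q) * U x) <= _).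
  apply: mean_le; first exact: (bm_mean1 P (pow_prob P m) bO).
    by apply: bmD; [exact: bm_cst | exact: bmZ].
  move=> x; apply: le_trans (IH (unhit x)) _; rewrite /U.
  have [/existsP[c /andP[cS Ac]]|no] := boolP [exists c, (c \in S) && A c x].
    have uE : unhit x = S :\ c.
      apply/setP => c'; rewrite !inE andbC; case: (boolP (c' \in S)) => c'S; last by rewrite !andbF.
      case: (eqVneq c' c) => [->|ne]; first by rewrite Ac.
      by rewrite andbT /=; apply/negP => /A_disj/(_ Ac) e; rewrite e eqxx in ne.
    have -> : #|unhit x| = q.-1 by rewrite uE /q (cardsD1 c S) cS.
    rewrite (bigD1 c)//= Ac big1 => [|c' /andP[_ ne]]; last first.
      by apply/eqP; rewrite pnatr_eq0 eqb0; apply/negP => /A_disj/(_ Ac) e; rewrite e eqxx in ne.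
    by rewrite addr0 mulr1 [leRHS]addrC subrK.
  have -> : unhit x = S.
    apply/setP => c; rewrite inE; case: (boolP (c \in S)) => //= cS.
    by apply/negP => Ac; move/existsPn/(_ c): no; rewrite cS Ac.
  rewrite big1 ?mulr0 ?addr0// => c cS.
  by move/existsPn/(_ c): no; rewrite cS /= => /negbTE ->.
rewrite meanD; [|exact: bm_cst|exact: bmZ].
rewrite mean_cst meanZ// mean_sum; last by move=> c _; exact: bm_bool.
have pq0 : 0 <= psi ^+ q.-1 - psi ^+ q.
  by rewrite subr_ge0 ler_wiXn2l// leq_pred.
apply: le_trans (_ : psi ^+ q + (psi ^+ q.-1 - psi ^+ q) * (q%:R * p) <= _).
  rewrite lerD2l ler_wpM2l//.
  apply: le_trans (_ : \sum_(c in S) p <= _); first by apply: ler_sum.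
  by rewrite sumr_const -/q mulr_natl.
have e0 : 0 <= p * (1 - psi) by rewrite mulr_ge0// subr_ge0.
apply: le_trans (bernoulli_pow q psi0 e0).
rewrite lerD2l; case: q {pq0 U bU} => [|q] /=; first by rewrite !mul0r mulr0.
by rewrite le_eqVlt; apply/predU1l; rewrite exprS; ring.
Qed.

End occupancy.

Section interaction.
Context (R : realType) (k n m : nat).
Local Notation TR := (measurableTypeR R).
Local Notation Pt := (k.-tuple TR).
Local Notation U := (unif_cube R k).
Local Notation Law := (locations R k n m).
Local Notation Om := (n.-tuple Pt * m.-tuple Pt)%type.
Variables (z : k.-tuple R -> k.-tuple R -> bool) (gam : R).
Hypothesis mz : measurable_fun setT (fun p : Pt * Pt => z p.1 p.2).

Local Notation good := (fun x => 0 <= x <= gam).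

(** One labelling has to serve all admissible ranges at once, because the exchange compares four
    range vectors. *)
Definition separated (w : Om) (i1 i2 : 'I_n) :=
  exists (ls : 'I_n -> bool) (ld : 'I_m -> bool), ls i1 != ls i2 /\
  forall r : 'I_n -> R, (forall i, good (r i)) ->
  forall i j, range_adj z r w.1 w.2 i j -> ls i = ld j.

(** In a separated configuration the sizes are modular and the four terms cancel. Otherwise each
    mixed vector differs from one with equal entries at [i2] only, which changes the matching size
    by at most one; hence the factor two. *)
Lemma four_term_le (NS : Om -> bool) h (i1 i2 : 'I_n) a b :
  measurable_fun setT NS -> (forall w, ~~ NS w -> separated w i1 i2) ->
  (forall i, good (h i)) -> good a -> good b -> i1 != i2 ->
  mean_matching m z (setf (setf h i1 a) i2 b) +
  mean_matching m z (setf (setf h i1 b) i2 a) -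
  mean_matching m z (setf (setf h i1 a) i2 a) -
  mean_matching m z (setf (setf h i1 b) i2 b) <=
  2 * mean Law (fun w => (NS w)%:R).
Proof.
move=> mNS sep gh ga gb i12.
pose v (c : bool) := if c then a else b.
pose adj (w : Om) c1 c2 := range_adj z (setf (setf h i1 (v c1)) i2 (v c2)) w.1 w.2.
pose F c1 c2 (w : Om) : R := (max_matching (adj w c1 c2))%:R.
have bF c1 c2 : bounded_measurable (F c1 c2) by exact: bm_range_matching.
have -> : mean_matching m z (setf (setf h i1 a) i2 b) = mean Law (F true false) by [].
have -> : mean_matching m z (setf (setf h i1 b) i2 a) = mean Law (F false true) by [].
have -> : mean_matching m z (setf (setf h i1 a) i2 a) = mean Law (F true true) by [].
have -> : mean_matching m z (setf (setf h i1 b) i2 b) = mean Law (F false false) by [].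
rewrite -meanD// -meanB//; last exact: bmD.
rewrite -meanB//; last by apply: bmB => //; exact: bmD.
rewrite -meanZ; last exact: bm_bool.
apply: mean_le.
- by apply: bmB => //; apply: bmB => //; exact: bmD.
- by apply: bmZ; exact: bm_bool.
move=> w; case: (boolP (NS w)) => [_|/sep[ls [ld [ne hl]]]].
  have le1 c1 : F c1 (~~ c1) w <= F c1 c1 w + 1.
    rewrite /F natr1 ler_nat (leq_trans (max_matching_le_without _ i2))// ltnS.
    rewrite (_ : max_matching (without _ i2) =
        max_matching (without (adj w c1 c1) i2)).
      exact: max_matching_without_le.
    apply: eq_max_matching => i j; rewrite /without; case: eqVneq => //= ii.
    by rewrite /adj /range_adj /setf (negbTE ii).
  have aux (x y u t : R) : x <= u + 1 -> y <= t + 1 -> x + y - u - t <= 2 * 1 by lra.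
  exact: aux (le1 true) (le1 false).
have gv c : good (v c) by case: c.
have gr c1 c2 i : good (setf (setf h i1 (v c1)) i2 (v c2) i).
  by rewrite /setf; case: ifP => // _; case: ifP.
have := @max_matching_modular n m (adj w) i1 i2 ls ld.
rewrite mulr0 => E; have {}E := E _ ne _ _.
have aux (x y u t : R) : x + y = u + t -> x + y - u - t <= 0 by lra.
apply: aux.
rewrite /F -!natrD; congr (_%:R); apply: E.
- by move=> b1 b2 i j; apply: hl; exact: gr.
- move=> b1 b2 b2' i j ii; rewrite /adj /range_adj /setf.
  by case: (eqVneq i i2) ii => // _ _.
- move=> b1 b1' b2 i j ii; rewrite /adj /range_adj /setf.
  by rewrite (negbTE ii).
Qed.

Variable c0 : 'I_k.

Lemma mean_close_le (i1 i2 : 'I_n) (wd : R) : i1 != i2 -> 0 <= wd ->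
  mean Law (fun w => (`|tnth (tnth w.1 i1) c0 - tnth (tnth w.1 i2) c0| <= wd)%R%:R)
  <= 2 * wd.
Proof.
move=> i12 w0.
have mc : measurable_fun setT (fun w : Om =>
    `|tnth (tnth w.1 i1) c0 - tnth (tnth w.1 i2) c0| <= wd).
  apply: measurable_fun_ler => //; apply: measurableT_comp => //.
  by apply: measurable_funB; apply: measurable_coord; exact: measurable_supply.
have b := bm_bool R mc.
rewrite (mean_prod2 (pow_prob U n) (pow_prob U m) b).
rewrite -[leRHS](mean_cst (pow_prob U m)); apply: mean_le.
- exact: (bm_mean2 (pow_prob U n) (pow_prob U m) b).
- exact: bm_cst.
move=> d; rewrite (mean_resample U i1 (bm_pair2 d b)).
rewrite -[leRHS](mean_cst (pow_prob U n)); apply: mean_le.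
- exact: (bm_mean1 (pow_prob U n) U (bm_upd i1 (bm_pair2 d b))).
- exact: bm_cst.
move=> s; under eq_mean do rewrite /= !tnth_upd eqxx [i2 == i1]eq_sym (negbTE i12).
pose f (x : TR) := (`|x - tnth (tnth s i2) c0| <= wd)%R%:R : R.
have bf : bounded_measurable f by apply: bm_bool; exact: measurable_near.
rewrite (mean_tnth (uniform_prob (@ltr01 R)) c0 bf).
exact: mean_near_le.
Qed.

End interaction.

(** * Empty slabs of demands between two supplies *)

Section gaps.
Context (R : realType) (k n m : nat).
Local Notation TR := (measurableTypeR R).
Local Notation Pt := (k.-tuple TR).
Local Notation U := (unif_cube R k).
Local Notation Om := (n.-tuple Pt * m.-tuple Pt)%type.
Local Notation all_pairs := (fun _ _ : k.-tuple R => true).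
Variables (c0 : 'I_k) (gam : R).
Local Notation rho := (radius k n gam).
Hypotheses (n_gt0 : (0 < n)%N) (gam_gt0 : 0 < gam).

Let rho_gt0 : 0 < rho. Proof. exact: radius_gt0. Qed.

Lemma range_adj_near z (r : 'I_n -> R) s (d : m.-tuple (k.-tuple R)) i j :
  (forall i, 0 <= r i <= gam) -> range_adj z r s d i j ->
  `|tnth (tnth s i) c0 - tnth (tnth d j) c0| <= rho.
Proof.
move=> rg /andP[h _]; have /andP[r0 rl] := rg i.
by rewrite (le_trans (ler_coord_dist2 _ _ c0))// (le_trans h)// ler_radius.
Qed.

(** One index for each slab of width [2 * rho] that starts inside the unit interval. *)
Let M := (Num.truncn (2 * rho)^-1).+1.

Definition slab (c : 'I_M) (x : k.-tuple R) :=
  (2 * rho * c%:R <= tnth x c0) && (tnth x c0 < 2 * rho * c.+1%:R).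

Lemma measurable_slab c :
  measurable_fun setT (fun x : Pt => slab c (x : k.-tuple R)).
Proof.
have mc : measurable_fun setT (fun x : Pt => tnth x c0 : R).
  exact: (measurable_coord c0 (X := id)).
by apply: measurable_and; [apply: measurable_fun_ler | apply: measurable_fun_ltr].
Qed.

Lemma slab_disj c c' x : slab c x -> slab c' x -> c = c'.
Proof.
move=> /andP[h1 h2] /andP[h3 h4]; apply: val_inj; apply/eqP.
have r0 : 0 < 2 * rho by rewrite mulr_gt0.
have := le_lt_trans h1 h4; have := le_lt_trans h3 h2.
by rewrite !ltr_pM2l// !ltr_nat !ltnS eqn_leq => -> ->.
Qed.

Lemma mean_slab_le c : mean U (fun x => (slab c x)%:R) <= 2 * rho.
Proof.
pose f (x : TR) := (`|x - 2 * rho * (c%:R + 2^-1)| <= rho)%R%:R : R.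
have bf : bounded_measurable f by apply: bm_bool; exact: measurable_near.
apply: (@le_trans _ _ (mean U (fun x => f (tnth x c0)))).
  apply: mean_le.
  - by apply: bm_bool; exact: measurable_slab.
  - by apply: (bm_comp (f := f)) => //; exact: measurable_tnth.
  move=> x; apply: ler_bool => /andP[h1 h2].
  rewrite ler_norml; move: h2; rewrite -(natr1 c) mulrDr mulr1 mulrDr.
  by rewrite (mulrAC 2 rho 2^-1) divff ?pnatr_eq0// mul1r; lra.
rewrite (mean_tnth (uniform_prob (@ltr01 R)) c0 bf).
by apply: mean_near_le; exact: ltW.
Qed.

(** Directed: it holds vacuously when [i1] is to the right of [i2]. The conjunction of both orders
    therefore says that no empty slab lies between the two supplies. *)
Definition no_gap (i1 i2 : 'I_n) (w : Om) := [forall c : 'I_M,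
  ((tnth (tnth w.1 i1) c0 < 2 * rho * c%:R) &&
   (2 * rho * c.+1%:R <= tnth (tnth w.1 i2) c0)) ==>
  [exists j, slab c (tnth w.2 j)]].

(** Supplies are cut at the middle of the empty slab, demands at its left wall. An edge changes the
    coordinate by at most [rho], half of the width, so an edge joining the two sides would need a
    demand inside the slab. *)
Lemma gap_separated i1 i2 w : ~~ no_gap i1 i2 w -> separated all_pairs gam w i1 i2.
Proof.
rewrite negb_forall => /existsP[c]; rewrite negb_imply => /andP[/andP[h1 h2] no].
have r0 := rho_gt0.
exists (fun i => tnth (tnth w.1 i) c0 < 2 * rho * c%:R + rho).
exists (fun j => tnth (tnth w.2 j) c0 < 2 * rho * c%:R).
have S1 : 2 * rho * c.+1%:R = 2 * rho * c%:R + 2 * rho.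
  by rewrite -(natr1 c) mulrDr mulr1.
split.
  have -> : tnth (tnth w.1 i1) c0 < 2 * rho * c%:R + rho.
    by rewrite (lt_trans h1)// ltrDl.
  by rewrite eq_sym eqb_id -leNgt (le_trans _ h2)// S1 lerD2l; lra.
move=> r rg i j /(range_adj_near rg); rewrite ler_norml => /andP[a1 a2].
move/existsPn/(_ j): no; rewrite /slab negb_and -ltNge -leNgt S1.
case: ltP => [lt _|ge /= ge2]; first by apply/idP; lra.
by apply/negbTE; rewrite -leNgt; lra.
Qed.

Lemma measurable_no_gap i1 i2 : measurable_fun setT (no_gap i1 i2).
Proof.
have mS i : measurable_fun setT (fun w : Om => tnth (tnth w.1 i) c0 : R).
  by apply: measurable_coord; exact: measurable_supply.
apply: (@measurable_fun_of_bools _ _ _ _ ('I_M * 'I_m + 'I_M * bool)%type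
  (fun e (w : Om) => match e with inl e => slab e.1 (tnth w.2 e.2)
   | inr (c, b) => if b then tnth (tnth w.1 i1) c0 < 2 * rho * c%:R
       else 2 * rho * c.+1%:R <= tnth (tnth w.1 i2) c0 end)).
  move=> [[c j]|[c []]] /=.
  - apply: (measurableT_comp (f := fun x : Pt => slab c (x : k.-tuple R))).
      exact: measurable_slab.
    exact: measurable_demand.
  - by apply: measurable_fun_ltr.
  - by apply: measurable_fun_ler.
move=> w w' h; apply: eq_forallb => c.
have /= -> := h (inr (c, true)); have /= -> := h (inr (c, false)).
by congr (_ ==> _); apply: eq_existsb => j; exact: (h (inl (c, j))).
Qed.

Lemma mean_no_gap_le (i1 i2 : 'I_n) q : 2 * rho <= 1 ->
  forall s : n.-tuple Pt, in_cube (tnth s i2 : k.-tuple R) ->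
  0 <= tnth (tnth s i1) c0 ->
  2 * rho * q.+1%:R <= tnth (tnth s i2) c0 - tnth (tnth s i1) c0 ->
  mean (pow_prob U m) (fun d => (no_gap i1 i2 (s, d))%:R) <=
  (1 - (1 - 2 * rho) ^+ m) ^+ q.
Proof.
move=> rho1 s /in_cubeP/(_ c0)/andP[_ s21] s10 gap.
have r0 : 0 < 2 * rho by rewrite mulr_gt0.
set x1 := tnth (tnth s i1) c0 in s10 gap *; set x2 := tnth (tnth s i2) c0 in s21 gap *.
(* [x1] lies in slab [t], so the next [q] slabs lie between the supplies; one of the [q.+1] widths
   pays for the partial slab of [x1]. *)
pose t := Num.truncn (x1 / (2 * rho)).
have [t1 t2] : t%:R <= x1 / (2 * rho) /\ x1 / (2 * rho) < t.+1%:R.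
  have x1r : 0 <= x1 / (2 * rho) by rewrite divr_ge0// ltW.
  by have /andP[] := Num.Theory.truncn_itv x1r.
rewrite ler_pdivlMr// in t1; rewrite ltr_pdivrMr// in t2.
have cell_in i : (i < q)%N -> x1 < 2 * rho * (t.+1 + i)%:R /\
    2 * rho * (t.+1 + i).+1%:R <= x2.
  move=> iq; split.
    by rewrite natrD mulrDr mulrC in t2 *; rewrite (lt_le_trans t2)// mulrC lerDl mulr_ge0// ltW.
  apply: le_trans (_ : 2 * rho * (t + q.+1)%:R <= _).
    by rewrite ler_pM2l// ler_nat addSn -!addnS leq_add2l ltnS.
  by rewrite natrD mulrDr [2 * rho * t%:R]mulrC; lra.
have lt_M i : (i < q)%N -> (t.+1 + i < M)%N.
  move=> /cell_in[_ le2]; rewrite /M ltnS.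
  rewrite Num.Theory.truncn_ge_nat ?invr_ge0 ?(ltW r0)//.
  rewrite -[leRHS]mul1r ler_pdivlMr// mulrC (le_trans _ s21)// (le_trans _ le2)//.
  by rewrite ler_pM2l// ler_nat.
pose f (i : 'I_q) : 'I_M := Ordinal (lt_M i (ltn_ord i)).
have fI : injective f by move=> i i' [/addnI]; exact: val_inj.
have psi1 : 0 <= 1 - 2 * rho by rewrite subr_ge0.
pose S := [set f i | i : 'I_q]%SET.
have cS : #|S| = q by rewrite card_imset// card_ord.
have := mean_occupied_le (P := U) (A := slab) (ltW r0) rho1 measurable_slab
  slab_disj mean_slab_le m S.
rewrite cS; apply: le_trans; apply: mean_le.
- by apply: (bm_pair1 s (f := fun w => (no_gap i1 i2 w)%:R));
    apply: bm_bool; exact: measurable_no_gap.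
- by apply: bm_bool; exact: (measurable_occupied measurable_slab).
move=> d; apply: ler_bool => /forallP ng; apply/forall_inP => _ /imsetP[i _ ->].
have [h1 h2] := cell_in i (ltn_ord i).
by have := ng (f i); rewrite /= h1 h2.
Qed.

End gaps.

(** * Probabilities of non-separation and the cost of deleting edges *)

Section error_terms.
Context (R : realType) (k n m : nat).
Local Notation TR := (measurableTypeR R).
Local Notation Pt := (k.-tuple TR).
Local Notation U := (unif_cube R k).
Local Notation Law := (locations R k n m).
Local Notation Om := (n.-tuple Pt * m.-tuple Pt)%type.
Local Notation all_pairs := (fun _ _ : k.-tuple R => true).
Variables (c0 : 'I_k) (gam : R).
Local Notation rho := (radius k n gam).
Hypotheses (n_gt0 : (0 < n)%N) (gam_gt0 : 0 < gam).

Let rho_gt0 : 0 < rho. Proof. exact: radius_gt0. Qed.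

Lemma measurable_supply_out i :
  measurable_fun setT (fun w : Om => ~~ in_cube (tnth w.1 i : k.-tuple R)).
Proof.
by apply: measurable_neg; apply: measurable_in_cube; exact: measurable_supply.
Qed.

Lemma mean_supply (f : Pt -> R) (i : 'I_n) : bounded_measurable f ->
  mean Law (fun w => f (tnth w.1 i)) = mean U f.
Proof.
move=> bf; have b := bm_comp (@measurable_supply R k n m i) bf.
rewrite [LHS](mean_prod2 (pow_prob U n) (pow_prob U m) b).
under eq_mean do rewrite /= (mean_tnth U i bf).
exact: mean_cst.
Qed.

Lemma mean_supply_out i :
  mean Law (fun w => (~~ in_cube (tnth w.1 i : k.-tuple R))%:R) = 0.
Proof.
have mc : measurable_fun setT (fun x : Pt => in_cube (x : k.-tuple R)).
  exact: (measurable_in_cube (X := id)).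
pose f (x : Pt) : R := (~~ in_cube (x : k.-tuple R))%:R.
have bf : bounded_measurable f by apply/bm_bool/measurable_neg.
rewrite (mean_supply i bf).
have -> : mean U f = mean U (fun x => 1 - (in_cube (x : k.-tuple R))%:R).
  by apply: eq_mean => x; rewrite /f; case: in_cube; rewrite ?subrr ?subr0.
rewrite meanB; [|exact: bm_cst|exact: bm_bool].
by rewrite mean_cst unif_cube_in_cube subrr.
Qed.

(** Either the supplies are within [q.+1] slab widths of each other, or one of them is outside the
    cube, which has probability zero, or [q] slabs fit between them and all are occupied. *)
Lemma mean_no_gap2_le (i1 i2 : 'I_n) q : i1 != i2 -> 2 * rho <= 1 ->
  mean Law (fun w => (no_gap c0 gam i1 i2 w && no_gap c0 gam i2 i1 w)%:R) <=
  2 * (2 * rho * q.+1%:R) + (1 - (1 - 2 * rho) ^+ m) ^+ q.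
Proof.
move=> i12 rho1; set psi := 1 - _.
have r0 : 0 < 2 * rho by rewrite mulr_gt0.
have psi0 : 0 <= psi by rewrite subr_ge0 exprn_ile1 ?subr_ge0// gerBl ltW.
have mng i j : measurable_fun setT (fun w : Om => no_gap c0 gam i j w).
  exact: measurable_no_gap.
have bN : bounded_measurable (fun w : Om =>
    (no_gap c0 gam i1 i2 w && no_gap c0 gam i2 i1 w)%:R : R).
  by apply/bm_bool/measurable_and; exact: mng.
pose wd := 2 * rho * q.+1%:R; have wd0 : 0 <= wd by rewrite mulr_ge0// ltW.
pose close (w : Om) := `|tnth (tnth w.1 i1) c0 - tnth (tnth w.1 i2) c0| <= wd.
pose out i (w : Om) := ~~ in_cube (tnth w.1 i : k.-tuple R).
have mc : measurable_fun setT close.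
  apply: measurable_fun_ler => //; apply: measurableT_comp => //.
  by apply: measurable_funB; apply: measurable_coord; exact: measurable_supply.
have bc := bm_bool R mc.
have bo i : bounded_measurable (fun w : Om => (out i w)%:R : R).
  exact: bm_bool (measurable_supply_out i).
have mo i : mean Law (fun w => (out i w)%:R) = 0 by exact: mean_supply_out.
have b1 := bmD bc (bo i1); have b2 := bmD b1 (bo i2).
pose g w : R := (close w)%:R + (out i1 w)%:R + (out i2 w)%:R + psi ^+ q.
have bg : bounded_measurable g.
  exact: bmD b2 (bm_cst _).
have Eg : mean Law g <= 2 * wd + psi ^+ q.
  rewrite (meanD Law b2 (bm_cst _)) (meanD Law b1 (bo i2)) (meanD Law bc (bo i1)).
  by rewrite mean_cst !mo !addr0 lerD2r mean_close_le.
apply: le_trans Eg.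
rewrite [leLHS](mean_prod1 (pow_prob U n) (pow_prob U m) bN).
rewrite [leRHS](mean_prod1 (pow_prob U n) (pow_prob U m) bg).
apply: mean_le.
- exact: (bm_mean1 (pow_prob U n) (pow_prob U m) bN).
- exact: (bm_mean1 (pow_prob U n) (pow_prob U m) bg).
(* [g] does not depend on the demands; the tuple of zeros is a placeholder. *)
move=> s; have -> : mean (pow_prob U m) (fun d => g (s, d)) =
    (close (s, [tuple [tuple 0 | _ < k] | _ < m]))%:R +
    (out i1 (s, [tuple [tuple 0 | _ < k] | _ < m]))%:R +
    (out i2 (s, [tuple [tuple 0 | _ < k] | _ < m]))%:R + psi ^+ q.
  by rewrite -[RHS](mean_cst (pow_prob U m)).
rewrite /close /out /=.
have le1 : mean (pow_prob U m) (fun d =>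
    (no_gap c0 gam i1 i2 (s, d) && no_gap c0 gam i2 i1 (s, d))%:R) <= 1 :> R.
  rewrite -[leRHS](mean_cst (pow_prob U m)); apply: mean_le.
  - exact: (bm_pair1 s bN).
  - exact: bm_cst.
  - by move=> d; case: (_ && _).
have psq : 0 <= psi ^+ q by rewrite exprn_ge0.
case: (boolP (in_cube (tnth s i1))) => [c1|_]; last first.
  have aux (x y t : R) : 0 <= x -> 0 <= y -> 0 <= t -> 1 <= x + 1 + y + t by lra.
  by apply: le_trans le1 _; apply: aux.
case: (boolP (in_cube (tnth s i2))) => [c2|_]; last first.
  have aux (x t : R) : 0 <= x -> 0 <= t -> 1 <= x + 0 + 1 + t by lra.
  by apply: le_trans le1 _; apply: aux.
rewrite /= !addr0; case: (leP _ wd) => [_|]; first by apply: le_trans le1 _; rewrite lerDl.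
rewrite add0r real_lter_normr ?num_real// => /orP[gap|gap].
  apply: le_trans (_ : mean (pow_prob U m) (fun d => (no_gap c0 gam i2 i1 (s, d))%:R) <= _).
    apply: mean_le; first exact: (bm_pair1 s bN).
      exact: (bm_pair1 s (bm_bool R (mng i2 i1))).
    by move=> d; apply: ler_bool => /andP[].
  apply: mean_no_gap_le => //; last exact: ltW.
  by have /in_cubeP/(_ c0)/andP[] := c2.
apply: le_trans (_ : mean (pow_prob U m) (fun d => (no_gap c0 gam i1 i2 (s, d))%:R) <= _).
  apply: mean_le; first exact: (bm_pair1 s bN).
    exact: (bm_pair1 s (bm_bool R (mng i1 i2))).
  by move=> d; apply: ler_bool => /andP[].
apply: mean_no_gap_le => //; first by have /in_cubeP/(_ c0)/andP[] := c1.
by rewrite opprB in gap; exact: ltW.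
Qed.

Lemma separated_sym (z : k.-tuple R -> k.-tuple R -> bool) (w : Om) i1 i2 :
  separated z gam w i1 i2 -> separated z gam w i2 i1.
Proof. by move=> [ls [ld [ne h]]]; exists ls, ld; split=> //; rewrite eq_sym. Qed.

Section grid.
Variable b : nat.
Hypothesis b_gt0 : (0 < b)%N.

Let b_gt0R : 0 < b%:R :> R. Proof. by rewrite ltr0n. Qed.

Definition above (c : 'I_b.+1) (x : k.-tuple R) := c%:R / b%:R <= tnth x c0.

(** Comparing with every wall, rather than slab indices, provides the separating labelling directly:
    any wall at which two supplies differ is one that no remaining edge crosses. *)
Definition same_slab (x y : k.-tuple R) := [forall c, above c x == above c y].

Lemma measurable_above c :
  measurable_fun setT (fun x : Pt => above c (x : k.-tuple R)).
Proof. by apply: measurable_fun_ler => //; exact: (measurable_coord c0 (X := id)). Qed.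

Lemma measurable_same_slab :
  measurable_fun setT (fun p : Pt * Pt => same_slab p.1 p.2).
Proof.
apply: (@measurable_fun_of_bools _ _ _ _ ('I_b.+1 * bool)%type
  (fun e (p : Pt * Pt) => above e.1 (if e.2 then p.1 else p.2))).
  by move=> [c []] /=; apply: (measurableT_comp (measurable_above c)).
move=> p p' h; apply: eq_forallb => c.
by have /= -> := h (c, true); have /= -> := h (c, false).
Qed.

Lemma same_slab_separated (w : Om) i1 i2 :
  ~~ same_slab (tnth w.1 i1) (tnth w.1 i2) -> separated same_slab gam w i1 i2.
Proof.
rewrite negb_forall => /existsP[c ne].
exists (fun i => above c (tnth w.1 i)), (fun j => above c (tnth w.2 j)).
by split=> // r _ i j /andP[_ /forallP/(_ c)/eqP].
Qed.

Lemma same_slab_close x y : in_cube x -> in_cube y -> same_slab x y ->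
  `|tnth x c0 - tnth y c0| <= b%:R^-1.
Proof.
wlog xy : x y / tnth x c0 <= tnth y c0 => [hw xc yc xy|].
  have [le|/ltW le] := leP (tnth x c0) (tnth y c0); first exact: hw.
  rewrite distrC; apply: hw => //; apply/forallP => c; rewrite eq_sym.
  exact: (forallP xy).
move=> /in_cubeP/(_ c0)/andP[x0 _] /in_cubeP/(_ c0)/andP[_ y1] /forallP same.
rewrite distrC ger0_norm ?subr_ge0// leNgt; apply/negP => gap.
(* [t.+1] is the first wall strictly to the right of [x]. *)
pose t := Num.truncn (tnth x c0 * b%:R).
have /andP[t1 t2] : t%:R <= tnth x c0 * b%:R < t.+1%:R.
  by apply: Num.Theory.truncn_itv; rewrite mulr_ge0// ltW.
have ty : t.+1%:R / b%:R <= tnth y c0.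
  rewrite -natr1 mulrDl mul1r -ler_pdivrMr// in t1 *.
  by rewrite ltW// (le_lt_trans _ (_ : tnth x c0 + b%:R^-1 < _)) ?lerD2r//; lra.
have tb : (t.+1 < b.+1)%N.
  rewrite ltnS -(ler_nat R); have := le_trans ty y1.
  by rewrite ler_pdivrMr// mul1r.
have := same (Ordinal tb); rewrite /above /= ty eqb_id.
by rewrite ler_pdivrMr// leNgt t2.
Qed.

Lemma mean_same_slab_le (i1 i2 : 'I_n) : i1 != i2 ->
  mean Law (fun w => (same_slab (tnth w.1 i1) (tnth w.1 i2))%:R) <= 2 / b%:R.
Proof.
move=> i12.
have ms : measurable_fun setT (fun w : Om =>
    same_slab (tnth w.1 i1 : k.-tuple R) (tnth w.1 i2)).
  apply: (measurableT_comp (f := fun p : Pt * Pt => same_slab p.1 p.2)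
    measurable_same_slab (g := fun w : Om => (tnth w.1 i1, tnth w.1 i2))).
  by apply/measurable_fun_pairP; split; exact: measurable_supply.
have mc : measurable_fun setT (fun w : Om =>
    `|tnth (tnth w.1 i1) c0 - tnth (tnth w.1 i2) c0| <= b%:R^-1).
  apply: measurable_fun_ler => //; apply: measurableT_comp => //.
  by apply: measurable_funB; apply: measurable_coord; exact: measurable_supply.
have bc := bm_bool R mc; have bs := bm_bool R ms.
have bo i := bm_bool R (measurable_supply_out i).
apply: le_trans (@mean_close_le R k n m c0 i1 i2 b%:R^-1 i12 _); last by rewrite invr_ge0 ltW.
rewrite -[leRHS]addr0 -(mean_supply_out i1) -meanD//.
rewrite -[leRHS]addr0 -(mean_supply_out i2) -meanD//; last exact: bmD.
apply: mean_le => //; first by apply: bmD => //; exact: bmD.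
move=> w; case: (boolP (in_cube (tnth w.1 i1))) => [c1|_]; last first.
  by case: same_slab; rewrite /= ?addr_ge0// addrAC lerDr addr_ge0.
case: (boolP (in_cube (tnth w.1 i2))) => [c2|_]; last first.
  by case: same_slab; rewrite /= ?addr_ge0// lerDr addr_ge0.
by rewrite !addr0; apply: ler_bool => /same_slab_close; apply.
Qed.

Lemma mean_matching_same_slab_le r :
  mean_matching m same_slab r <= mean_matching (n := n) m all_pairs r.
Proof.
apply: mean_le.
- by apply: bm_range_matching; exact: measurable_same_slab.
- exact: bm_range_matching.
move=> w; rewrite ler_nat; apply: leq_max_matching_sub => i j /andP[h _].
by rewrite /range_adj h.
Qed.

(** Only a supply within [rho] of a wall can lose an edge, and each such supply costs at most one
    matched pair. *)
Lemma mean_matching_le_same_slab (r : 'I_n -> R) : (forall i, 0 <= r i <= gam) ->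
  mean_matching m all_pairs r <=
  mean_matching m same_slab r + n%:R * (b.+1%:R * (2 * rho)).
Proof.
move=> rg.
pose f c (x : TR) : R := (`|x - c%:R / b%:R| <= rho)%R%:R.
have bf c : bounded_measurable (f c) by apply: bm_bool; exact: measurable_near.
have bfx (c : 'I_b.+1) : bounded_measurable (fun x : Pt => f c (tnth x c0)).
  by apply: (bm_comp (f := f c)) => //; exact: measurable_tnth.
have bfw i (c : 'I_b.+1) : bounded_measurable (fun w : Om => f c (tnth (tnth w.1 i) c0)).
  exact: (bm_comp (@measurable_supply R k n m i) (bfx c)).
pose E (w : Om) : R := \sum_(i < n) \sum_(c < b.+1) f c (tnth (tnth w.1 i) c0).
have bE : bounded_measurable E by apply: bm_sum => i _; apply: bm_sum => c _.
apply: le_trans (_ : mean_matching m same_slab r + mean Law E <= _); last first.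
  rewrite lerD2l /E mean_sum; last by move=> i _; apply: bm_sum => c _.
  have -> : n%:R * (b.+1%:R * (2 * rho)) = \sum_(i < n) \sum_(c < b.+1) 2 * rho.
    by rewrite !sum_cst !card_ord.
  apply: ler_sum => i _; rewrite mean_sum//; apply: ler_sum => c _.
  rewrite (mean_supply i (bfx c)) (mean_tnth (uniform_prob (@ltr01 R)) c0 (bf c)).
  by apply: mean_near_le; exact: ltW.
rewrite /mean_matching -meanD//; last first.
  by apply: bm_range_matching; exact: measurable_same_slab.
apply: mean_le.
- exact: bm_range_matching.
- by apply: bmD => //; apply: bm_range_matching; exact: measurable_same_slab.
move=> w.
pose S := [set i : 'I_n | [exists c : 'I_b.+1,
  `|tnth (tnth w.1 i) c0 - c%:R / b%:R| <= rho]]%SET.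
apply: le_trans (_ : (max_matching (range_adj same_slab r w.1 w.2))%:R + #|S|%:R <= _).
  rewrite -natrD ler_nat; apply: max_matching_le_card => i j.
  rewrite inE => /existsPn far adj; move: (adj) => /andP[h _]; rewrite /range_adj h /=.
  have near := range_adj_near c0 n_gt0 rg adj.
  apply/forallP => c; have := far c; rewrite -ltNge /above.
  move: near; set x := tnth _ c0; set y := tnth _ c0; set t := _ / _ => near.
  by case: (leP t x) => h1; case: (leP t y) => h2 //; move: near;
    rewrite lter_norml ltNge ler_norml; lra.
rewrite lerD2l -sum1_card natr_sum big_mkcond/=; apply: ler_sum => i _.
rewrite inE; case: (boolP [exists c, _]) => [/existsP[c h]|_]; last first.
  by rewrite sumr_ge0.
by rewrite (bigD1 c)//= /f h lerDl sumr_ge0.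
Qed.

End grid.

End error_terms.

(** * Comparison with the averaged ranges *)

Section comparison.
Context (R : realType) (k n m : nat).
Local Notation TR := (measurableTypeR R).
Local Notation Pt := (k.-tuple TR).
Local Notation Law := (locations R k n m).
Local Notation Om := (n.-tuple Pt * m.-tuple Pt)%type.
Local Notation all_pairs := (fun _ _ : k.-tuple R => true).
Variables (r : 'I_n -> R) (gam delta c : R).
Local Notation rho := (radius k n gam).
Hypotheses (k_gt0 : (0 < k)%N) (n_gt0 : (0 < n)%N) (gam_gt0 : 0 < gam).
Hypothesis r_gam : forall i, 0 <= r i <= gam.
Hypotheses (radius_small : 12 * rho <= 1) (alpha_ge0 : 0 <= 1 - (6 * rho) ^+ k).
Hypotheses (delta_gt0 : 0 < delta) (delta_le : delta <= curvature k n m gam).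
Hypotheses (c_gt0 : 0 < c) (c_lt : c < gam).
Hypothesis mean_r : \sum_i r i = n%:R * c.

Let rho_gt0 : 0 < rho. Proof. exact: radius_gt0. Qed.

(** The exchange runs in the graph restricted by [z], where supplies can be separated; the averaging
    runs in the full graph, where concavity is available. Deleting edges costs [e1] once, at the
    start; restoring them after the exchange is free, as it can only enlarge matchings. *)
Lemma mean_matching_le_cst (z : k.-tuple R -> k.-tuple R -> bool)
    (NS : 'I_n -> 'I_n -> Om -> bool) (beta e1 : R) :
  measurable_fun setT (fun p : Pt * Pt => z p.1 p.2) ->
  (forall h, mean_matching m z h <= mean_matching (n := n) m all_pairs h) ->
  mean_matching m all_pairs r <= mean_matching m z r + e1 ->
  (forall i1 i2, measurable_fun setT (NS i1 i2)) ->
  (forall i1 i2 w, ~~ NS i1 i2 w -> separated z gam w i1 i2) ->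
  (forall i1 i2, i1 != i2 -> mean Law (fun w => (NS i1 i2 w)%:R) <= beta) ->
  0 <= beta ->
  mean_matching m all_pairs r <=
  mean_matching m all_pairs (fun _ : 'I_n => c) - delta / 4 * \sum_i (r i - c) ^+ 2 +
  n%:R * beta + e1.
Proof.
move=> mz le_all near mNS sepNS NS_le beta0; apply: le_trans near _; rewrite lerD2r.
have n0R : 0 < n%:R :> R by rewrite ltr0n.
pose good (x : R) := 0 <= x <= gam.
have good_c : good c by rewrite /good !ltW.
have two0 : 0 <= 2 * beta by rewrite mulr_ge0.
apply: le_trans (le_iid_mean (Phi := mean_matching m z) (r := r) n_gt0
  (good := fun x => good x) r_gam two0 _ _) _.
- by move=> s; exact: mean_matching_perm.
- move=> h i1 i2 a b gh ga gb i12.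
  apply: le_trans (four_term_le mz (mNS i1 i2) (sepNS i1 i2) gh ga gb i12) _.
  by rewrite ler_pM2l// NS_le.
have -> : 2 * beta / 2 = beta by field.
rewrite lerD2r.
apply: le_trans (iid_mean_le n_gt0 (fun f => le_all (r \o f))) _.
set S := delta / 4 * _.
have -> : S = n%:R * (n%:R^-1 * S) by rewrite mulrA mulfV ?mul1r ?gt_eqF.
apply: (iid_mean_le_cst n_gt0 (good := fun x => good x)) => // h i gh.
have setE x := @mean_matching_setf R k n m i h x.
rewrite setE; under eq_bigr do rewrite setE.
rewrite big_split/= sum_cst card_ord mulrDr mulrA mulVf ?mul1r ?gt_eqF//.
rewrite -addrA lerD2l.
exact: (gain_jensen i k_gt0 n_gt0 gam_gt0 gh radius_small alpha_ge0 delta_gt0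
  delta_le n_gt0 c_gt0 c_lt r_gam mean_r).
Qed.

End comparison.

Section comparison_cases.
Context (R : realType) (k n m : nat).
Local Notation all_pairs := (fun _ _ : k.-tuple R => true).
Variables (r : 'I_n -> R) (gam delta c : R) (c0 : 'I_k).
Local Notation rho := (radius k n gam).
Hypotheses (n_gt0 : (0 < n)%N) (gam_gt0 : 0 < gam).
Hypothesis r_gam : forall i, 0 <= r i <= gam.
Hypotheses (radius_small : 12 * rho <= 1) (alpha_ge0 : 0 <= 1 - (6 * rho) ^+ k).
Hypotheses (delta_gt0 : 0 < delta) (delta_le : delta <= curvature k n m gam).
Hypotheses (c_gt0 : 0 < c) (c_lt : c < gam).
Hypothesis mean_r : \sum_i r i = n%:R * c.

Let rho_gt0 : 0 < rho. Proof. exact: radius_gt0. Qed.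
Let k_gt0 : (0 < k)%N. Proof. by case: k c0 => [[]|]. Qed.

Lemma mean_matching_le_cst_gap q :
  mean_matching m all_pairs r <=
  mean_matching m all_pairs (fun _ : 'I_n => c) - delta / 4 * \sum_i (r i - c) ^+ 2 +
  n%:R * (2 * (2 * rho * q.+1%:R) + (1 - (1 - 2 * rho) ^+ m) ^+ q).
Proof.
have rho1 : 2 * rho <= 1 by have := radius_small; have := rho_gt0; lra.
rewrite -[leRHS]addr0.
apply: (mean_matching_le_cst k_gt0 n_gt0 gam_gt0 r_gam radius_small alpha_ge0
  delta_gt0 delta_le c_gt0 c_lt mean_r (z := all_pairs)
  (NS := fun i1 i2 w => no_gap c0 gam i1 i2 w && no_gap c0 gam i2 i1 w)) => //.
- by rewrite addr0.
- by move=> i1 i2; apply: measurable_and; exact: measurable_no_gap.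
- move=> i1 i2 w; rewrite negb_and => /orP[gap|gap]; first exact: gap_separated gap.
  apply: separated_sym; exact: gap_separated gap.
- by move=> i1 i2 i12; exact: mean_no_gap2_le.
- rewrite addr_ge0//; first by rewrite !mulr_ge0 ?ltW.
  by rewrite exprn_ge0// subr_ge0 exprn_ile1 ?subr_ge0// gerBl mulr_ge0// ltW.
Qed.

Lemma mean_matching_le_cst_slab b : (0 < b)%N ->
  mean_matching m all_pairs r <=
  mean_matching m all_pairs (fun _ : 'I_n => c) - delta / 4 * \sum_i (r i - c) ^+ 2 +
  n%:R * (2 / b%:R) + n%:R * (b.+1%:R * (2 * rho)).
Proof.
move=> b0.
have ms := @measurable_same_slab R k c0 b.
apply: (mean_matching_le_cst k_gt0 n_gt0 gam_gt0 r_gam radius_small alpha_ge0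
  delta_gt0 delta_le c_gt0 c_lt mean_r ms
  (NS := fun i1 i2 w => same_slab c0 b (tnth w.1 i1) (tnth w.1 i2))) => //.
- by move=> h; exact: mean_matching_same_slab_le.
- exact: mean_matching_le_same_slab.
- move=> i1 i2.
  apply: (measurableT_comp ms (g := fun w : n.-tuple _ * m.-tuple _ => (tnth w.1 i1, tnth w.1 i2))).
  by apply/measurable_fun_pairP; split; exact: measurable_supply.
- by move=> i1 i2 w; exact: same_slab_separated.
- by move=> i1 i2; exact: mean_same_slab_le.
Qed.

End comparison_cases.

(** * Numerical estimates and the choice of parameters *)

Section estimates.
Context (R : realType).

Lemma expRN_le_subr (t : R) : 0 <= t -> t <= 2^-1 -> expR (- (2 * t)) <= 1 - t.
Proof.
move=> t0 t1; rewrite expRN -[leLHS]mul1r ler_pdivrMr ?expR_gt0//.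
apply: le_trans (_ : (1 - t) * (1 + 2 * t) <= _).
  have h : 0 <= t * (1 - 2 * t) by rewrite mulr_ge0//; lra.
  by lra.
by rewrite ler_wpM2l ?expR_ge1Dx//; lra.
Qed.

Lemma expr_subr_ge (a n p : R) m : 0 <= a -> 0 < n -> 2 * a <= n -> m%:R = p * n ->
  expR (- (2 * a * p)) <= (1 - a / n) ^+ m.
Proof.
move=> a0 n0 an mp.
have t0 : 0 <= a / n by rewrite divr_ge0// ltW.
have t1 : a / n <= 2^-1 by rewrite ler_pdivrMr//; lra.
have -> : - (2 * a * p) = - (2 * (a / n)) * m%:R.
  by rewrite mp; field; rewrite gt_eqF.
rewrite expRM_natr lerXn2r ?nnegrE ?expR_ge0 ?expRN_le_subr//.
by rewrite subr_ge0; lra.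
Qed.

(** Cube the inequality [x / 3 <= expR (x / 3)]. *)
Lemma cube_expRN_le (x : R) : 0 < x -> x ^+ 3 * expR (- x) <= 27.
Proof.
move=> x0; rewrite expRN ler_pdivrMr ?expR_gt0//.
have -> : expR x = expR (x / 3) ^+ 3.
  by rewrite -expRM_natr; congr expR; field.
have -> : x ^+ 3 = 27 * (x / 3) ^+ 3 by field.
rewrite ler_wpM2l// lerXn2r ?nnegrE ?expR_ge0//; first by rewrite divr_ge0// ltW.
by apply: le_trans (expR_ge1Dx _); rewrite lerDr.
Qed.

(** Sum the tangent inequality [2 theta |v i| - theta ^+ 2 <= v i ^+ 2]. *)
Lemma sum_sqr_gt n (v : 'I_n -> R) (theta : R) : 0 < theta ->
  theta * n%:R < \sum_i `|v i| -> theta ^+ 2 * n%:R < \sum_i v i ^+ 2.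
Proof.
move=> t0 lt.
have : \sum_i (2 * theta * `|v i| - theta ^+ 2) <= \sum_i v i ^+ 2.
  apply: ler_sum => i _; rewrite -[v i ^+ 2]real_normK ?num_real//.
  by have := sqr_ge0 (`|v i| - theta); rewrite sqrrB; lra.
rewrite sumrB -mulr_sumr sum_cst card_ord; apply: lt_le_trans.
have : theta * (theta * n%:R) < theta * (\sum_i `|v i|) by rewrite ltr_pM2l.
by move: (\sum_i _) => x; lra.
Qed.

(** If [c] were not strictly inside, all deviations [r i - c] would have the same sign; as they sum
    to zero, all would vanish. The supporting line in Jensen's inequality is taken at such an
    interior [c]. *)
Lemma mean_bounds n (r : 'I_n -> R) (gam c : R) : (forall i, 0 <= r i <= gam) ->
  \sum_i r i = n%:R * c -> 0 < \sum_i `|r i - c| -> 0 < c < gam.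
Proof.
move=> rg rc pos.
have sum0 : \sum_i (r i - c) = 0 by rewrite sumrB rc sum_cst card_ord subrr.
apply/andP; split; rewrite ltNge; apply: contraTN pos => bound; rewrite -leNgt.
  rewrite (eq_bigr (fun i => r i - c)) ?sum0// => i _.
  by have /andP[r0 _] := rg i; rewrite ger0_norm// subr_ge0 (le_trans bound).
rewrite (eq_bigr (fun i => - (r i - c))) ?sumrN ?sum0 ?oppr0// => i _.
by have /andP[_ r1] := rg i; rewrite ler0_norm// subr_le0 (le_trans r1).
Qed.

Section parameters.
Variables (k : nat) (xi gam : R).
Hypotheses (k_gt0 : (0 < k)%N) (xi_gt0 : 0 < xi) (gam_ge1 : 1 <= gam).

Let gam_gt0 : 0 < gam. Proof. exact: lt_le_trans gam_ge1. Qed.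

(* The value of [curvature] with [alpha] replaced by its exponential lower
   bound, which makes it independent of [n]. *)
Definition curvature_bound : R := xi ^+ 2 / 2 * (2^-1 ^+ k *
  (expR (- (2 * (6 ^+ k * gam) * (1 + xi))) * ((2 / k%:R) ^+ k ^+ 2 / 2))).

Lemma curvature_bound_gt0 : 0 < curvature_bound.
Proof.
have kR : 0 < k%:R :> R by rewrite ltr0n.
by rewrite /curvature_bound; do ?[apply: mulr_gt0 | apply: exprn_gt0 | exact: expR_gt0
  | rewrite invr_gt0].
Qed.

Variables n m : nat.
Hypotheses (n_gt0 : (0 < n)%N) (mE : m%:R = xi * n%:R).
Hypothesis n_large : 12 ^+ k * gam <= n%:R.
Local Notation rho := (radius k n gam).

Let n_gt0R : 0 < n%:R :> R. Proof. by rewrite ltr0n. Qed.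
Let rho_gt0 : 0 < rho. Proof. exact: radius_gt0. Qed.

Lemma expr_radius (x : R) : (x * rho) ^+ k = x ^+ k * gam / n%:R.
Proof. by rewrite exprMn radiusK ?ltW// mulrA. Qed.

Lemma radius_small : 12 * rho <= 1.
Proof.
have rho12 : 0 <= 12 * rho by rewrite mulr_ge0// ltW.
by rewrite -(expr_le1 k_gt0 rho12) expr_radius ler_pdivrMr// mul1r.
Qed.

Let radius_half : 2 * rho <= 1.
Proof. by have := radius_small; have := rho_gt0; move: rho => x; lra. Qed.

Let six_le : 2 * (6 ^+ k * gam) <= n%:R.
Proof.
apply: le_trans n_large; rewrite mulrA ler_pM2r//.
rewrite [leRHS](_ : _ = 2 ^+ k * 6 ^+ k); last by rewrite -exprMn; congr (_ ^+ k); ring.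
by rewrite ler_pM2r ?exprn_gt0// ler_eXnr// ler1n.
Qed.

Lemma alpha_ge0 : 0 <= 1 - (6 * rho) ^+ k.
Proof.
rewrite subr_ge0 expr_radius ler_pdivrMr// mul1r (le_trans _ six_le)//.
by rewrite ler_peMl ?ler1n// mulr_ge0 ?exprn_ge0// ltW.
Qed.

Lemma curvature_bound_le : 2 <= xi * n%:R -> curvature_bound <= curvature k n m gam.
Proof.
rewrite -mE => m2; rewrite /curvature_bound /curvature.
have m2N : (2 <= m)%N by rewrite -(ler_nat R).
have pos : 0 <= (2 / k%:R) ^+ k ^+ 2 / 2 :> R by rewrite divr_ge0// sqr_ge0.
apply: ler_pM.
- by rewrite divr_ge0// sqr_ge0.
- by rewrite !mulr_ge0 ?exprn_ge0 ?expR_ge0// invr_ge0.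
- have -> : xi = m%:R / n%:R by rewrite mE mulfK ?gt_eqF.
  rewrite expr_div_n mulrAC ler_pM2r ?invr_gt0 ?exprn_gt0//.
  rewrite natrM expr2 -mulrA ler_pM2l ?(lt_le_trans _ m2)//.
  case: (m) m2N => [//|[//|p]] _ /=; rewrite ler_pdivrMr// -natrM ler_nat.
  by rewrite muln2 -addnn addSn -addnS leq_addl.
rewrite ler_wpM2l ?exprn_ge0// [leRHS]mulrA -exprD ler_wpM2r// expr_radius.
apply: expr_subr_ge; rewrite ?mulr_ge0 ?exprn_ge0 ?(ltW gam_gt0)//.
by rewrite natrD mE; ring.
Qed.

Lemma deviation_rate_gt0 : expR 1 <= n%:R :> R -> 0 < deviation_rate R k n.
Proof.
move=> n_exp; rewrite /deviation_rate; case: ifP => _; apply: powR_gt0.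
  by rewrite divr_gt0// ln_gt0// (lt_le_trans _ n_exp)// expR_gt1.
by rewrite invr_gt0.
Qed.

(** The first term pays for supplies that are close together, the second for distant supplies with
    no empty slab between them. The exponential is a lower bound for the probability that an
    interval of width [2 * gam / n] is empty. *)
Definition gap_constant : R := 8 * gam + 8 * 27 / expR (- (4 * gam * xi)) ^+ 3.

Lemma gap_constant_gt0 : 0 < gap_constant.
Proof. by rewrite addr_gt0 ?mulr_gt0// invr_gt0 exprn_gt0// expR_gt0. Qed.

(** With [q] about [n^(1/3)], the cost of close supplies is of order [q], which fits the target,
    while the probability that [q] slabs are all occupied decays exponentially in [q] and absorbs
    the factor [n <= 8 q^3]. *)
Lemma gap_error_le : k = 1 -> expR 1 <= n%:R :> R -> exists q,
  n%:R * (2 * (2 * rho * q.+1%:R) + (1 - (1 - 2 * rho) ^+ m) ^+ q) <=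
  gap_constant * (deviation_rate R k n ^+ 2 * n%:R).
Proof.
move=> k1 n_exp; have := deviation_rate_gt0 n_exp.
rewrite (_ : deviation_rate R k n = (ln n%:R / n%:R) `^ 3^-1); last first.
  by rewrite /deviation_rate k1.
set D := _ `^ _ => D0.
have D3 : D ^+ 3 = ln n%:R / n%:R.
  by rewrite /D powR_rootK// divr_ge0 ?ln_ge0 ?ler1n.
have ln1 : 1 <= ln n%:R :> R by rewrite -[leLHS]expRK ler_ln ?posrE ?expR_gt0.
pose y : R := n%:R^-1 `^ 3%:R^-1.
have y0 : 0 < y by rewrite powR_gt0// invr_gt0.
have y3 : y ^+ 3 = n%:R^-1 by rewrite /y powR_rootK// invr_ge0.
(* Here [ln n >= 1] enters: [y] is [n^(-1/3)], and [D] has the additional factor [(ln n)^(1/3)]. *)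
have yD : y <= D.
  rewrite -(@ler_pXn2r _ 3)// ?nnegrE ?(ltW y0) ?(ltW D0)// y3 D3.
  by rewrite -[leLHS]mul1r ler_pM2r// invr_gt0.
have rhoE : rho = gam / n%:R by have := expr_radius 1; rewrite k1 !expr1 !mul1r.
have yV1 : 1 <= y^-1.
  rewrite invf_ge1// -(@expr_le1 _ 3) ?(ltW y0)// y3 invf_le1// ler1n//.
have yn : y ^+ 2 * n%:R = y^-1.
  by rewrite -[n%:R]invrK -y3; field; rewrite gt_eqF.
pose q := Num.truncn y^-1; exists q.
have /andP[qy yq] : q%:R <= y^-1 < q.+1%:R.
  by apply: Num.Theory.truncn_itv; rewrite invr_ge0 ltW.
have q1 : (1 <= q)%N by rewrite -ltnS -(ltr_nat R) (le_lt_trans yV1).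
have q1R : 1 <= q%:R :> R by rewrite ler1n.
have q0R : 0 < q%:R :> R by rewrite ltr0n.
have q2 : q.+1%:R <= 2 * q%:R :> R by rewrite -natr1; lra.
have nq : n%:R <= 8 * q%:R ^+ 3 :> R.
  rewrite (_ : 8 * q%:R ^+ 3 = (2 * q%:R) ^+ 3); last by ring.
  rewrite -[n%:R]invrK -y3 -exprVn lerXn2r ?nnegrE ?invr_ge0 ?(ltW y0) ?mulr_ge0//.
  exact: le_trans (ltW yq) q2.
apply: le_trans (_ : gap_constant * y^-1 <= _); last first.
  rewrite -yn ler_pM2l ?gap_constant_gt0// ler_pM2r//.
  by rewrite lerXn2r ?nnegrE ?(ltW y0) ?(ltW D0).
set e := expR (- (4 * gam * xi)); have e0 : 0 < e by exact: expR_gt0.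
rewrite /gap_constant -/e rhoE [leLHS]mulrDr [leRHS]mulrDl; apply: lerD.
  rewrite [leLHS](_ : _ = 4 * gam * q.+1%:R); last by field; rewrite gt_eqF.
  apply: le_trans (_ : 4 * gam * (2 * q%:R) <= _); first by rewrite ler_pM2l ?mulr_gt0.
  by rewrite mulrA [_ * gam * 2]mulrAC -natrM ler_pM2l ?mulr_gt0.
have psi : (1 - (1 - 2 * (gam / n%:R)) ^+ m) ^+ q <= expR (- (e * q%:R)).
  rewrite -[- (e * _)]mulNr expRM_natr lerXn2r ?nnegrE ?expR_ge0//.
    by rewrite -rhoE subr_ge0 exprn_ile1 ?subr_ge0 ?gerBl ?mulr_ge0 ?(ltW rho_gt0).
  apply: le_trans (expR_ge1Dx _); rewrite lerD2l lerN2 mulrA.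
  rewrite /e (_ : 4 * gam = 2 * (2 * gam)); last by ring.
  apply: expr_subr_ge => //; first by rewrite mulr_ge0// ltW.
  apply: le_trans n_large; by rewrite k1 expr1 mulrA ler_pM2r// -natrM ler_nat.
apply: le_trans (_ : 8 * q%:R ^+ 3 * expR (- (e * q%:R)) <= _).
  apply: ler_pM => //; rewrite -rhoE.
  by rewrite exprn_ge0// subr_ge0 exprn_ile1 ?subr_ge0 ?gerBl ?mulr_ge0 ?(ltW rho_gt0).
have -> : 8 * q%:R ^+ 3 * expR (- (e * q%:R)) =
    8 / e ^+ 3 * ((e * q%:R) ^+ 3 * expR (- (e * q%:R))).
  by move: (expR _) => E; field; rewrite gt_eqF.
apply: le_trans (_ : 8 / e ^+ 3 * 27 <= _).
  by rewrite ler_pM2l ?divr_gt0 ?exprn_gt0// cube_expRN_le// mulr_gt0.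
rewrite mulrAC ler_peMr// divr_ge0// exprn_ge0// ltW//.
Qed.

(** Taking [b] about [rho^(-1/2)] balances the chance of sharing a slab, of order [1 / b], against
    the volume near the walls, of order [b * rho]. *)
Lemma slab_error_le : k != 1 -> expR 1 <= n%:R :> R -> exists2 b, (0 < b)%N &
  n%:R * (2 / b%:R) + n%:R * (b.+1%:R * (2 * rho)) <=
  8 * gam * (deviation_rate R k n ^+ 2 * n%:R).
Proof.
move=> k1 n_exp; have := deviation_rate_gt0 n_exp.
rewrite /deviation_rate (negbTE k1); set D := _ `^ _ => D0.
have DE : D ^+ (4 * k.+1) = n%:R^-1 by rewrite /D powR_rootK// invr_ge0.
pose s := Num.sqrt rho; have s0 : 0 < s by rewrite sqrtr_gt0.
have s2 : s ^+ 2 = rho by rewrite sqr_sqrtr// ltW.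
have s1 : s <= 1.
  rewrite -(@expr_le1 _ 2) ?(ltW s0)// s2 (le_trans _ radius_half)//.
  by rewrite ler_peMl ?ler1n// ltW.
have D1 : D <= 1.
  by rewrite -(@expr_le1 _ (4 * k.+1)) ?(ltW D0)// DE invf_le1// ler1n.
(* Raised to the power [2 * k], the left side is [gam / n = gam * D ^+ (4 * k.+1)] and the right
   side is [gam ^+ (2 * k) * D ^+ (4 * k)]; both [D <= 1] and [gam >= 1] help. *)
have sD : s <= gam * D ^+ 2.
  rewrite -(@ler_pXn2r _ (2 * k)) ?nnegrE ?muln_gt0 ?(ltW s0) ?mulr_ge0 ?(ltW gam_gt0) ?exprn_ge0 ?(ltW D0)//.
  rewrite exprM s2 radiusK ?(ltW gam_gt0)// exprMn -exprM.
  apply: ler_pM => //; rewrite ?invr_ge0 ?(ltW gam_gt0)//.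
    by rewrite ler_eXnr// muln_gt0.
  rewrite -DE (_ : 4 * k.+1 = 4 + 2 * (2 * k))%N; last by rewrite mulnS mulnA.
  by rewrite exprD ler_piMl ?exprn_ge0 ?(ltW D0)// exprn_ile1// ltW.
have sV1 : 1 <= s^-1 by rewrite invf_ge1.
pose b := Num.truncn s^-1.
have /andP[bs sb] : b%:R <= s^-1 < b.+1%:R.
  by apply: Num.Theory.truncn_itv; rewrite invr_ge0 ltW.
have b1 : (0 < b)%N by rewrite -ltnS -(ltr_nat R) (le_lt_trans sV1).
have b1R : 1 <= b%:R :> R by rewrite ler1n.
have b0R : 0 < b%:R :> R by rewrite ltr0n.
have b2 : b.+1%:R <= 2 * b%:R :> R by rewrite -natr1; lra.
exists b => //; rewrite -mulrDr.
apply: le_trans (_ : n%:R * (8 * s) <= _); last first.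
  rewrite [leRHS](_ : _ = n%:R * (8 * (gam * D ^+ 2))); last by ring.
  by rewrite ler_pM2l// ler_pM2l.
rewrite ler_pM2l// (_ : 8 * s = 4 * s + 4 * s); last by ring.
apply: lerD.
  rewrite ler_pdivrMr//.
  have : 1 <= s * (2 * b%:R) by rewrite -ler_pdivrMl// mulr1 (le_trans (ltW sb)).
  by lra.
apply: le_trans (_ : 2 * s^-1 * (2 * rho) <= _).
  rewrite ler_pM2r ?mulr_gt0// (le_trans b2)// ler_pM2l//.
by rewrite -s2 [leLHS](_ : _ = 4 * s)//; field; rewrite gt_eqF.
Qed.

End parameters.

End estimates.

Theorem corollary1 (R : realType) (k : nat) (xi gamma : R) :
  (1 <= k)%N -> 0 < xi -> Num.max 1 xi^-1 <= gamma ->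
  exists2 C : R, 0 < C &
  exists N : nat, forall n m : nat, (N <= n)%N -> m%:R = xi * n%:R ->
  forall r : 'rV[R]_n, (forall i, 0 <= r ord0 i <= gamma) ->
  let rbar : 'rV[R]_n := const_mx (l1norm r / n%:R) in
  forall theta : R, C * deviation_rate R k n < theta ->
  theta * n%:R < l1norm (r - rbar) ->
  (mu k m r < mu k m rbar)%E.
Proof.
move=> k0 xi0; rewrite ge_max => /andP[gam1 _].
have gam0 : 0 < gamma by exact: lt_le_trans gam1.
pose delta := curvature_bound k xi gamma.
have d0 : 0 < delta by exact: curvature_bound_gt0.
pose A := gap_constant xi gamma.
have A0 : 0 < A by exact: gap_constant_gt0.
have gap_slab : 8 * gamma <= A by rewrite lerDl divr_ge0// exprn_ge0// expR_ge0.
(* Chosen so that [delta / 4 * C] exceeds the error coefficient [A]; the square of [C] that comes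
   from the variance is at least [C] because [C >= 1]. *)
exists (1 + 4 * A / delta); first by rewrite addr_gt0// divr_gt0// mulr_gt0.
(* The three summands ensure small radii ([12 * rho <= 1]), at least two demands, and a logarithm of
   at least one. *)
exists (Num.truncn (12 ^+ k * gamma + 2 / xi + expR 1)).+1 => n m nN mE r rg rbar theta.
have n0 : (0 < n)%N by exact: leq_trans nN.
have n0R : 0 < n%:R :> R by rewrite ltr0n.
have n_large : 12 ^+ k * gamma + 2 / xi + expR 1 <= n%:R.
  by rewrite ltW// (lt_le_trans (Num.Theory.truncnS_gt _))// ler_nat.
have a0 : 0 <= 12 ^+ k * gamma by rewrite mulr_ge0 ?exprn_ge0// ltW.
have x0 : 0 <= 2 / xi by rewrite divr_ge0// ltW.
have e0 : 0 <= expR 1 :> R by exact: expR_ge0.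
have n1 : 12 ^+ k * gamma <= n%:R by lra.
have n2 : 2 <= xi * n%:R.
  by rewrite -ler_pdivrMl// mulrC; lra.
have n3 : expR 1 <= n%:R :> R by lra.
set C := 1 + _ => thetaC dev.
pose c := l1norm r / n%:R.
have rc : \sum_i r ord0 i = n%:R * c.
  rewrite mulrC divfK ?gt_eqF//; apply: eq_bigr => i _.
  by have /andP[? _] := rg i; rewrite ger0_norm.
have devE : l1norm (r - rbar) = \sum_i `|r ord0 i - c|.
  by apply: eq_bigr => i _; rewrite !mxE.
rewrite devE in dev.
set D := deviation_rate R k n in thetaC.
have D0 : 0 < D by exact: deviation_rate_gt0.
have C1 : 1 <= C by rewrite lerDl divr_ge0 ?mulr_ge0// ltW.
have C0 : 0 < C by exact: lt_le_trans C1.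
have theta0 : 0 < theta by apply: lt_trans thetaC; exact: mulr_gt0.
have sq := sum_sqr_gt theta0 dev.
have /andP[c0 cg] : 0 < c < gamma.
  by apply: (mean_bounds rg rc); apply: lt_trans dev; exact: mulr_gt0.
have small := radius_small k0 gam1 n0 n1.
have alpha0 := alpha_ge0 k0 gam1 n0 n1.
have dc := curvature_bound_le k0 gam1 n0 mE n1 n2.
have err : A * (D ^+ 2 * n%:R) < delta / 4 * \sum_i (r ord0 i - c) ^+ 2.
  apply: lt_trans (_ : delta / 4 * (theta ^+ 2 * n%:R) < _); last first.
    by rewrite ltr_pM2l// divr_gt0.
  rewrite [ltLHS]mulrA [ltRHS]mulrA ltr_pM2r//.
  apply: lt_trans (_ : delta / 4 * (C * D) ^+ 2 < _); last first.
    by rewrite ltr_pM2l ?divr_gt0// ltrXn2r// ltW// mulr_gt0.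
  rewrite exprMn [ltRHS]mulrA ltr_pM2r ?exprn_gt0//.
  apply: lt_le_trans (_ : delta / 4 * C <= _).
    have -> : delta / 4 * C = delta / 4 + A by rewrite /C; field; rewrite gt_eqF.
    by rewrite ltrDr divr_gt0.
  by rewrite ler_pM2l ?divr_gt0// ler_eXnr.
rewrite !mu_mean_matching lte_fin.
have -> : rbar ord0 = fun=> c by apply/funext => i; rewrite mxE.
have conclude (x y S e1 e2 : R) : x <= y - S + e1 -> e1 <= e2 -> e2 < S -> x < y by lra.
pose c1 : 'I_k := Ordinal k0.
case: (eqVneq k 1) => [k1|k1].
  have [q qE] := gap_error_le k0 gam1 n0 mE n1 k1 n3.
  apply: conclude _ qE err.
  exact: (mean_matching_le_cst_gap c1 n0 gam0 rg small alpha0 d0 dc c0 cg rc q).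
have [b b0 bE] := slab_error_le k0 gam1 n0 n1 k1 n3.
apply: conclude _ (le_trans bE _) err; last first.
  by rewrite ler_pM2r// mulr_gt0// exprn_gt0.
rewrite addrA.
exact: (mean_matching_le_cst_slab c1 n0 gam0 rg small alpha0 d0 dc c0 cg rc b0).
Qed.
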